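(* Let $f(\boldsymbol{x},\boldsymbol{u})\in\mathcal{S}(\mathbb{R}^{2n})$, let $\bar P$ be the photography transform defined in the context with dual operator $\bar P^*$, and denote $$\bar P^*_\beta g=\bar P^*\Big(\prod_{i=1}^n\big(\alpha_i^2+(1-\alpha_i)^2\big)^{-\beta/2}g\Big).$$ Then for any $\beta<2$, $$f=\bar I_c^{-\beta}\bar P^*_\beta\bar I^{\beta-1}g,\qquad g=\bar Pf.$$
   Context: Points of $\mathbb{R}^{2n}$ are $(\boldsymbol{x},\boldsymbol{u})$ with $\boldsymbol{x},\boldsymbol{u}\in\mathbb{R}^n$; Fourier variables are $(\xi_{\boldsymbol{x}},\xi_{\boldsymbol{u}})$; the Fourier transform is $\hat h(\xi)=\int e^{-2\pi iy\cdot\xi}h(y)\,dy$. Transform $\bar P$: for $f\in\mathcal{S}(\mathbb{R}^{2n})$, $\boldsymbol{\alpha}=(\alpha_1,\dots,\alpha_n)\in(\mathbb{R}\setminus\{0\})^n$, $\bar{\boldsymbol{x}}\in\mathbb{R}^n$, $$\bar Pf(\boldsymbol{\alpha},\bar{\boldsymbol{x}})=\Big(\prod_{i=1}^n|\alpha_i|\Big)^{-1}\int_{\mathbb{R}^n}f\Big(\big(\tfrac1{\alpha_i}\bar x_i+(1-\tfrac1{\alpha_i})u_i\big)_{i=1}^n,\boldsymbol{u}\Big)d\boldsymbol{u},$$ equivalently (and for all $\boldsymbol{\alpha}\in\mathbb{R}^n$) $\bar Pf(\boldsymbol{\alpha},\bar{\boldsymbol{x}})=\iint f(\boldsymbol{x},\boldsymbol{u})\,\delta\big((\alpha_ix_i+(1-\alpha_i)u_i-\bar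 x_i)_{i=1}^n\big)\,d\boldsymbol{x}\,d\boldsymbol{u}$, $\delta$ the Dirac delta on $\mathbb{R}^n$. Dual operator: $$(\bar P^*g)(\boldsymbol{x},\boldsymbol{u})=\int_{\mathbb{R}^n}g\big(\boldsymbol{\alpha},(\alpha_ix_i+(1-\alpha_i)u_i)_{i=1}^n\big)\,d\boldsymbol{\alpha}.$$ Operators defined by Fourier multipliers, for $\beta<2$: $$(\bar I_c^\beta f)^{\wedge}(\xi_{\boldsymbol{x}},\xi_{\boldsymbol{u}})=\prod_{i=1}^n\|(\xi_{x_i},\xi_{u_i})\|^{-\beta}\hat f(\xi_{\boldsymbol{x}},\xi_{\boldsymbol{u}}),\qquad(\bar I^\beta g)^{\wedge}(\boldsymbol{\alpha},\xi_{\bar{\boldsymbol{x}}})=\prod_{i=1}^n|\xi_{\bar x_i}|^{-\beta}\hat g(\boldsymbol{\alpha},\xi_{\bar{\boldsymbol{x}}}),$$ where for functions $g(\boldsymbol{\alpha},\bar{\boldsymbol{x}})$ the Fourier transform is in $\bar{\boldsymbol{x}}$ only. $\bar I_c^{-\beta}$ is given by the same multiplier formula, so that $\bar I_c^{-\beta}\bar I_c^{\beta}f=f$. *)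

(* Defs.v *)
From HB Require Import structures.
From mathcomp Require Import all_boot all_order all_algebra.
From mathcomp Require Import all_classical all_reals all_analysis.
From mathcomp Require Import complex.
Set Implicit Arguments.
Unset Strict Implicit.
Unset Printing Implicit Defensive.
Import Order.TTheory GRing.Theory Num.Theory.
Import numFieldNormedType.Exports.
Local Open Scope classical_set_scope.
Local Open Scope ring_scope.

Section product_measure_sigma_finite.
Local Open Scope ereal_scope.
Context d1 d2 (T1 : measurableType d1) (T2 : measurableType d2) (R : realType).
Variable m1 : {sigma_finite_measure set T1 -> \bar R}.
Variable m2 : {sigma_finite_measure set T2 -> \bar R}.

Lemma sigma_finite_product_measure1 : sigma_finite setT (m1 \x m2).
Proof.
have /sigma_finiteP[F [TF ndF Foo]] := sigma_finiteT m1.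
have /sigma_finiteP[G [TG ndG Goo]] := sigma_finiteT m2.
exists (fun n => F n `*` G n).
 rewrite -setXTT TF TG predeqE => -[x y]; split.
    move=> [/= [n _ Fnx] [k _ Gky]]; exists (maxn n k) => //; split.
    - by move: x Fnx; exact/subsetPset/ndF/leq_maxl.
    - by move: y Gky; exact/subsetPset/ndG/leq_maxr.
  by move=> [n _ []/= ? ?]; split; exists n.
move=> k; have [? ?] := Foo k; have [? ?] := Goo k.
split; first exact: measurableX.
by rewrite product_measure1E// lte_mul_pinfty// ge0_fin_numE.
Qed.

End product_measure_sigma_finite.

Section row_vectors.
Context {R : realType}.

Section measurable_rV.
Variable n : nat.

Definition coordinate (i : 'I_n) (x : 'rV[R]_n) : R := x ord0 i.

Let rV0 : g_sigma_preimage coordinate set0.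
Proof. exact: sigma_algebra0. Qed.

Let rVC A : g_sigma_preimage coordinate A -> g_sigma_preimage coordinate (~` A).
Proof. exact: sigma_algebraC. Qed.

Let rV_bigcup (F : (set 'rV[R]_n)^nat) :
  (forall i, g_sigma_preimage coordinate (F i)) ->
  g_sigma_preimage coordinate (\bigcup_i (F i)).
Proof. exact: sigma_algebra_bigcup. Qed.

HB.instance Definition _ := @isMeasurable.Build default_measure_display
  'rV[R]_n (g_sigma_preimage coordinate) rV0 rVC rV_bigcup.

End measurable_rV.

Lemma measurable_fun_rV d (T : measurableType d) n (f : T -> 'rV[R]_n) :
  (forall i, measurable_fun [set: T] (fun t => f t ord0 i)) ->
  measurable_fun [set: T] f.
Proof.
move=> mf.
suff H : g_sigma_preimage (@coordinate n) `<=`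
    image_set_system [set: T] f measurable.
  by move=> _ A /H; rewrite /image_set_system.
apply: smallest_sub => [|B].
  exact/sigma_algebra_image/sigma_algebra_measurable.
rewrite -bigcup_seq => -[i _ [C mC <-]] /=.
rewrite /image_set_system /= !setTI -comp_preimage -[X in measurable X]setTI.
exact: mf.
Qed.

Lemma measurable_coordinate n (i : 'I_n) :
  measurable_fun [set: 'rV[R]_n] (coordinate i).
Proof.
move=> _ Y mY; rewrite setTI; apply: sub_sigma_algebra => /=.
rewrite -bigcup_seq/=; exists i => /=; first by rewrite mem_index_enum.
by exists Y => //; rewrite setTI.
Qed.

Definition rV_cons n (p : measurableTypeR R * 'rV[R]_n) : 'rV[R]_n.+1 :=
  \row_i oapp (p.2 ord0) p.1 (unlift ord0 i).

Lemma measurable_rV_cons n : measurable_fun [set: _ * _] (@rV_cons n).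
Proof.
apply: measurable_fun_rV => i.
case: (unliftP ord0 i) => [j ->|->].
- rewrite (_ : (fun _ => _) = coordinate j \o snd); last first.
    by apply/funext => p /=; rewrite mxE liftK.
  apply: measurableT_comp; last exact: measurable_snd.
  exact: measurable_coordinate.
- rewrite (_ : (fun _ => _) = fst); first exact: measurable_fst.
  by apply/funext => p /=; rewrite mxE unlift_none.
Qed.

Section rV_cons_measure.
Variables (n : nat) (m : {sigma_finite_measure set 'rV[R]_n -> \bar R}).

Definition rV_cons_measure : set 'rV[R]_n.+1 -> \bar R :=
  pushforward (@lebesgue_measure R \x m)%E (@rV_cons n).

Let preimage_rV_cons A : measurable A -> measurable (@rV_cons n @^-1` A).
Proof.
move=> mA; rewrite -[X in measurable X]setTI.
by apply: measurable_rV_cons.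
Qed.

Let rV_cons_measure0 : rV_cons_measure set0 = 0%E.
Proof. by rewrite /rV_cons_measure /pushforward preimage_set0 measure0. Qed.

Let rV_cons_measure_ge0 A : (0 <= rV_cons_measure A)%E.
Proof. by rewrite /rV_cons_measure /pushforward measure_ge0. Qed.

Let rV_cons_measure_sigma_additive : semi_sigma_additive rV_cons_measure.
Proof.
move=> F mF tF mUF; rewrite /rV_cons_measure /pushforward preimage_bigcup.
apply: measure_semi_sigma_additive.
- by move=> k; exact: preimage_rV_cons.
- apply/trivIsetP => /= i j _ _ ij; rewrite -preimage_setI.
  by move/trivIsetP : tF => /(_ _ _ _ _ ij) ->//; rewrite preimage_set0.
- by rewrite -preimage_bigcup; exact: preimage_rV_cons.
Qed.

HB.instance Definition _ := isMeasure.Build _ _ _ rV_cons_measure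
  rV_cons_measure0 rV_cons_measure_ge0 rV_cons_measure_sigma_additive.

Let rV_uncons (x : 'rV[R]_n.+1) : measurableTypeR R * 'rV[R]_n :=
  (x ord0 ord0, \row_j x ord0 (lift ord0 j)).

Let rV_consK : cancel (@rV_cons n) rV_uncons.
Proof.
move=> [t v]; congr (_, _); first by rewrite mxE unlift_none.
by apply/rowP => j; rewrite !mxE liftK.
Qed.

Let measurable_rV_uncons : measurable_fun [set: 'rV[R]_n.+1] rV_uncons.
Proof.
apply/measurable_fun_pairP; split => /=.
  exact: (measurable_coordinate ord0).
apply: measurable_fun_rV => j.
rewrite (_ : (fun _ => _) = coordinate (lift ord0 j)).
  exact: measurable_coordinate.
by apply/funext => x /=; rewrite mxE.
Qed.

Let rV_cons_measure_sigma_finite : sigma_finite [set: 'rV[R]_n.+1] rV_cons_measure.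
Proof.
have [F UF Ffin] : sigma_finite setT (@lebesgue_measure R \x m)%E.
  exact: sigma_finite_product_measure1.
exists (fun k => rV_uncons @^-1` F k).
  by rewrite -preimage_bigcup -UF preimage_setT.
move=> k; have [mF Foo] := Ffin k; split.
  by rewrite -[X in measurable X]setTI; exact: measurable_rV_uncons.
rewrite /rV_cons_measure /pushforward -comp_preimage.
rewrite (_ : _ @^-1` _ = F k)//; apply/seteqP; split => p /=;
  by rewrite rV_consK.
Qed.

HB.instance Definition _ := @Measure_isSigmaFinite.Build _ _ _ rV_cons_measure
  rV_cons_measure_sigma_finite.

End rV_cons_measure.

(* Lebesgue measure on R^n: unit mass on the one-point space R^0, and
   Lebesgue measure on R times Lebesgue measure on R^n for R^(n+1). *)
Fixpoint lebesgue_rV n : {sigma_finite_measure set 'rV[R]_n -> \bar R} :=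
  if n is k.+1 then rV_cons_measure (lebesgue_rV k) else \d_(0 : 'rV[R]_0).

End row_vectors.
Arguments lebesgue_rV : clear implicits.

Local Open Scope complex_scope.

Section complex_integration.
Context d (T : measurableType d) (R : realType).
Variable mu : {measure set T -> \bar R}.

Definition cintegral (F : T -> R[i]) : R[i] :=
  (\int[mu]_x complex.Re (F x)) +i* (\int[mu]_x complex.Im (F x)).

Definition cintegrable (F : T -> R[i]) : Prop :=
  mu.-integrable [set: T] (fun x => (complex.Re (F x))%:E) /\
  mu.-integrable [set: T] (fun x => (complex.Im (F x))%:E).

Variable dot : T -> T -> R.

Definition cis (t : R) : R[i] := cos t +i* sin t.

Definition fourier (F : T -> R[i]) (xi : T) : R[i] :=
  cintegral (fun y => cis (- (2 * pi * dot y xi)) * F y).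

Definition fourier_inv (F : T -> R[i]) (y : T) : R[i] :=
  cintegral (fun xi => cis (2 * pi * dot y xi) * F xi).

End complex_integration.

Section schwartz.
Context {R : realType} {V : normedModType R}.

Definition iter_derive (s : seq V) (F : V -> R) : V -> R :=
  foldr (fun v G => fun x => 'D_v G x) F s.

Definition schwartz_real (F : V -> R) : Prop :=
  (forall s x, differentiable (iter_derive s F) x) /\
  (forall s k, exists C : R, forall x,
     (1 + `|x|) ^+ k * `|iter_derive s F x| <= C).

(* S(V; C) for a finite-dimensional V. By multilinearity, it amounts to the
   same to differentiate along arbitrary vectors or along the basis vectors. *)
Definition schwartz (F : V -> R[i]) : Prop :=
  schwartz_real (fun x => complex.Re (F x)) /\ schwartz_real (fun x => complex.Im (F x)).

End schwartz.

Section photography.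
Context {R : realType} {n : nat}.
Local Notation Rn := 'rV[R]_n.
Local Notation R2n := ('rV[R]_n * 'rV[R]_n)%type.
Implicit Types (f h H : R2n -> R[i]) (g : Rn -> Rn -> R[i]) (b : R).

Definition dot (x y : Rn) : R := \sum_i x ord0 i * y ord0 i.

Definition dot2 (p q : R2n) : R := dot p.1 q.1 + dot p.2 q.2.

Definition lebesgue2 : set R2n -> \bar R :=
  (lebesgue_rV R n \x lebesgue_rV R n)%E.

HB.instance Definition _ := Measure.on lebesgue2.
HB.instance Definition _ := Measure_isSigmaFinite.Build _ _ _ lebesgue2
  (sigma_finite_product_measure1 (lebesgue_rV R n) (lebesgue_rV R n)).

Definition fourier1 : (Rn -> R[i]) -> Rn -> R[i] :=
  fourier (lebesgue_rV R n) dot.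
Definition fourier1_inv : (Rn -> R[i]) -> Rn -> R[i] :=
  fourier_inv (lebesgue_rV R n) dot.
Definition fourier2 : (R2n -> R[i]) -> R2n -> R[i] :=
  fourier lebesgue2 dot2.
Definition fourier2_inv : (R2n -> R[i]) -> R2n -> R[i] :=
  fourier_inv lebesgue2 dot2.

(* The solutions (x, u) of a x + (1 - a) u = y, parametrized by t, and the weight
   w with delta(a x + (1 - a) u - y) dx du = w dt on them. For a != 0, the
   parameter is u; for a = 0, where the equation is u = y, it is x. *)
Definition line_x (a y t : R) : R :=
  if a == 0 then t else a^-1 * y + (1 - a^-1) * t.
Definition line_u (a y t : R) : R := if a == 0 then y else t.
Definition line_weight (a : R) : R := if a == 0 then 1 else `|a|^-1.

Definition photo f (alpha xbar : Rn) : R[i] :=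
  (\prod_i line_weight (alpha ord0 i))%:C *
  cintegral (lebesgue_rV R n) (fun t : Rn =>
    f (\row_i line_x (alpha ord0 i) (xbar ord0 i) (t ord0 i),
       \row_i line_u (alpha ord0 i) (xbar ord0 i) (t ord0 i))).

Lemma photoE f (alpha xbar : Rn) : (forall i, alpha ord0 i != 0) ->
  photo f alpha xbar =
  ((\prod_i `|alpha ord0 i|)^-1)%:C *
  cintegral (lebesgue_rV R n) (fun u : Rn =>
    f (\row_i ((alpha ord0 i)^-1 * xbar ord0 i
               + (1 - (alpha ord0 i)^-1) * u ord0 i), u)).
Proof.
move=> alpha0; have weightE : \prod_i line_weight (alpha ord0 i) = (\prod_i `|alpha ord0 i|)^-1.
  rewrite -prodfV; apply: eq_bigr => i _.
  by rewrite /line_weight (negbTE (alpha0 i)).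
rewrite /photo weightE; congr (_ * _).
congr (cintegral _); apply/funext => u; congr (f (_, _)); apply/rowP => i;
  by rewrite !mxE /line_x /line_u (negbTE (alpha0 i)).
Qed.

Definition photo_dual g : R2n -> R[i] := fun p =>
  cintegral (lebesgue_rV R n) (fun alpha : Rn =>
    g alpha (\row_i (alpha ord0 i * p.1 ord0 i
                     + (1 - alpha ord0 i) * p.2 ord0 i))).

Definition photo_dual_weighted b g : R2n -> R[i] :=
  photo_dual (fun alpha xbar =>
    (\prod_i ((alpha ord0 i) ^+ 2 + (1 - alpha ord0 i) ^+ 2) `^ (- b / 2))%:C
    * g alpha xbar).

Definition Ibar b g : Rn -> Rn -> R[i] := fun alpha =>
  fourier1_inv (fun xi =>
    (\prod_i `|xi ord0 i| `^ (- b))%:C * fourier1 (g alpha) xi).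

Definition tempered h : Prop := exists N : nat,
  cintegrable lebesgue2 (fun p => ((1 + `|p|) ^- N)%:C * h p).

(* H represents the Fourier transform of h as a tempered distribution. *)
Definition is_fourier_transform h H : Prop :=
  [/\ tempered h, tempered H &
      forall phi : R2n -> R[i], schwartz phi ->
        cintegral lebesgue2 (fun p => h p * fourier2 phi p) =
        cintegral lebesgue2 (fun p => H p * phi p)].

(* Any such H: it is unique up to a null set, which the integral defining
   [fourier2_inv] does not see. *)
Definition tempered_fourier h : R2n -> R[i] :=
  xget (fun=> 0) [set H | is_fourier_transform h H].

(* [Icbar b f] need not be integrable, even for f in the Schwartz class, so for
   [Icbar (- b)] to apply to it the Fourier transform has to be that of
   tempered distributions. *)
Definition Icbar b h : R2n -> R[i] :=
  fourier2_inv (fun xi =>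
    (\prod_i Num.sqrt ((xi.1 ord0 i) ^+ 2 + (xi.2 ord0 i) ^+ 2) `^ (- b))%:C
    * tempered_fourier h xi).

End photography.

(* Main.v *)
Require Import Defs.
From HB Require Import structures.
From mathcomp Require Import all_boot all_order all_algebra.
From mathcomp Require Import all_classical all_reals all_analysis.
From mathcomp Require Import measurable_realfun complex.
From mathcomp Require Import ring lra.
Set Implicit Arguments.
Unset Strict Implicit.
Unset Printing Implicit Defensive.
Import Order.TTheory GRing.Theory Num.Theory.
Import numFieldNormedType.Exports.
Local Open Scope classical_set_scope.
Local Open Scope ring_scope.
Local Open Scope complex_scope.

(** Write F for the Fourier transform of f, and regard R^2n as the product of the
    n planes (x_i, u_i). Two facts relate F to the photography transform.

    - Slice theorem ([fourier1_photo]): the transform of g(alpha, .) at xi is the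
      value of F at the point with planar coordinates
      (alpha_i xi_i, (1 - alpha_i) xi_i).
    - In each plane, (a, r) |-> (a r, (1 - a) r) has Jacobian |r| and maps (a, r) to
      a point of norm |r| (a^2 + (1 - a)^2)^(1/2) ([substitution_slices]).

    The filter |xi_i|^(1 - beta) and the weight of the dual operator are
    therefore, together, the Jacobian times norm^(-beta), and unfolding the dual
    operator gives, by Fubini, the inverse Fourier transform h of
    G = prod_i norm_i^(-beta) F ([photo_dual_weighted_Ibar]). The function G is
    integrable: F decreases rapidly ([fourier2_decay]) and norm^(-beta) is locally
    integrable in the plane for beta < 2 ([radial_weight_le]).

    It remains to see that the last operator sends h to f. The tempered Fourier
    transform of h is G ([is_fourier_transform_inv]) and nothing else up to a null
    set ([is_fourier_transform_ae]), because Schwartz functions separate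
    functions of polynomial growth in the mean ([schwartz_separates]). So the last
    filter restores F almost everywhere, and Fourier inversion
    ([schwartz_inversion]) restores f at every point.

    Three choices keep the analysis elementary. All changes of variables act on
    the planes separately, so that they reduce to affine ones on the line
    ([substitution_coord2], [substitution_fiber]). Inversion is obtained by Abel
    summation, whose Poisson kernel is explicit ([fourier2_inversion]). The decay
    of F comes from translating f, in place of integrating by parts
    ([fourier2_cderive]). *)

(** * Complex-valued integrals *)

Section complex_arithmetic.
Context {R : realType}.
Implicit Types (z w : R[i]) (t : R).

Lemma complexReM z w : complex.Re (z * w) =
  complex.Re z * complex.Re w - complex.Im z * complex.Im w.
Proof. by case: z; case: w. Qed.

Lemma complexImM z w : complex.Im (z * w) =
  complex.Re z * complex.Im w + complex.Im z * complex.Re w.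
Proof. by case: z; case: w. Qed.

Lemma complexReD z w : complex.Re (z + w) = complex.Re z + complex.Re w.
Proof. by case: z; case: w. Qed.

Lemma complexImD z w : complex.Im (z + w) = complex.Im z + complex.Im w.
Proof. by case: z; case: w. Qed.

Lemma cisD t s : cis (t + s) = cis t * cis s.
Proof. by rewrite /cis sinD cosD addrC; congr (_ +i* _); rewrite addrC. Qed.

Lemma cis0 : cis 0 = 1 :> R[i].
Proof. by rewrite /cis cos0 sin0. Qed.

Lemma cis_sum n (F : 'I_n -> R) : cis (\sum_i F i) = \prod_i cis (F i).
Proof. by apply: (big_morph _ cisD cis0). Qed.

(** The sum norm is used in place of the modulus: it is real-valued, equivalent to
    the modulus, submultiplicative, and free of square roots. *)
Definition norm1 z : R := `|complex.Re z| + `|complex.Im z|.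

Lemma norm1_ge0 z : 0 <= norm1 z.
Proof. by rewrite addr_ge0. Qed.

Lemma norm1_Re z : `|complex.Re z| <= norm1 z.
Proof. by rewrite lerDl. Qed.

Lemma norm1_Im z : `|complex.Im z| <= norm1 z.
Proof. by rewrite lerDr. Qed.

Lemma norm1M z w : norm1 (z * w) <= norm1 z * norm1 w.
Proof.
rewrite /norm1 complexReM complexImM mulrDl !mulrDr.
have h a b c d : `|a * b - c * d| <= `|a| * `|b| + `|c| * `|d| :> R.
  by rewrite (le_trans (ler_normB _ _))// !normrM.
have h' a b c d : `|a * b + c * d| <= `|a| * `|b| + `|c| * `|d| :> R.
  by rewrite (le_trans (ler_normD _ _))// !normrM.
have := h (complex.Re z) (complex.Re w) (complex.Im z) (complex.Im w).
have := h' (complex.Re z) (complex.Im w) (complex.Im z) (complex.Re w).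
by lra.
Qed.

Lemma norm1R t : norm1 t%:C = `|t|.
Proof. by rewrite /norm1 /= normr0 addr0. Qed.

Lemma norm1RM t z : norm1 (t%:C * z) = `|t| * norm1 z.
Proof. by rewrite /norm1 complexReM complexImM /= !mul0r subr0 addr0 !normrM mulrDr. Qed.

Lemma norm1_cis t : norm1 (cis t) <= 2.
Proof.
rewrite /norm1 /=.
have : `|cos t| <= 1 by rewrite ler_norml cos_geN1 cos_le1.
have : `|sin t| <= 1 by rewrite ler_norml sin_geN1 sin_le1.
by lra.
Qed.

Lemma complex_eq z w : complex.Re z = complex.Re w ->
  complex.Im z = complex.Im w -> z = w.
Proof. by case: z => a b; case: w => c d /= -> ->. Qed.

End complex_arithmetic.

Section complex_measurability.
Context d (T : measurableType d) (R : realType).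
Implicit Types F G : T -> R[i].

Definition cmeasurable F :=
  measurable_fun [set: T] (fun x => complex.Re (F x)) /\
  measurable_fun [set: T] (fun x => complex.Im (F x)).

Lemma cmeasurableM F G : cmeasurable F -> cmeasurable G ->
  cmeasurable (fun x => F x * G x).
Proof.
move=> [F1 F2] [G1 G2]; split.
  under eq_fun do rewrite complexReM.
  by apply: measurable_funB; exact: measurable_funM.
under eq_fun do rewrite complexImM.
by apply: measurable_funD; exact: measurable_funM.
Qed.

Lemma cmeasurableR (h : T -> R) : measurable_fun [set: T] h ->
  cmeasurable (fun x => (h x)%:C).
Proof. by move=> mh; split => //=; exact: measurable_cst. Qed.

Lemma cmeasurable_cst c : cmeasurable (fun _ => c).
Proof. by split; exact: measurable_cst. Qed.

Lemma cmeasurable_cis (h : T -> R) : measurable_fun [set: T] h ->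
  cmeasurable (fun x => cis (h x)).
Proof.
move=> mh; split => /=.
- apply: (measurableT_comp _ mh).
  by apply: continuous_measurable_fun; exact: continuous_cos.
- apply: (measurableT_comp _ mh).
  by apply: continuous_measurable_fun; exact: continuous_sin.
Qed.

Lemma measurable_norm1 F : cmeasurable F ->
  measurable_fun [set: T] (fun x => norm1 (F x)).
Proof.
move=> [F1 F2]; rewrite /norm1; apply: measurable_funD.
- exact: (measurableT_comp (@normr_measurable R setT) F1).
- exact: (measurableT_comp (@normr_measurable R setT) F2).
Qed.

Lemma cmeasurable_prod n (F : 'I_n -> T -> R[i]) :
  (forall i, cmeasurable (F i)) -> cmeasurable (fun x => \prod_i F i x).
Proof.
elim: n F => [F _|n ih F mF].
  by under eq_fun do rewrite big_ord0; exact: cmeasurable_cst.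
under eq_fun do rewrite big_ord_recl.
by apply: cmeasurableM => //; exact: ih.
Qed.

End complex_measurability.

Lemma cmeasurable_comp d (T : measurableType d) d' (T' : measurableType d')
    (R : realType) (F : T' -> R[i]) (h : T -> T') :
  cmeasurable F -> measurable_fun [set: T] h -> cmeasurable (fun x => F (h x)).
Proof.
move=> [F1 F2] mh; split.
- exact: (measurableT_comp F1 mh).
- exact: (measurableT_comp F2 mh).
Qed.

Section complex_integral.
Context d (T : measurableType d) (R : realType).
Variable mu : {measure set T -> \bar R}.
Implicit Types F G : T -> R[i].

Lemma cintegrable_cmeasurable F : cintegrable mu F -> cmeasurable F.
Proof.
by move=> [/measurable_int/measurable_EFinP ? /measurable_int/measurable_EFinP].
Qed.

Lemma cintegrable_norm1 F : cintegrable mu F ->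
  mu.-integrable [set: T] (fun x => (norm1 (F x))%:E).
Proof.
by move=> [/integrable_abse F1 /integrable_abse F2]; exact: (integrableD _ F1 F2).
Qed.

Lemma cintegrable_lty F : cintegrable mu F -> (\int[mu]_x (norm1 (F x))%:E < +oo)%E.
Proof.
move=> /cintegrable_norm1/integrableP[_]; congr (_ < _)%E.
by apply: eq_integral => x _; rewrite gee0_abs// lee_fin norm1_ge0.
Qed.

Lemma cintegrable_le F (B : T -> R) : cmeasurable F ->
  mu.-integrable [set: T] (fun x => (B x)%:E) ->
  (forall x, norm1 (F x) <= B x) -> cintegrable mu F.
Proof.
move=> [F1 F2] iB FB; split; apply: le_integrable iB => //.
- exact/measurable_EFinP.
- move=> x _; rewrite /= lee_fin (le_trans (norm1_Re _))// (le_trans (FB x))//.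
  exact: ler_norm.
- exact/measurable_EFinP.
- move=> x _; rewrite /= lee_fin (le_trans (norm1_Im _))// (le_trans (FB x))//.
  exact: ler_norm.
Qed.

Lemma cintegrable_ltyP F : cmeasurable F ->
  (\int[mu]_x (norm1 (F x))%:E < +oo)%E -> cintegrable mu F.
Proof.
move=> mF Foo; apply: (@cintegrable_le _ (fun x => norm1 (F x))) => //.
apply/integrableP; split; first exact/measurable_EFinP/measurable_norm1.
rewrite (eq_integral (fun x => (norm1 (F x))%:E))// => x _.
by rewrite gee0_abs// lee_fin norm1_ge0.
Qed.

Lemma integrableZl_EFin (r : R) (h : T -> R) :
  mu.-integrable [set: T] (fun x => (h x)%:E) ->
  mu.-integrable [set: T] (fun x => (r * h x)%:E).
Proof. by move=> ih; under eq_fun do rewrite EFinM; exact: integrableZl. Qed.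

Lemma cintegralZ c F : cintegrable mu F ->
  cintegral mu (fun x => c * F x) = c * cintegral mu F.
Proof.
move=> [F1 F2]; apply: complex_eq; rewrite ?complexReM ?complexImM /=.
- under eq_Rintegral do rewrite complexReM.
  by rewrite RintegralB ?RintegralZl//; exact: integrableZl_EFin.
- under eq_Rintegral do rewrite complexImM.
  by rewrite RintegralD ?RintegralZl//; exact: integrableZl_EFin.
Qed.

Lemma cintegralD F G : cintegrable mu F -> cintegrable mu G ->
  cintegral mu (fun x => F x + G x) = cintegral mu F + cintegral mu G.
Proof.
move=> [F1 F2] [G1 G2]; apply: complex_eq; rewrite ?complexReD ?complexImD /=.
- by under eq_Rintegral do rewrite complexReD; rewrite RintegralD.
- by under eq_Rintegral do rewrite complexImD; rewrite RintegralD.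
Qed.

Lemma cintegrableZ c F : cintegrable mu F -> cintegrable mu (fun x => c * F x).
Proof.
move=> iF; apply: (@cintegrable_le _ (fun x => norm1 c * norm1 (F x))).
- apply: cmeasurableM; first exact: cmeasurable_cst.
  exact: cintegrable_cmeasurable iF.
- exact/integrableZl_EFin/cintegrable_norm1.
- by move=> x; exact: norm1M.
Qed.

Lemma eq_cintegral F G : F =1 G -> cintegral mu F = cintegral mu G.
Proof. by move=> /funext ->. Qed.

Lemma ae_eq_cintegral F G : cmeasurable F -> cmeasurable G ->
  {ae mu, forall x, F x = G x} -> cintegral mu F = cintegral mu G.
Proof.
move=> [F1 F2] [G1 G2] FG; congr (_ +i* _); congr fine; apply: ae_eq_integral => //.
- exact/measurable_EFinP.
- exact/measurable_EFinP.
- by apply: filterS FG => x -> .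
- exact/measurable_EFinP.
- exact/measurable_EFinP.
- by apply: filterS FG => x ->.
Qed.

Lemma norm1_cintegral F : cintegrable mu F ->
  ((norm1 (cintegral mu F))%:E <= \int[mu]_x (norm1 (F x))%:E)%E.
Proof.
move=> [F1 F2]; rewrite /norm1 /= EFinD.
under eq_integral do rewrite EFinD.
rewrite integralD//; [|exact: (integrable_abse F1)|exact: (integrable_abse F2)].
apply: leeD.
- rewrite EFin_normr_Rintegral//; apply: le_abse_integral => //.
  exact: measurable_int F1.
- rewrite EFin_normr_Rintegral//; apply: le_abse_integral => //.
  exact: measurable_int F2.
Qed.

(** Convergence is asked of the real and imaginary parts, so that no topology
    on the complex numbers is involved. *)
Definition ccvg (u : nat -> R[i]) (l : R[i]) :=
  (complex.Re (u n) @[n --> \oo] --> complex.Re l) /\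
  (complex.Im (u n) @[n --> \oo] --> complex.Im l).

Lemma cdominated_convergence (F_ : nat -> T -> R[i]) F (B : T -> R) :
  (forall n, cmeasurable (F_ n)) -> cmeasurable F ->
  (forall x, ccvg (F_ ^~ x) (F x)) ->
  mu.-integrable [set: T] (fun x => (B x)%:E) ->
  (forall n x, norm1 (F_ n x) <= B x) ->
  ccvg (fun n => cintegral mu (F_ n)) (cintegral mu F).
Proof.
move=> mF_ [mF1 mF2] FF iB FB.
have iF n : cintegrable mu (F_ n) by apply: cintegrable_le iB _.
have key (f_ : nat -> T -> R) (f : T -> R) : (forall n, measurable_fun setT (f_ n)) ->
    measurable_fun setT f -> (forall x, f_ n x @[n --> \oo] --> f x) ->
    (forall n x, `|f_ n x| <= B x) ->
    (\int[mu]_x f_ n x)%R @[n --> \oo] --> (\int[mu]_x f x)%R.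
  move=> mf_ mf ff fB.
  have [|||||if_ _ cf] := @dominated_convergence _ _ _ mu setT measurableT
    (fun n x => (f_ n x)%:E) (fun x => (f x)%:E) (fun x => (B x)%:E).
  - by move=> n; exact/measurable_EFinP.
  - exact/measurable_EFinP.
  - by apply: aeW => x _; apply: cvg_EFin; [exact: nearW|exact: ff].
  - exact: iB.
  - by apply: aeW => x n _; rewrite /= lee_fin.
  apply: fine_cvg; rewrite fineK; last exact: integrable_fin_num.
  exact: cf.
split => /=; apply: key => //.
- by move=> n; have [] := mF_ n.
- by move=> x; have [] := FF x.
- by move=> n x; exact: le_trans (norm1_Re _) (FB n x).
- by move=> n; have [] := mF_ n.
- by move=> x; have [] := FF x.
- by move=> n x; exact: le_trans (norm1_Im _) (FB n x).
Qed.

Lemma ccvg_unique (u : nat -> R[i]) l l' : ccvg u l -> ccvg u l' -> l = l'.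
Proof.
move=> [u1 u2] [v1 v2]; apply: complex_eq.
- exact: (cvg_unique _ u1 v1).
- exact: (cvg_unique _ u2 v2).
Qed.

Lemma ccvgM (u v : nat -> R[i]) l l' : ccvg u l -> ccvg v l' ->
  ccvg (fun n => u n * v n) (l * l').
Proof.
move=> [u1 u2] [v1 v2]; split; rewrite ?complexReM ?complexImM.
- by under eq_fun do rewrite complexReM; apply: cvgB; exact: cvgM.
- by under eq_fun do rewrite complexImM; apply: cvgD; exact: cvgM.
Qed.

Lemma ccvg_cst l : ccvg (fun=> l) l.
Proof. by split; exact: cvg_cst. Qed.

Lemma ccvgR (u : nat -> R) (l : R) : u n @[n --> \oo] --> l ->
  ccvg (fun n => (u n)%:C) l%:C.
Proof. by move=> ul; split => //=; exact: cvg_cst. Qed.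

End complex_integral.

Section complex_Fubini.
Context d1 d2 (T1 : measurableType d1) (T2 : measurableType d2) (R : realType).
Variables (m1 : {sigma_finite_measure set T1 -> \bar R})
  (m2 : {sigma_finite_measure set T2 -> \bar R}).

Lemma Rintegral_fubini1 (f : T1 * T2 -> R) :
  (m1 \x m2)%E.-integrable setT (EFin \o f) ->
  m1.-integrable setT (fun x => (\int[m2]_y f (x, y))%:E) /\
  \int[(m1 \x m2)%E]_z f z = \int[m1]_x \int[m2]_y f (x, y).
Proof.
move=> fi; have iF := integrable_fubini_F fi.
have mF := measurable_int _ iF.
have mF' : measurable_fun setT (fun x => (\int[m2]_y f (x, y))%:E).
  by apply/measurable_EFinP; apply: measurableT_comp mF; exact: fine_measurable.
split.
  apply: le_integrable iF => // x _; rewrite /Rintegral /fubini_F /=.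
  by case: (\int[m2]_y _)%E => [r| |] /=; rewrite ?normr0 ?leey.
congr fine; rewrite -(integral12_prod_meas1 fi); apply: ae_eq_integral => //.
by have := integrable_ae measurableT iF; apply: filterS => x + xT;
  move=> /(_ xT) /fineK <-.
Qed.

Lemma Rintegral_fubini2 (f : T1 * T2 -> R) :
  (m1 \x m2)%E.-integrable setT (EFin \o f) ->
  m2.-integrable setT (fun y => (\int[m1]_x f (x, y))%:E) /\
  \int[(m1 \x m2)%E]_z f z = \int[m2]_y \int[m1]_x f (x, y).
Proof.
move=> fi; have mf := measurable_int _ fi.
have iF : m2.-integrable setT (fubini_G m1 (EFin \o f)).
  apply/integrableP; split; first exact: (measurable_fubini_G fi).
  have mabs : measurable_fun setT (fun z => `|(f z)%:E|%E) by exact: measurableT_comp.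
  apply: le_lt_trans (proj1 (integrable21ltyP m1 m2 mf) fi).
  apply: ge0_le_integral => //.
  - by apply: measurableT_comp => //; exact: (measurable_fubini_G fi).

  - exact: (measurable_fun_fubini_tonelli_G (fun z => `|(f z)%:E|%E)).
  - by move=> y _; apply: le_abse_integral => //; exact: measurableT_comp.
have mF := measurable_int _ iF.
have mF' : measurable_fun setT (fun y => (\int[m1]_x f (x, y))%:E).
  by apply/measurable_EFinP; apply: measurableT_comp mF; exact: fine_measurable.
split.
  apply: le_integrable iF => // x _; rewrite /Rintegral /fubini_G /=.
  by case: (\int[m1]_x _)%E => [r| |] /=; rewrite ?normr0 ?leey.
congr fine; rewrite -(integral21_prod_meas1 fi); apply: ae_eq_integral => //.
by have := integrable_ae measurableT iF; apply: filterS => x + xT;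
  move=> /(_ xT) /fineK <-.
Qed.

Lemma cfubini1 (F : T1 * T2 -> R[i]) : cintegrable (m1 \x m2)%E F ->
  cintegrable m1 (fun x => cintegral m2 (fun y => F (x, y))) /\
  cintegral (m1 \x m2)%E F = cintegral m1 (fun x => cintegral m2 (fun y => F (x, y))).
Proof.
move=> [/Rintegral_fubini1[F1 E1] /Rintegral_fubini1[F2 E2]]; split=> //.
by congr (_ +i* _).
Qed.

Lemma cfubini2 (F : T1 * T2 -> R[i]) : cintegrable (m1 \x m2)%E F ->
  cintegrable m2 (fun y => cintegral m1 (fun x => F (x, y))) /\
  cintegral (m1 \x m2)%E F = cintegral m2 (fun y => cintegral m1 (fun x => F (x, y))).
Proof.
move=> [/Rintegral_fubini2[F1 E1] /Rintegral_fubini2[F2 E2]]; split=> //.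
by congr (_ +i* _).
Qed.

End complex_Fubini.

(** * Changes of variables *)

(** A constant of its own, to carry the sigma-finiteness of a product of
    sigma-finite measures. *)
Definition pairm d1 d2 (T1 : measurableType d1) (T2 : measurableType d2)
    (R : realType) (m1 : {sigma_finite_measure set T1 -> \bar R})
    (m2 : {sigma_finite_measure set T2 -> \bar R}) : set (T1 * T2) -> \bar R :=
  (m1 \x m2)%E.

HB.instance Definition _ d1 d2 (T1 : measurableType d1) (T2 : measurableType d2)
    (R : realType) (m1 : {sigma_finite_measure set T1 -> \bar R})
    (m2 : {sigma_finite_measure set T2 -> \bar R}) := Measure.on (pairm m1 m2).

HB.instance Definition _ d1 d2 (T1 : measurableType d1) (T2 : measurableType d2)
    (R : realType) (m1 : {sigma_finite_measure set T1 -> \bar R})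
    (m2 : {sigma_finite_measure set T2 -> \bar R}) :=
  Measure_isSigmaFinite.Build _ _ _ (pairm m1 m2)
    (sigma_finite_product_measure1 m1 m2).

Section pairm_Tonelli.
Local Open Scope ereal_scope.
Context d1 d2 (T1 : measurableType d1) (T2 : measurableType d2) (R : realType).
Variables (m1 : {sigma_finite_measure set T1 -> \bar R})
  (m2 : {sigma_finite_measure set T2 -> \bar R}).
Variables (f : T1 * T2 -> \bar R) (mf : measurable_fun [set: T1 * T2] f)
  (f0 : forall x, 0 <= f x).

Lemma pairm_tonelli1 : \int[pairm m1 m2]_z f z = \int[m1]_x \int[m2]_y f (x, y).
Proof. exact: fubini_tonelli1. Qed.

Lemma pairm_tonelli2 : \int[pairm m1 m2]_z f z = \int[m2]_y \int[m1]_x f (x, y).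
Proof. exact: fubini_tonelli2. Qed.

Lemma measurable_tonelli1 : measurable_fun [set: T1] (fun x => \int[m2]_y f (x, y)).
Proof. exact: measurable_fun_fubini_tonelli_F. Qed.

Lemma measurable_tonelli2 : measurable_fun [set: T2] (fun y => \int[m1]_x f (x, y)).
Proof. exact: (measurable_fun_fubini_tonelli_G f). Qed.

End pairm_Tonelli.

(** A change of variables [T] of Jacobian [rho]: the image under [T] of the measure
    of density [rho] is [nu]. It is tested on nonnegative functions only, which
    needs no integrability; [substitution_cintegral] gives the rest. *)
Definition substitution d1 d2 (X : measurableType d1) (Y : measurableType d2)
    (R : realType) (mu : set X -> \bar R) (nu : set Y -> \bar R)
    (T : X -> Y) (rho : X -> R) : Prop :=
  [/\ measurable_fun [set: X] T, measurable_fun [set: X] rho,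
      forall x, 0 <= rho x &
      forall Phi : Y -> \bar R, measurable_fun [set: Y] Phi ->
        (forall y, 0 <= Phi y)%E ->
        (\int[mu]_x ((rho x)%:E * Phi (T x)) = \int[nu]_y Phi y)%E].

Section substitution_integral.
Context d1 d2 (X : measurableType d1) (Y : measurableType d2) (R : realType).
Variables (mu : {measure set X -> \bar R}) (nu : {measure set Y -> \bar R}).
Variables (T : X -> Y) (rho : X -> R).
Hypothesis Trho : substitution mu nu T rho.

Lemma substitution_Rintegral (h : Y -> R) : measurable_fun [set: Y] h ->
  \int[mu]_x (rho x * h (T x)) = \int[nu]_y h y.
Proof.
case: Trho => mT mr r0 ch mh; congr fine; rewrite integralE [RHS]integralE.
have mEh : measurable_fun [set: Y] (EFin \o h) by exact/measurable_EFinP.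
congr (_ - _)%E.
- rewrite -ch//; last exact: measurable_funepos.
  apply: eq_integral => x _; rewrite !funeposE.
  by rewrite maxe_pMr ?lee_fin// mule0 -EFinM.
- rewrite -ch//; last exact: measurable_funeneg.
  apply: eq_integral => x _; rewrite !funenegE.
  by rewrite maxe_pMr ?lee_fin// mule0 muleN -EFinM.
Qed.

Lemma substitution_cmeasurable (F : Y -> R[i]) : cmeasurable F ->
  cmeasurable (fun x => (rho x)%:C * F (T x)).
Proof.
case: Trho => mT mr r0 ch mF; apply: cmeasurableM; first exact: cmeasurableR.
exact: cmeasurable_comp mF mT.
Qed.

Lemma substitution_cintegrable (F : Y -> R[i]) : cmeasurable F ->
  cintegrable mu (fun x => (rho x)%:C * F (T x)) <-> cintegrable nu F.
Proof.
move=> mF; case: (Trho) => mT mr r0 ch.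
have E : (\int[mu]_x (norm1 ((rho x)%:C * F (T x)))%:E =
          \int[nu]_y (norm1 (F y))%:E)%E.
  rewrite -ch//; first by apply: eq_integral => x _; rewrite norm1RM ger0_norm// EFinM.
  - exact/measurable_EFinP/measurable_norm1.
  - by move=> y; rewrite lee_fin norm1_ge0.
split=> /cintegrable_lty; first by rewrite E; exact: cintegrable_ltyP.
by rewrite -E; apply: cintegrable_ltyP; exact: substitution_cmeasurable.
Qed.

Lemma substitution_cintegral (F : Y -> R[i]) : cmeasurable F ->
  cintegral mu (fun x => (rho x)%:C * F (T x)) = cintegral nu F.
Proof.
move=> [F1 F2]; congr (_ +i* _).
- rewrite -substitution_Rintegral//; apply: eq_Rintegral => x _.
  by rewrite complexReM /= mul0r subr0.
- rewrite -substitution_Rintegral//; apply: eq_Rintegral => x _.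
  by rewrite complexImM /= mul0r addr0.
Qed.

End substitution_integral.

Section substitution_theory.
Local Open Scope ereal_scope.

Lemma substitution_comp d1 d2 d3 (X : measurableType d1) (Y : measurableType d2)
    (Z : measurableType d3) (R : realType)
    (mu : {measure set X -> \bar R}) (nu : {measure set Y -> \bar R})
    (la : {measure set Z -> \bar R}) T S rho sg :
  substitution mu nu T rho -> substitution nu la S sg ->
  substitution mu la (S \o T) (fun x => rho x * sg (T x))%R.
Proof.
move=> [mT mr r0 hT] [mS ms s0 hS]; split.
- exact: measurableT_comp.
- by apply: measurable_funM => //; exact: measurableT_comp.
- by move=> x; rewrite mulr_ge0.
- move=> Phi mPhi Phi0; rewrite -hS// -hT.
  + by apply: eq_integral => x _; rewrite EFinM muleA.
  + apply: emeasurable_funM; first exact/measurable_EFinP.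
    exact: measurableT_comp.
  + by move=> y; rewrite mule_ge0// lee_fin.
Qed.

Lemma eq_substitution d1 d2 (X : measurableType d1) (Y : measurableType d2)
    (R : realType) (mu : set X -> \bar R) (nu : set Y -> \bar R) T S rho sg :
  T =1 S -> rho =1 sg -> substitution mu nu T rho -> substitution mu nu S sg.
Proof. by move=> /funext -> /funext ->. Qed.

Lemma substitution_pushforward d1 d2 (X : measurableType d1) (Y : measurableType d2)
    (R : realType) (mu : {measure set X -> \bar R}) T :
  measurable_fun [set: X] T ->
  substitution mu (pushforward mu T : set Y -> \bar R) T (fun=> 1%R).
Proof.
move=> mT; split => //.
move=> Phi mPhi Phi0; rewrite ge0_integral_pushforward//.
by apply: eq_integral => x _; rewrite mul1e.
Qed.

Section product.
Context d1 d2 e1 e2 (X1 : measurableType d1) (X2 : measurableType d2)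
  (Y1 : measurableType e1) (Y2 : measurableType e2) (R : realType).
Variables (m1 : {sigma_finite_measure set X1 -> \bar R})
  (m2 : {sigma_finite_measure set X2 -> \bar R})
  (n1 : {sigma_finite_measure set Y1 -> \bar R})
  (n2 : {sigma_finite_measure set Y2 -> \bar R}).

Lemma substitution_prod T1 T2 r1 r2 :
  substitution m1 n1 T1 r1 -> substitution m2 n2 T2 r2 ->
  substitution (pairm m1 m2) (pairm n1 n2)
    (fun z => (T1 z.1, T2 z.2)) (fun z => r1 z.1 * r2 z.2)%R.
Proof.
move=> [mT1 mr1 r10 h1] [mT2 mr2 r20 h2].
have mT : measurable_fun [set: X1 * X2] (fun z => (T1 z.1, T2 z.2)).
  apply/measurable_fun_pairP; split => /=.
  - exact: (measurableT_comp mT1 measurable_fst).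
  - exact: (measurableT_comp mT2 measurable_snd).
have mr : measurable_fun [set: X1 * X2] (fun z => r1 z.1 * r2 z.2)%R.
  apply: measurable_funM.
  - exact: (measurableT_comp mr1 measurable_fst).
  - exact: (measurableT_comp mr2 measurable_snd).
split => //; first by move=> z; rewrite mulr_ge0.
move=> Phi mPhi Phi0.
rewrite pairm_tonelli1//; last 2 first.
- apply: emeasurable_funM; first exact/measurable_EFinP.
  exact: measurableT_comp.
- by move=> z; rewrite mule_ge0// lee_fin mulr_ge0.
rewrite pairm_tonelli1// -h1//; last 2 first.
- exact: measurable_tonelli1.
- by move=> x; exact: integral_ge0.
apply: eq_integral => x _; rewrite -h2//; last first.
  by apply: measurableT_comp => //; exact: measurable_pair1.
rewrite -ge0_integralZl//.
- by apply: eq_integral => y _ /=; rewrite EFinM muleA.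
- apply: emeasurable_funM; first exact/measurable_EFinP.
  apply: (measurableT_comp mPhi); apply/measurable_fun_pairP; split => //=.
  exact: measurable_cst.
- by move=> y _; rewrite mule_ge0// lee_fin.
- by rewrite lee_fin.
Qed.

(** Under a slicewise substitution, only almost every slice matters. *)
Lemma substitution_fiber (N : set X2) (T : X1 * X2 -> Y1) (rho : X1 * X2 -> R) :
  measurable N -> m2 N = 0 ->
  measurable_fun [set: X1 * X2] T -> measurable_fun [set: X1 * X2] rho ->
  (forall z, 0 <= rho z)%R ->
  (forall t, ~ N t -> substitution m1 n1 (fun s => T (s, t)) (fun s => rho (s, t))) ->
  substitution (pairm m1 m2) (pairm n1 m2) (fun z => (T z, z.2)) rho.
Proof.
move=> mN N0 mT mr r0 h; split => //.
  by apply/measurable_fun_pairP; split => //=; exact: measurable_snd.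
move=> Phi mPhi Phi0.
have mG : measurable_fun [set: X1 * X2] (fun z => (rho z)%:E * Phi (T z, z.2)).
  apply: emeasurable_funM; first exact/measurable_EFinP.
  apply: (measurableT_comp mPhi); apply/measurable_fun_pairP; split => //=.
  exact: measurable_snd.
have G0 z : 0 <= (rho z)%:E * Phi (T z, z.2) by rewrite mule_ge0// lee_fin.
rewrite pairm_tonelli2// pairm_tonelli2//; apply: ge0_ae_eq_integral => //.
- exact: (measurable_tonelli2 m1 mG G0).
- exact: (measurable_tonelli2 n1 mPhi Phi0).
- by move=> y _; exact: integral_ge0.
- by move=> y _; exact: integral_ge0.
exists N; split => // t; apply: contra_notP => Nt _; have [_ _ _ ht] := h t Nt.
rewrite -ht//.
by apply: measurableT_comp => //; exact: measurable_pair2.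
Qed.

End product.

Section rearrangement.
Context d1 d2 d3 d4 (A : measurableType d1) (B : measurableType d2)
  (C : measurableType d3) (D : measurableType d4) (R : realType).
Variables (a : {sigma_finite_measure set A -> \bar R})
  (b : {sigma_finite_measure set B -> \bar R})
  (c : {sigma_finite_measure set C -> \bar R})
  (d : {sigma_finite_measure set D -> \bar R}).

Lemma substitution_swap :
  substitution (pairm a b) (pairm b a) (fun z => (z.2, z.1)) (fun=> 1%R).
Proof.
have ms : measurable_fun [set: A * B] (fun z => (z.2, z.1)).
  by apply/measurable_fun_pairP; split => /=; [exact: measurable_snd|exact: measurable_fst].
split => //.
move=> Phi mPhi Phi0; under eq_integral do rewrite mul1e.
have mPs : measurable_fun [set: A * B] (fun z => Phi (z.2, z.1)) by exact: measurableT_comp.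
by rewrite pairm_tonelli1// pairm_tonelli2.
Qed.

(** This exchange of the two middle factors turns R^(n+1) x R^(n+1) into
    R^2 x (R^n x R^n). *)
Lemma substitution_rearrange :
  substitution (pairm (pairm a b) (pairm c d)) (pairm (pairm a c) (pairm b d))
    (fun z => ((z.1.1, z.2.1), (z.1.2, z.2.2))) (fun=> 1%R).
Proof.
pose T := fun z : (A * B) * (C * D) => ((z.1.1, z.2.1), (z.1.2, z.2.2)).
have m11 : measurable_fun setT (fun z : (A * B) * (C * D) => z.1.1).
  exact: (measurableT_comp measurable_fst measurable_fst).
have m12 : measurable_fun setT (fun z : (A * B) * (C * D) => z.1.2).
  exact: (measurableT_comp measurable_snd measurable_fst).
have m21 : measurable_fun setT (fun z : (A * B) * (C * D) => z.2.1).
  exact: (measurableT_comp measurable_fst measurable_snd).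
have m22 : measurable_fun setT (fun z : (A * B) * (C * D) => z.2.2).
  exact: (measurableT_comp measurable_snd measurable_snd).
have mT : measurable_fun setT T.
  by apply/measurable_fun_pairP; split => /=; apply/measurable_fun_pairP; split.
split => //.
move=> Phi mPhi Phi0; under eq_integral do rewrite mul1e.
have mPT : measurable_fun setT (fun z => Phi (T z)) by exact: measurableT_comp.
have mP1 : measurable_fun setT (fun z => \int[pairm c d]_w Phi (T (z, w))).
  exact: (measurable_tonelli1 (pairm c d) mPT (fun z => Phi0 (T z))).
have mP2 : measurable_fun setT (fun z => \int[pairm b d]_w Phi (z, w)).
  exact: (measurable_tonelli1 (pairm b d) mPhi Phi0).
rewrite [LHS]pairm_tonelli1// [RHS]pairm_tonelli1//.
rewrite [LHS]pairm_tonelli1//; last by move=> z; exact: integral_ge0.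
rewrite [RHS]pairm_tonelli1//; last by move=> z; exact: integral_ge0.
apply: eq_integral => x _; rewrite /T /=.
have mc y : measurable_fun setT (fun w : C * D => Phi ((x, w.1), (y, w.2))).
  apply: (measurableT_comp mPhi); apply/measurable_fun_pairP; split => /=;
  apply/measurable_fun_pairP; split => /=.
  - exact: measurable_cst.
  - exact: measurable_fst.
  - exact: measurable_cst.
  - exact: measurable_snd.
have mb z : measurable_fun setT (fun w : B * D => Phi ((x, z), w)).
  by apply: (measurableT_comp mPhi); exact: measurable_pair1.
under eq_integral do rewrite pairm_tonelli1//.
under [RHS]eq_integral do rewrite pairm_tonelli1//.
rewrite /=.
pose G := fun w : (B * C) => \int[d]_t Phi ((x, w.2), (w.1, t)).
have mG : measurable_fun setT G.
  have mH : measurable_fun setT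
      (fun w : (B * C) * D => Phi ((x, w.1.2), (w.1.1, w.2))).
    apply: (measurableT_comp mPhi); apply/measurable_fun_pairP; split => /=;
    apply/measurable_fun_pairP; split => /=.
    - exact: measurable_cst.
    - exact: (measurableT_comp measurable_snd measurable_fst).
    - exact: (measurableT_comp measurable_fst measurable_fst).
    - exact: measurable_snd.
  exact: (measurable_tonelli1 d mH (fun w => Phi0 _)).
have G0 w : 0 <= G w by exact: integral_ge0.
exact: (etrans (esym (pairm_tonelli1 b c mG G0)) (pairm_tonelli2 b c mG G0)).
Qed.

End rearrangement.

(** By uniqueness of Lebesgue measure, as both sides agree on intervals. *)
Lemma substitution_affine (R : realType) (a b : R) : a != 0%R ->
  substitution (@lebesgue_measure R) (@lebesgue_measure R)
    (fun t => a * t + b)%R (fun=> `|a|%R).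
Proof.
move=> a0; pose T := (fun t : measurableTypeR R => a * t + b : measurableTypeR R)%R.
have mT : measurable_fun setT T.
  apply: measurable_funD; last exact: measurable_cst.
  exact: mulrl_measurable.
split => //.
move=> Phi mPhi Phi0.
pose k : {nonneg R} := NngNum (normr_ge0 a).
pose pT := measure_function_pushforward__canonical__measure_function_Measure
  (@lebesgue_measure R) mT.
pose m : {measure set (measurableTypeR R) -> \bar R} := mscale k pT.
have mE A : measurable A -> lebesgue_measure A = m A.
  apply: lebesgue_measure_unique => _ [[c e]] _ <-.
  rewrite (_ : m _ = `|a|%:E * lebesgue_measure (T @^-1` `]c, e]))//.
  have [alt0|agt0|/eqP] := ltgtP a 0%R; last by rewrite (negbTE a0).
  - rewrite (_ : T @^-1` _ = `[(e - b) / a, (c - b) / a[%classic)%R; last first.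
      apply/seteqP; split => t; rewrite /= !in_itv /= /T => /andP[h1 h2];
      apply/andP; split.
      + by rewrite ler_ndivrMr// mulrC lerBrDr.
      + by rewrite ltr_ndivlMr// mulrC ltrBlDr.
      + by move: h2; rewrite ltr_ndivlMr// mulrC ltrBlDr.
      + by move: h1; rewrite ler_ndivrMr// mulrC lerBrDr.
    rewrite !lebesgue_measure_itv/= !lte_fin ltr_ndivlMr// divfK//.
    rewrite ltrBlDr subrK; case: ifPn => _; last by rewrite mule0.
    by rewrite -!EFinB -EFinM; congr EFin; rewrite ltr0_norm//; field.
  - rewrite (_ : T @^-1` _ = `](c - b) / a, (e - b) / a]%classic)%R; last first.
      apply/seteqP; split => t; rewrite /= !in_itv /= /T => /andP[h1 h2];
      apply/andP; split.
      + by rewrite ltr_pdivrMr// mulrC ltrBlDr.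
      + by rewrite ler_pdivlMr// mulrC lerBrDr.
      + by move: h1; rewrite ltr_pdivrMr// mulrC ltrBlDr.
      + by move: h2; rewrite ler_pdivlMr// mulrC lerBrDr.
    rewrite !lebesgue_measure_itv/= !lte_fin ltr_pdivrMr// divfK//.
    rewrite ltrBlDr subrK; case: ifPn => _; last by rewrite mule0.
    by rewrite -!EFinB -EFinM; congr EFin; rewrite gtr0_norm//; field.
rewrite [RHS](@eq_measure_integral _ _ _ _ m); last by move=> A mA _; exact: mE.
rewrite ge0_integral_mscale// ge0_integralZl//; last exact: measurableT_comp.
by rewrite ge0_integral_pushforward.
Qed.

End substitution_theory.

(** * The space R^2n as a product of planes *)

Notation leb R := (@lebesgue_measure R : {sigma_finite_measure set (measurableTypeR R) -> \bar R}).
Notation leb2 R := (pairm (leb R) (leb R)).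
Notation rV2 R n := ('rV[R]_n * 'rV[R]_n)%type.

Section coordinates.
Context {R : realType}.

(** The i-th plane (x_i, u_i): all the transformations and weights of the problem
    act on these planes separately. *)
Definition coord2 n (p : rV2 R n) (i : 'I_n) : measurableTypeR R * measurableTypeR R :=
  (p.1 ord0 i, p.2 ord0 i).

Definition of_coord2 n (T : 'I_n -> measurableTypeR R * measurableTypeR R) : rV2 R n :=
  (\row_i (T i).1, \row_i (T i).2).

Definition cons2 n (z : (measurableTypeR R * measurableTypeR R) * rV2 R n) : rV2 R n.+1 :=
  (rV_cons (z.1.1, z.2.1), rV_cons (z.1.2, z.2.2)).

Lemma coord2_of n T (i : 'I_n) : coord2 (of_coord2 T) i = T i.
Proof. by rewrite /coord2 !mxE -surjective_pairing. Qed.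

Lemma coord2_inj n (p q : rV2 R n) : coord2 p =1 coord2 q -> p = q.
Proof.
case: p q => [p1 p2] [q1 q2] pq; congr pair; apply/rowP => i.
- by have /(congr1 fst) := pq i.
- by have /(congr1 snd) := pq i.
Qed.

Lemma coord2_cons0 n z : coord2 (@cons2 n z) ord0 = z.1.
Proof. by rewrite /coord2 !mxE !unlift_none /= -surjective_pairing. Qed.

Lemma coord2_consS n z (i : 'I_n) : coord2 (cons2 z) (lift ord0 i) = coord2 z.2 i.
Proof. by rewrite /coord2 !mxE !liftK. Qed.

Lemma measurable_coord2_fst n (i : 'I_n) :
  measurable_fun [set: rV2 R n] (fun p => p.1 ord0 i).
Proof. exact: (measurableT_comp (measurable_coordinate i) measurable_fst). Qed.

Lemma measurable_coord2_snd n (i : 'I_n) :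
  measurable_fun [set: rV2 R n] (fun p => p.2 ord0 i).
Proof. exact: (measurableT_comp (measurable_coordinate i) measurable_snd). Qed.

Lemma measurable_coord2 n (i : 'I_n) :
  measurable_fun [set: rV2 R n] (fun p => coord2 p i).
Proof.
apply/measurable_fun_pairP; split => /=.
- exact: measurable_coord2_fst.
- exact: measurable_coord2_snd.
Qed.

Lemma measurable_of_coord2 d (X : measurableType d) n
    (T : X -> 'I_n -> measurableTypeR R * measurableTypeR R) :
  (forall i, measurable_fun [set: X] (fun x => T x i)) ->
  measurable_fun [set: X] (fun x => of_coord2 (T x)).
Proof.
move=> mT; apply/measurable_fun_pairP; split => /=; apply: measurable_fun_rV => i.
- rewrite (_ : (fun _ => _) = fst \o (fun x => T x i)).
    exact: measurableT_comp.
  by apply/funext => x; rewrite !mxE.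
- rewrite (_ : (fun _ => _) = snd \o (fun x => T x i)).
    exact: measurableT_comp.
  by apply/funext => x; rewrite !mxE.
Qed.

Lemma measurable_prod_coord2 n (r : 'I_n -> measurableTypeR R * measurableTypeR R -> R) :
  (forall i, measurable_fun [set: _] (r i)) ->
  measurable_fun [set: rV2 R n] (fun p => \prod_i r i (coord2 p i)).
Proof.
move=> mr; apply: measurable_prod => i _.
exact: (measurableT_comp (mr i) (measurable_coord2 i)).
Qed.

Lemma measurable_dot n : measurable_fun [set: 'rV[R]_n * 'rV[R]_n]
  (fun p => dot p.1 p.2).
Proof.
apply: measurable_sum => i; apply: measurable_funM.
- exact: measurable_coord2_fst.
- exact: measurable_coord2_snd.
Qed.

Lemma measurable_dot2 n : measurable_fun [set: rV2 R n * rV2 R n]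
  (fun z => dot2 z.1 z.2).
Proof.
apply: measurable_funD.
- apply: (measurableT_comp (@measurable_dot n)
    (g := fun z : rV2 R n * rV2 R n => (z.1.1, z.2.1))).
  apply/measurable_fun_pairP; split => /=.
  + exact: (measurableT_comp measurable_fst measurable_fst).
  + exact: (measurableT_comp measurable_fst measurable_snd).
- apply: (measurableT_comp (@measurable_dot n)
    (g := fun z : rV2 R n * rV2 R n => (z.1.2, z.2.2))).
  apply/measurable_fun_pairP; split => /=.
  + exact: (measurableT_comp measurable_snd measurable_fst).
  + exact: (measurableT_comp measurable_snd measurable_snd).
Qed.

End coordinates.

Lemma measure_integral_indic d (T : measurableType d) (R : realType)
    (mu : {measure set T -> \bar R}) (A : set T) : measurable A ->
  mu A = (\int[mu]_x (\1_A x)%:E)%E.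
Proof. by move=> mA; rewrite integral_indic// setIT. Qed.

Section lebesgue2_theory.
Local Open Scope ereal_scope.
Context {R : realType}.
Local Notation lebn n := (lebesgue_rV R n).
Local Notation lebn2 n := (@lebesgue2 R n).

Lemma substitution_rV_cons n : substitution (pairm (leb R) (lebn n)) (lebn n.+1)
  (@rV_cons R n) (fun=> 1%R).
Proof. exact: (substitution_pushforward (pairm _ _) (@measurable_rV_cons R n)). Qed.

(** The recursion behind every product formula on R^2n. *)
Lemma substitution_cons2 n :
  substitution (pairm (leb2 R) (lebn2 n)) (lebn2 n.+1) (@cons2 R n) (fun=> 1%R).
Proof.
have h := substitution_comp (substitution_rearrange (leb R) (leb R) (lebn n) (lebn n))
  (substitution_prod (@substitution_rV_cons n) (@substitution_rV_cons n)).
by apply: eq_substitution h => // z; rewrite !mulr1.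
Qed.

(** Jacobians multiply when the variables are changed plane by plane. *)
Lemma substitution_coord2 n
    (T : 'I_n -> measurableTypeR R * measurableTypeR R -> measurableTypeR R * measurableTypeR R)
    (r : 'I_n -> measurableTypeR R * measurableTypeR R -> R) :
  (forall i, substitution (leb2 R) (leb2 R) (T i) (r i)) ->
  substitution (lebn2 n) (lebn2 n) (fun p => of_coord2 (fun i => T i (coord2 p i)))
    (fun p => \prod_i r i (coord2 p i))%R.
Proof.
elim: n T r => [|n ih] T r hT.
  apply: (@eq_substitution _ _ _ _ _ _ _ id _ (fun=> 1%R)).
  - by move=> p; apply: coord2_inj => -[].
  - by move=> p; rewrite big_ord0.
  split => // Phi _ _; by apply: eq_integral => p _; rewrite mul1e.
have mT : measurable_fun setT
    (fun p : rV2 R n.+1 => of_coord2 (fun i => T i (coord2 p i))).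
  apply: measurable_of_coord2 => i; have [mTi _ _ _] := hT i.
  exact: (measurableT_comp mTi (measurable_coord2 i)).
have mr : measurable_fun setT (fun p : rV2 R n.+1 => \prod_i r i (coord2 p i))%R.
  by apply: measurable_prod_coord2 => i; have [_ mri _ _] := hT i.
have r0 (p : rV2 R n.+1) : (0 <= \prod_i r i (coord2 p i))%R.
  by apply: prodr_ge0 => i _; have [_ _ r0 _] := hT i.
split => // Phi mPhi Phi0; have [mc _ _ hc] := @substitution_cons2 n.
rewrite -hc//; last 2 first.
- by apply: emeasurable_funM; [exact/measurable_EFinP|exact: measurableT_comp].
- by move=> p; rewrite mule_ge0// lee_fin.
rewrite -hc//.
have [_ _ _ hp] := substitution_prod (hT ord0) (ih _ _ (fun i => hT (lift ord0 i))).
under [RHS]eq_integral do rewrite mul1e.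
rewrite -[RHS]hp//; last exact: measurableT_comp.
apply: eq_integral => z _; rewrite mul1e big_ord_recl coord2_cons0.
congr ((_ * _)%:E * Phi _); first by apply: eq_bigr => i _; rewrite coord2_consS.
apply: coord2_inj => i; rewrite coord2_of; have [j ->|->] := unliftP ord0 i.
- by rewrite !coord2_consS coord2_of.
- by rewrite !coord2_cons0.
Qed.

Lemma lebesgue2_coord2_null n (i : 'I_n) (A : set (measurableTypeR R * measurableTypeR R)) :
  measurable A -> leb2 R A = 0 -> lebn2 n [set p | A (coord2 p i)] = 0.
Proof.
move=> mA A0.
have mAn m (j : 'I_m) : measurable [set p : rV2 R m | A (coord2 p j)].
  by rewrite -[X in measurable X]setTI; exact: measurable_coord2.
elim: n i => [[]//|n ih i]; have [mc _ _ hc] := @substitution_cons2 n.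
have E : lebn2 n.+1 [set p | A (coord2 p i)] =
    \int[pairm (leb2 R) (lebn2 n)]_z (\1_[set p | A (coord2 p i)] (cons2 z))%:E.
  rewrite measure_integral_indic; last exact: mAn.
  apply: etrans (esym (hc _ _ _)) _ => //.
  - by apply/measurable_EFinP; apply: measurable_indic; exact: mAn.
  - by apply: eq_integral => z _; rewrite mul1e.
have m1 : measurable_fun setT (fun z : _ * rV2 R n =>
    (\1_[set p | A (coord2 p i)] (cons2 z) : R)%:E).
  by apply/measurable_EFinP; apply: (measurableT_comp (measurable_indic (mAn _ i)) mc).
rewrite E; have [j ij|i0] := unliftP ord0 i.
- rewrite pairm_tonelli1//; apply: integral0_eq => x _.
  rewrite -[RHS](ih j) measure_integral_indic; last exact: mAn.
  apply: eq_integral => w _.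
  rewrite !indicE; congr ((nat_of_bool _)%:R%:E); apply: asbool_equiv_eq.
  by rewrite /= ij coord2_consS.
- rewrite pairm_tonelli2//; apply: integral0_eq => w _.
  rewrite -[RHS]A0 measure_integral_indic//; apply: eq_integral => z _.
  rewrite !indicE; congr ((nat_of_bool _)%:R%:E); apply: asbool_equiv_eq.
  by rewrite /= i0 coord2_cons0.
Qed.

End lebesgue2_theory.

(** * Functions in product form and planar substitutions *)

Section product_functions.
Context {R : realType}.

Lemma cintegrableR d (T : measurableType d) (mu : {measure set T -> \bar R}) (h : T -> R) :
  mu.-integrable [set: T] (fun x => (h x)%:E) -> cintegrable mu (fun x => (h x)%:C).
Proof. by move=> ih; split => //=; exact: integrable0. Qed.

Section pair.
Context d1 d2 (T1 : measurableType d1) (T2 : measurableType d2).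
Variables (m1 : {sigma_finite_measure set T1 -> \bar R})
  (m2 : {sigma_finite_measure set T2 -> \bar R}).

Lemma cmeasurable_pairM (phi : T1 -> R[i]) (psi : T2 -> R[i]) :
  cmeasurable phi -> cmeasurable psi ->
  cmeasurable (fun z : T1 * T2 => phi z.1 * psi z.2).
Proof.
move=> mphi mpsi; apply: cmeasurableM.
- exact: (cmeasurable_comp mphi measurable_fst).
- exact: (cmeasurable_comp mpsi measurable_snd).
Qed.

Lemma cintegrable_pairM (phi : T1 -> R[i]) (psi : T2 -> R[i]) :
  cintegrable m1 phi -> cintegrable m2 psi ->
  cintegrable (pairm m1 m2) (fun z => phi z.1 * psi z.2).
Proof.
move=> iphi ipsi.
have mphi := cintegrable_cmeasurable iphi.
have mpsi := cintegrable_cmeasurable ipsi.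
have mn1 : measurable_fun setT (fun x => norm1 (phi x)) by exact: measurable_norm1.
have mn2 : measurable_fun setT (fun x => norm1 (psi x)) by exact: measurable_norm1.
have mn : measurable_fun setT (fun z : T1 * T2 => norm1 (phi z.1) * norm1 (psi z.2)).
  apply: measurable_funM.
  - exact: (measurableT_comp mn1 measurable_fst).
  - exact: (measurableT_comp mn2 measurable_snd).
apply: cintegrable_ltyP; first exact: cmeasurable_pairM.
apply: (@le_lt_trans _ _
  (\int[pairm m1 m2]_z (norm1 (phi z.1) * norm1 (psi z.2))%:E)%E).
  apply: ge0_le_integral => //.
  - by move=> z _; rewrite lee_fin norm1_ge0.
  - exact/measurable_EFinP/measurable_norm1/cmeasurable_pairM.
  - exact/measurable_EFinP.
  - by move=> z _; rewrite lee_fin norm1M.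
rewrite pairm_tonelli1; last 2 first.
- exact/measurable_EFinP.
- by move=> z; rewrite lee_fin mulr_ge0// norm1_ge0.
under eq_integral => x _.
  under eq_integral do rewrite EFinM /=.
  rewrite ge0_integralZl//; last 3 first.
  - exact/measurable_EFinP.
  - by move=> y _; rewrite lee_fin norm1_ge0.
  - by rewrite lee_fin norm1_ge0.
  over.
have := cintegrable_lty iphi; have := cintegrable_lty ipsi.
have n0 d (T : measurableType d) (mu : {measure set T -> \bar R}) F :
    (0 <= \int[mu]_x (norm1 (F x))%:E)%E.
  by apply: integral_ge0 => x _; rewrite lee_fin norm1_ge0.
move=> psioo phioo; rewrite ge0_integralZr//.
- by apply: lte_mul_pinfty => //; rewrite ge0_fin_numE.
- exact/measurable_EFinP.
- by move=> x _; rewrite lee_fin norm1_ge0.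
Qed.

Lemma cintegral_pairM (phi : T1 -> R[i]) (psi : T2 -> R[i]) :
  cintegrable m1 phi -> cintegrable m2 psi ->
  cintegral (pairm m1 m2) (fun z => phi z.1 * psi z.2) =
  cintegral m1 phi * cintegral m2 psi.
Proof.
move=> iphi ipsi.
have [_ ->] := cfubini1 (cintegrable_pairM iphi ipsi).
rewrite mulrC -cintegralZ//; apply: eq_cintegral => x /=.
by rewrite cintegralZ// mulrC.
Qed.

Lemma integrable_pairM (phi : T1 -> R) (psi : T2 -> R) :
  m1.-integrable [set: T1] (fun x => (phi x)%:E) ->
  m2.-integrable [set: T2] (fun x => (psi x)%:E) ->
  (pairm m1 m2).-integrable [set: T1 * T2] (fun z => (phi z.1 * psi z.2)%:E).
Proof.
move=> /cintegrableR iphi /cintegrableR ipsi.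
have [+ _] := cintegrable_pairM iphi ipsi.
by under eq_fun do rewrite -rmorphM.
Qed.

End pair.

(** Fubini for functions in product form, by induction on the number of planes. *)
Lemma cintegral_prod n (phi : 'I_n -> measurableTypeR R * measurableTypeR R -> R[i]) :
  (forall i, cintegrable (leb2 R) (phi i)) ->
  cintegrable (@lebesgue2 R n) (fun p => \prod_i phi i (coord2 p i)) /\
  cintegral (@lebesgue2 R n) (fun p => \prod_i phi i (coord2 p i)) =
    \prod_i cintegral (leb2 R) (phi i).
Proof.
elim: n phi => [|n ih] phi iphi.
  under eq_fun do rewrite big_ord0; rewrite big_ord0.
  have c1 : cmeasurable (fun _ : rV2 R 0 => 1 : R[i]) by exact: cmeasurable_cst.
  have l1 : (@lebesgue2 R 0 : {measure set (rV2 R 0) -> \bar R}) setT = 1%E.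
    rewrite -setXTT; apply: etrans (product_measure1E _ _ _ _) _ => //=.
    by rewrite /dirac !indicE !in_setT mul1e.
  split.
    apply: cintegrable_ltyP => //.
    by rewrite integral_cst// l1 mule1 ltry.
  by rewrite /cintegral !Rintegral_cst// l1 /= mulr1 mul0r.
have [ihi ihE] := ih (fun i => phi (lift ord0 i)) (fun i => iphi _).
have mphi : cmeasurable (fun p : rV2 R n.+1 => \prod_i phi i (coord2 p i)).
  apply: cmeasurable_prod => i.
  exact: (cmeasurable_comp (cintegrable_cmeasurable (iphi i)) (measurable_coord2 i)).
have sc := @substitution_cons2 R n.
have E : (fun z => 1%:C * \prod_i phi i (coord2 (cons2 z) i)) =
    (fun z : _ * rV2 R n => phi ord0 z.1 * \prod_i phi (lift ord0 i) (coord2 z.2 i)).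
  apply/funext => z; rewrite mul1r big_ord_recl coord2_cons0; congr (_ * _).
  by apply: eq_bigr => i _; rewrite coord2_consS.
split.
- apply/(substitution_cintegrable sc mphi); rewrite E.
  exact: (cintegrable_pairM (iphi ord0) ihi).
- by rewrite -(substitution_cintegral sc mphi) E
    (cintegral_pairM (iphi ord0) ihi) ihE big_ord_recl.
Qed.

Lemma integrable_prod n (phi : 'I_n -> measurableTypeR R * measurableTypeR R -> R) :
  (forall i, (leb2 R).-integrable setT (fun z => (phi i z)%:E)) ->
  (@lebesgue2 R n).-integrable setT (fun p => (\prod_i phi i (coord2 p i))%:E).
Proof.
move=> iphi; have [[+ _] _] := cintegral_prod (fun i => cintegrableR (iphi i)).
by under eq_fun do rewrite -rmorph_prod.
Qed.

End product_functions.

Section planar_substitutions.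
Context {R : realType}.
Local Notation plane := (measurableTypeR R * measurableTypeR R)%type.

Lemma substitution_affine2 (a b c d : R) : a != 0 -> c != 0 ->
  substitution (leb2 R) (leb2 R) (fun z => (a * z.1 + b, c * z.2 + d))
    (fun=> `|a| * `|c|).
Proof.
by move=> a0 c0; exact: (substitution_prod (substitution_affine b a0)
  (substitution_affine d c0)).
Qed.

Let mfst : measurable_fun [set: plane] (fun z => z.1 : R). Proof. exact: measurable_fst. Qed.
Let msnd : measurable_fun [set: plane] (fun z => z.2 : R). Proof. exact: measurable_snd. Qed.

(** The weight of the delta function is the Jacobian of the parametrization of
    the lines; for a = 0 that parametrization exchanges the coordinates. *)
Lemma substitution_line (a : R) :
  substitution (leb2 R) (leb2 R)
    (fun z => (line_x a z.1 z.2, line_u a z.1 z.2)) (fun=> line_weight a).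
Proof.
rewrite /line_x /line_u /line_weight; case: (eqVneq a 0) => [_|a0].
  exact: substitution_swap.
have mT : measurable_fun [set: plane] (fun z => a^-1 * z.1 + (1 - a^-1) * z.2 : measurableTypeR R).
  by apply: measurable_funD; apply: measurable_funM => //; exact: measurable_cst.
apply: (substitution_fiber (N := set0) (n1 := leb R)
  (T := fun z : plane => (a^-1 * z.1 + (1 - a^-1) * z.2 : measurableTypeR R))) => //.
move=> t _; rewrite -normfV.
by apply: (substitution_affine ((1 - a^-1) * t)); rewrite invr_neq0.
Qed.

Lemma substitution_shear :
  substitution (leb2 R) (leb2 R) (fun z => (z.1, z.2 - z.1)) (fun=> 1).
Proof.
have mT : measurable_fun [set: plane] (fun z => z.1 - z.2 : measurableTypeR R).
  exact: measurable_funB.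
have h : substitution (leb2 R) (leb2 R) (fun z : plane => (z.1 - z.2, z.2)) (fun=> 1).
  apply: (substitution_fiber (N := set0) (n1 := leb R)
    (T := fun z : plane => (z.1 - z.2 : measurableTypeR R))) => //.
  move=> t _; have := substitution_affine (- t) (oner_neq0 R).
  by rewrite normr1; apply: eq_substitution => // s; rewrite mul1r.
have := substitution_comp (substitution_swap (leb R) (leb R))
  (substitution_comp h (substitution_swap (leb R) (leb R))).
by apply: eq_substitution => // z; rewrite !mulr1.
Qed.

(** In each plane (x_i, u_i) of Fourier variables, (a, r) |-> (a r, (1 - a) r)
    has Jacobian r: this is the change of variables relating the slices of
    the Fourier transform to the whole of it. *)
Lemma substitution_slices :
  substitution (leb2 R) (leb2 R) (fun z => (z.1 * z.2, (1 - z.1) * z.2)) (fun z => `|z.2|).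
Proof.
have mT : measurable_fun [set: plane] (fun z => z.1 * z.2 : measurableTypeR R).
  exact: measurable_funM.
have h : substitution (leb2 R) (leb2 R) (fun z : plane => (z.1 * z.2, z.2)) (fun z => `|z.2|).
  apply: (substitution_fiber (m1 := leb R) (m2 := leb R) (n1 := leb R)
    (N := [set 0 : R]) (rho := fun z : plane => `|z.2 : R|)
    (T := fun z : plane => (z.1 * z.2 : measurableTypeR R))) => //.
  - exact: lebesgue_measure_set1.
  - exact: measurableT_comp.
  move=> t /eqP t0; have := substitution_affine 0 t0.
  by apply: eq_substitution => // s; rewrite addr0 mulrC.
apply: eq_substitution (substitution_comp h substitution_shear).
- by move=> z /=; rewrite mulrBl mul1r.
- by move=> z /=; rewrite mulr1.
Qed.

(** On the coordinate hyperplanes real powers of 0 take conventional values, so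
    the identities between weights are only claimed off these null sets. *)
Lemma ae_coord2_neq0 n :
  {ae @lebesgue2 R n, forall p : rV2 R n, forall i : 'I_n, p.1 ord0 i != 0 /\ p.2 ord0 i != 0}.
Proof.
have key (A : set plane) (i : 'I_n) : measurable A -> leb2 R A = 0%E ->
    {ae @lebesgue2 R n, forall p, ~ A (coord2 p i)}.
  move=> mA A0; exists [set p | A (coord2 p i)]; split.
  - by rewrite -[X in measurable X]setTI; exact: measurable_coord2.
  - exact: lebesgue2_coord2_null.
  - by move=> p /= /contrapT.
have L0 : @lebesgue_measure R [set 0] = 0%E by exact: lebesgue_measure_set1.
have h1 : leb2 R ([set 0] `*` setT) = 0%E.
  by rewrite /pairm product_measure1E//= L0 mul0e.
have h2 : leb2 R (setT `*` [set 0]) = 0%E.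
  by rewrite /pairm product_measure1E//= L0 mule0.
apply: filter_forall => i.
have := key _ i (measurableX (measurable_set1 0) measurableT) h1.
have := key _ i (measurableX measurableT (measurable_set1 0)) h2.
apply: filterS2 => p /= n2 n1; split; apply/eqP => e; [apply: n1|apply: n2];
  by rewrite /= e.
Qed.

End planar_substitutions.

(** * Integrals on the line *)

Section line_integrals.
Context {R : realType}.
Local Notation mu := (leb R).
Local Notation prim b t :=
  (- expR (- t) + (b * sin (b * t) - cos (b * t)) * expR (- t) / (1 + b ^+ 2)).

Let is_derive_prim (b t : R) : is_derive t 1 (fun t => prim b t)
  ((1 + cos (b * t)) * expR (- t)).
Proof.
have b0 : 1 + b ^+ 2 != 0 by rewrite gt_eqF// ltr_wpDr// sqr_ge0.
have dN : is_derive t 1 (fun t => expR (- t)) (- expR (- t)).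
  by apply: is_derive_eq; rewrite mulrN1.
have ds : is_derive t 1 (fun t => sin (b * t)) (b * cos (b * t)).
  by apply: is_derive_eq; rewrite -[_%:A]/(b * 1) mulr1 mulrC.
have dc : is_derive t 1 (fun t => cos (b * t)) (- (b * sin (b * t))).
  by apply: is_derive_eq; rewrite -[_%:A]/(b * 1) mulr1 mulrC mulrN.
apply: is_derive_eq; rewrite /GRing.scale /=; field.
exact: b0.
Qed.

Let cvg_prim (b : R) : prim b t @[t --> +oo] --> 0.
Proof.
pose C : R := 1 + (`|b| + 1) / (1 + b ^+ 2).
have b0 : 0 < 1 + b ^+ 2 by rewrite ltr_wpDr// sqr_ge0.
have h : (C * expR (- t)) @[t --> +oo] --> (0 : R).
  by rewrite -(mulr0 C); apply: cvgM; [exact: cvg_cst|exact: cvgr_expR].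
apply/norm_cvg0P; apply: (squeeze_cvgr _ (cvg_cst _) h).
apply: nearW => t; rewrite normr_ge0 /=.
have s1 : `|sin (b * t)| <= 1 by rewrite ler_norml sin_geN1 sin_le1.
have c1 : `|cos (b * t)| <= 1 by rewrite ler_norml cos_geN1 cos_le1.
have e0 := expR_ge0 (- t).
apply: (le_trans (ler_normD _ _)); rewrite normrN !normrM (ger0_norm e0) mulrDl mul1r.
rewrite lerD2l mulrAC normfV (gtr0_norm b0) ler_wpM2r// ler_wpM2r ?invr_ge0 ?(ltW b0)//.
apply: (le_trans (ler_normB _ _)); rewrite normrM lerD//.
by rewrite -[leRHS]mulr1 ler_wpM2l.
Qed.

Let damped_cos (b t : R) : R := (1 + cos (b * t)) * expR (- `|t|).

Let damped_cos_ge0 b t : 0 <= damped_cos b t.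
Proof. by rewrite mulr_ge0 ?expR_ge0//; have := cos_geN1 (b * t); lra. Qed.

Let continuous_damped_cos b : continuous (damped_cos b).
Proof.
move=> t; apply: cvgM.
- apply: cvgD; first exact: cvg_cst.
  apply: continuous_cvg; first exact: continuous_cos.
  by apply: cvgM; [exact: cvg_cst|exact: cvg_id].
- apply: continuous_cvg; first exact: continuous_expR.
  by apply: cvgN; exact: norm_continuous.
Qed.

(** Adding 1 to the cosine makes the integrand nonnegative, so that the
    monotone form of the fundamental theorem applies on the half-line. *)
Let integral_damped_cos (b : R) :
  (\int[mu]_t (damped_cos b t)%:E = (2 + 2 / (1 + b ^+ 2))%:E)%E.
Proof.
have even : damped_cos b =1 damped_cos b \o -%R.
  by move=> t; rewrite /damped_cos /= mulrN cosN normrN.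
rewrite (ge0_symfun_integralT (@damped_cos_ge0 b) (@continuous_damped_cos b) even).
rewrite -set_itvcy (@ge0_continuous_FTC2y _ _ (fun t => prim b t) 0 0)//.
- rewrite mulr0 oppr0 expR0 sin0 cos0 -EFinB -EFinM; congr EFin; field.
  by rewrite gt_eqF// ltr_wpDr// sqr_ge0.
- exact: continuous_subspaceT.
- apply: cvg_at_right_filter.
  have : derivable (fun t => prim b t) 0 1 by case: (is_derive_prim b 0).
  by move=> /derivable1_diffP/differentiable_continuous.
- move=> t; rewrite in_itv /= andbT => t0; rewrite derive1E.
  by case: (is_derive_prim b t) => _ ->; rewrite /damped_cos gtr0_norm.
Qed.

Let measurable_expN : measurable_fun [set: R] (fun t : R => expR (- `|t|)).
Proof.
by apply: continuous_measurable_fun => t; apply: continuous_cvg;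
  [exact: continuous_expR|apply: cvgN; exact: norm_continuous].
Qed.

Let integral_expN : (\int[mu]_t (expR (- `|t|))%:E)%E = (2 : R)%:E.
Proof.
have := integral_damped_cos 0.
under eq_integral do rewrite /damped_cos mul0r cos0 EFinM.
rewrite ge0_integralZl//; last exact/measurable_EFinP.
rewrite expr0n addr0 divr1.
have : (0 <= \int[mu]_t (expR (- `|t|))%:E)%E.
  by apply: integral_ge0 => x _; rewrite lee_fin expR_ge0.
case: (\int[mu]_t _)%E => [r _| |]//.
- by rewrite -EFinM => -[h]; congr EFin; lra.
- by rewrite gt0_muley// lte_fin.
Qed.

Lemma integrable_expN : mu.-integrable setT (fun t => (expR (- `|t|))%:E).
Proof.
apply/integrableP; split; first exact/measurable_EFinP.
under eq_integral do rewrite gee0_abs ?lee_fin ?expR_ge0//.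
by rewrite integral_expN ltry.
Qed.

(** The Poisson kernel on the line; the sine part vanishes by parity. *)
Lemma cintegral_cis_expN (b : R) :
  cintegrable mu (fun t => cis (b * t) * (expR (- `|t|))%:C) /\
  cintegral mu (fun t => cis (b * t) * (expR (- `|t|))%:C) = (2 / (1 + b ^+ 2))%:C.
Proof.
have mb : measurable_fun [set: R] (fun t : R => b * t) by exact: mulrl_measurable.
have i1 : cintegrable mu (fun t => cis (b * t) * (expR (- `|t|))%:C).
  apply: (cintegrable_le (B := fun t : measurableTypeR R => 2 * expR (- `|t : R|))).
  - by apply: cmeasurableM; [exact: cmeasurable_cis|exact: cmeasurableR].
  - exact/integrableZl_EFin/integrable_expN.
  - move=> t; rewrite mulrC norm1RM mulrC ger0_norm ?expR_ge0//.
    by rewrite ler_wpM2r ?expR_ge0// norm1_cis.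
split => //; apply: complex_eq => /=.
- have [ic _] := i1.
  have : \int[mu]_t damped_cos b t = 2 + 2 / (1 + b ^+ 2).
    by rewrite /Rintegral integral_damped_cos.
  rewrite (_ : damped_cos b = fun t => expR (- `|t|) +
      complex.Re (cis (b * t) * (expR (- `|t|))%:C)); last first.
    by apply/funext => t; rewrite complexReM /= mulr0 subr0 /damped_cos mulrDl mul1r.
  rewrite RintegralD//; last exact: integrable_expN.
  by rewrite {1}/Rintegral integral_expN /= => /addrI.
- have mI : measurable_fun [set: measurableTypeR R]
      (fun t => complex.Im (cis (b * t) * (expR (- `|t|))%:C)).
    by case: (cintegrable_cmeasurable i1).
  have N10 : -1 != 0 :> R by rewrite oppr_eq0 oner_eq0.
  have := substitution_Rintegral (substitution_affine 0 N10) mI.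
  rewrite normrN normr1; under eq_Rintegral => t _.
    rewrite mul1r addr0 mulN1r complexImM /= mulr0 add0r normrN mulrN sinN mulNr.
    over.
  set I := (X in _ = X).
  have -> : \int[mu]_t - (sin (b * t) * expR (- `|t|)) = - I.
    rewrite -mulN1r -RintegralZl//; last by case: i1.
    by apply: eq_Rintegral => t _; rewrite complexImM /= mulr0 add0r mulN1r.
  by move=> h; have I0 : I = 0 by lra.
Qed.

Lemma integrable_oneDsqrV : mu.-integrable setT (fun t => ((1 + t ^+ 2)^-1)%:E) /\
  \int[mu]_t (1 + t ^+ 2)^-1 = pi.
Proof.
have h : (\int[mu]_t ((1 + t ^+ 2)^-1)%:E = pi%:E)%E.
  have even : (fun t : R => (oneDsqr t)^-1) =1 (fun t => (oneDsqr t)^-1) \o -%R.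
    by move=> t; rewrite /= /oneDsqr sqrrN.
  have ge0 (t : R) : 0 <= (oneDsqr t)^-1 by rewrite invr_ge0 addr_ge0 ?sqr_ge0.
  rewrite (ge0_symfun_integralT ge0 (@continuous_oneDsqrV R) even).
  by rewrite -set_itvcy integral0y_oneDsqr -EFinM; congr EFin; field.
split; last by rewrite /Rintegral h.
apply/integrableP; split.
  apply/measurable_EFinP; apply: continuous_measurable_fun.
  exact: continuous_oneDsqrV.
under eq_integral do rewrite gee0_abs ?lee_fin ?invr_ge0 ?addr_ge0 ?sqr_ge0//.
by rewrite h ltry.
Qed.

End line_integrals.

Section singular_weight.
Context {R : realType}.
Local Notation mu := (leb R).

Let F_ (k : nat) : set R := `[k.+2%:R^-1, 1]%classic.

Let bigcup_F : \bigcup_k F_ k = `]0, 1]%classic :> set R.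
Proof.
apply/seteqP; split => s /=.
  move=> [k _]; rewrite /F_ /= !in_itv /= => /andP[h ->]; rewrite andbT.
  by rewrite (lt_le_trans _ h)// invr_gt0 ltr0n.
rewrite in_itv /= => /andP[s0 s1]; exists (Num.truncn s^-1) => //=.
rewrite /F_ /= in_itv /= s1 andbT invf_ple ?posrE ?ltr0n//.
have := truncnS_gt s^-1; rewrite -natr1 => h; apply: le_trans (ltW h) _.
by rewrite natr1 ler_nat.
Qed.

Let integral_powR_le (g : R) : g < 1 ->
  (\int[mu]_(s in `]0%R, 1%R]) (s `^ (- g))%:E <= ((1 - g)^-1)%:E)%E.
Proof.
move=> g1; have g1' : 0 < 1 - g by rewrite subr_gt0.
have mp : measurable_fun [set: R] (fun s : R => s `^ (- g)) by exact: measurable_powR.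
have mF k : measurable (F_ k) by exact: measurable_itv.
rewrite -bigcup_F.
have h : (\int[mu]_(s in F_ k) (s `^ (- g))%:E)%E @[k --> \oo] -->
    (\int[mu]_(s in \bigcup_k F_ k) (s `^ (- g))%:E)%E.
  apply: ge0_nondecreasing_set_cvg_integral => //.
  - move=> k l kl; apply/subsetPset => s; rewrite /F_ /= !in_itv /= => /andP[h ->].
    rewrite andbT (le_trans _ h)// lef_pV2 ?posrE ?ltr0n// ler_nat.
    by rewrite !ltnS.
  - by move=> k; apply/measurable_EFinP; exact: measurable_funTS.
  - by move=> k s _; rewrite lee_fin powR_ge0.
rewrite -(cvg_lim _ h)//; apply: lime_le; first by apply/cvg_ex; eexists; exact: h.
apply: nearW => k.
have a0 : 0 < k.+2%:R^-1 :> R by rewrite invr_gt0 ltr0n.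
have a1 : k.+2%:R^-1 < 1 :> R by rewrite invf_lt1 ?ltr0n// ltr1n.
pose P (s : R) := (1 - g)^-1 * s `^ (1 - g).
have dP (s : R) : 0 < s -> is_derive s 1 P (s `^ (- g)).
  move=> s0; have := is_derive1_powR (1 - g) s0 => d.
  apply: is_derive_eq; rewrite /GRing.scale /= mulrA mulVf ?gt_eqF// mul1r.
  by congr (_ `^ _); ring.
have cP (s : R) : 0 < s -> P x @[x --> s] --> P s.
  move=> s0; have [d _] := dP s s0.
  by move: d => /derivable1_diffP/differentiable_continuous.
rewrite (continuous_FTC2 a1 (F := P)).
- rewrite -EFinB lee_fin /P powR1 mulr1 gerBl mulr_ge0 ?powR_ge0//.
  by rewrite invr_ge0 ltW.
- apply: continuous_in_subspaceT => s; rewrite inE /= in_itv /= => /andP[h1 _].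
  have s0 : 0 < s by exact: lt_le_trans h1.
  have [d _] : is_derive s 1 (fun s => s `^ (- g)) (- g * s `^ (- g - 1)).
    exact: is_derive1_powR.
  by move: d => /derivable1_diffP/differentiable_continuous.
- split.
  + move=> s; rewrite in_itv /= => /andP[h1 _].
    by have [] := dP s (lt_trans a0 h1).
  + by apply: cvg_at_right_filter; exact: cP.
  + by apply: cvg_at_left_filter; exact: cP.
- move=> s; rewrite in_itv /= => /andP[h1 _]; rewrite derive1E.
  by have [_ ->] := dP s (lt_trans a0 h1).
Qed.

(** The weight that dominates each coordinate of the filtered transform: a
    singularity of order g < 1 at 0, and decay of order at least 2 at infinity. *)
Lemma integrable_singular_weight (g : R) : 0 <= g -> g < 1 ->
  mu.-integrable setT (fun s => (`|s| `^ (- g) / (1 + s ^+ 2))%:E).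
Proof.
move=> g0 g1; pose u (s : R) := s `^ (- g) * \1_(`]0, 1]%classic : set R) s.
have mI : measurable (`]0, 1]%classic : set R) by exact: measurable_itv.
have mu_ : measurable_fun [set: R] u.
  apply: measurable_funM; first exact: measurable_powR.
  exact: measurable_indic.
have u0 s : 0 <= u s by rewrite mulr_ge0 ?powR_ge0// indicE.
have iu : mu.-integrable setT (fun s => (u s)%:E).
  apply/integrableP; split; first exact/measurable_EFinP.
  under eq_integral do rewrite gee0_abs ?lee_fin//.
  rewrite (_ : \int[mu]_x _ = \int[mu]_(s in `]0%R, 1%R]) (s `^ (- g))%:E)%E.
    exact: le_lt_trans (integral_powR_le g1) (ltry _).
  rewrite [RHS]integral_mkcond.
  apply: eq_integral => s _; rewrite /u patchE indicE.
  by case: ifP => _; rewrite ?mulr1 ?mulr0.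
have iuN : mu.-integrable setT (fun s : R => (u (- s))%:E).
  have N10 : -1 != 0 :> R by rewrite oppr_eq0 oner_eq0.
  have hs := substitution_affine 0 N10.
  have mEu : cmeasurable (fun s : measurableTypeR R => (u s)%:C) by exact: cmeasurableR.
  have [_ /(_ (cintegrableR iu))[+ _]] := substitution_cintegrable hs mEu.
  apply: eq_integrable => // s _.
  by rewrite complexReM /= mul0r subr0 normrN normr1 mul1r addr0 mulN1r.
have [iv _] := @integrable_oneDsqrV R.
have iB := integrableD measurableT (integrableD measurableT iu iuN) iv.
apply: le_integrable iB => //.
  apply/measurable_EFinP; apply: measurable_funM.
    apply: (measurableT_comp (measurable_powR _)).
    exact: normr_measurable.
  apply: continuous_measurable_fun; exact: continuous_oneDsqrV.
move=> s _ /=; rewrite lee_fin.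
have v0 : 0 < 1 + s ^+ 2 by rewrite ltr_wpDr ?sqr_ge0.
rewrite ger0_norm ?mulr_ge0 ?powR_ge0 ?invr_ge0 ?(ltW v0)//.
apply: le_trans (ler_norm _).
have v1 : (1 + s ^+ 2)^-1 <= 1 by rewrite invf_le1// lerDl sqr_ge0.
have v2 : 0 <= (1 + s ^+ 2)^-1 by rewrite invr_ge0 ltW.
have [s1|s1] := ltP 1 `|s|.
  have p1 : `|s| `^ (- g) <= 1.
    by rewrite -[leRHS](powRr0 `|s|) ler_powR ?(ltW s1)// oppr_le0.
  apply: (@le_trans _ _ (1 + s ^+ 2)^-1); first by rewrite ler_piMl.
  by rewrite lerDr addr_ge0.
have [->|s0] := eqVneq s 0.
  rewrite normr0 expr0n addr0 invr1 mulr1.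
  have [->|gn0] := eqVneq g 0; first by rewrite oppr0 powRr0 lerDr addr_ge0.
  by rewrite powR0 ?oppr_eq0// addr_ge0// addr_ge0.
apply: (@le_trans _ _ (`|s| `^ (- g))); first by rewrite ler_piMr ?powR_ge0.
apply: (@le_trans _ _ (u s + u (- s))); last by rewrite lerDl.
have [sp|sn] := ltP 0 s.
  rewrite gtr0_norm// in s1 *; rewrite /u indicE mem_set ?mulr1; last first.
    by rewrite /= in_itv /= sp.
  by rewrite lerDl mulr_ge0 ?powR_ge0// indicE.
have sn' : s < 0 by rewrite lt_neqAle s0.
rewrite ltr0_norm// in s1 *; rewrite /u [X in _ <= _ + _ * X]indicE mem_set ?mulr1; last first.
  by rewrite /= in_itv /= oppr_gt0 sn'.
by rewrite lerDr mulr_ge0 ?powR_ge0// indicE.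
Qed.

End singular_weight.

(** * Coordinates, maximum norm and continuity on R^2n *)

Section norm_coordinates.
Context {R : realType} {n : nat}.
Implicit Types p q : rV2 R n.

Let norm_rV_coord (x : 'rV[R]_n) i : `|x ord0 i| <= `|x|.
Proof.
rewrite -[leRHS]/(mx_norm x) mx_normrE.
by apply: (le_bigmax _ (fun ij => `|x ij.1 ij.2|) (ord0, i)).
Qed.

Lemma norm_fst_coord p i : `|p.1 ord0 i| <= `|p|.
Proof. by rewrite prod_normE le_max norm_rV_coord. Qed.

Lemma norm_snd_coord p i : `|p.2 ord0 i| <= `|p|.
Proof. by rewrite prod_normE le_max orbC norm_rV_coord. Qed.

Lemma norm_rV2_lt p (e : R) : 0 < e ->
  (forall i, `|p.1 ord0 i| < e /\ `|p.2 ord0 i| < e) -> `|p| < e.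
Proof.
move=> e0 h; rewrite prod_normE gt_max; apply/andP; split;
  rewrite -[ltLHS]/(mx_norm _) mx_normrE; apply/bigmax_ltP; split => //;
  by move=> [i j] _; rewrite (ord1 i) /=; case: (h j).
Qed.

(** The maximum norm is attained at a coordinate. *)
Lemma norm_rV2_attained p : `|p| != 0 ->
  exists i, `|p| = `|p.1 ord0 i| \/ `|p| = `|p.2 ord0 i|.
Proof.
have rV (x : 'rV[R]_n) : `|x| != 0 -> exists i, `|x| = `|x ord0 i|.
  by move=> /mx_norm_neq0[[i j]] /= h; exists j; rewrite [LHS]h (ord1 i).
rewrite prod_normE; case: (leP `|p.1| `|p.2|) => _ /rV[i ->]; exists i.
- by right.
- by left.
Qed.

Let norm_box q (r : R) : [set p : rV2 R n | `|p - q| < r] =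
  [set p : rV2 R n | 0 < r /\ forall i, `|p.1 ord0 i - q.1 ord0 i| < r /\
    `|p.2 ord0 i - q.2 ord0 i| < r].
Proof.
apply/seteqP; split => p /=.
  move=> h; split; first exact: le_lt_trans h.
  move=> i; split; apply: le_lt_trans h.
  - by have := norm_fst_coord (p - q) i; rewrite !mxE.
  - by have := norm_snd_coord (p - q) i; rewrite !mxE.
by move=> [r0 h]; apply: norm_rV2_lt => // i; rewrite !mxE.
Qed.

Let measurable_norm_box q (r : R) : measurable [set p : rV2 R n | `|p - q| < r].
Proof.
rewrite norm_box; have [r0|r0] := ltP 0 r; last first.
  by rewrite (_ : [set _ | _] = set0)//; apply/seteqP; split => // p [].
have key (g : rV2 R n -> R) c : measurable_fun setT g ->
    measurable [set p | `|g p - c| < r].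
  move=> mg; rewrite (_ : [set _ | _] = g @^-1` `]c - r, c + r[); last first.
    by apply/seteqP; split => p /=; rewrite in_itv/= ltr_distl.
  by rewrite -[X in measurable X]setTI; apply: mg => //; exact: measurable_itv.
rewrite (_ : [set _ | _] = \bigcap_(i in [set: 'I_n])
    ([set p : rV2 R n | `|p.1 ord0 i - q.1 ord0 i| < r] `&`
     [set p : rV2 R n | `|p.2 ord0 i - q.2 ord0 i| < r])); last first.
  by apply/seteqP; split => p /= => [[_ h] i _|h]; [exact: h|split => // i; exact: h].
apply: fin_bigcap_measurable; first exact: finite_finset.
move=> i _; apply: measurableI; apply: key.
- exact: measurable_coord2_fst.
- exact: measurable_coord2_snd.
Qed.

(** The measurable structure is the one generated by the coordinates; open
    sets belong to it because they are countable unions of rational boxes. *)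
Lemma open_measurable_rV2 (U : set (rV2 R n)) : open U -> measurable U.
Proof.
move=> oU; pose I := (('rV[rat]_n * 'rV[rat]_n) * nat)%type.
pose c (z : I) : rV2 R n := (map_mx ratr z.1.1, map_mx ratr z.1.2).
pose B (z : I) := [set p : rV2 R n | `|p - c z| < z.2.+1%:R^-1].
have -> : U = \bigcup_(z : I) (if `[< B z `<=` U >] then B z else set0).
  apply/seteqP; split => p; last by move=> [z _]; case: asboolP => // h; exact: h.
  move=> Up; have /nbhs_normP[e /= e0 eU] : nbhs p U by move: oU; rewrite openE; exact.
  have e20 : 0 < e / 2 by rewrite divr_gt0.
  have [N _ /(_ N (leqnn _)) /= Ne] := near_infty_natSinv_lt (PosNum e20).
  set r : R := N.+1%:R^-1 in Ne.
  have r0 : 0 < r by rewrite invr_gt0 ltr0n.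
  have rat_near (x : 'rV[R]_n) :
      exists y : 'rV[rat]_n, forall i, `|x ord0 i - ratr (y ord0 i)| < r.
    have /choice[f fP] : forall i : 'I_n, exists y : rat, `|x ord0 i - ratr y| < r.
      move=> i; have [y] := @rat_in_itvoo R (x ord0 i - r) (x ord0 i + r) ltac:(lra).
      by rewrite in_itv /= => h; exists y; rewrite distrC ltr_distl.
    by exists (\row_i f i) => i; rewrite mxE.
  have [y1 h1] := rat_near p.1; have [y2 h2] := rat_near p.2.
  exists ((y1, y2), N) => //.
  have Bp : B ((y1, y2), N) p.
    by rewrite /B /=; apply: norm_rV2_lt => // i; rewrite !mxE; split; [exact: h1|exact: h2].
  case: asboolP => // -[] q Bq; apply: eU => /=.
  rewrite (_ : p - q = (p - c ((y1, y2), N)) - (q - c ((y1, y2), N))); last first.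
    by rewrite opprB addrA subrK.
  apply: le_lt_trans (ler_normB _ _) _.
  move: Bp Bq; rewrite /B /= -/r => Bp Bq; lra.
apply: countable_bigcupT_measurable; first exact: countableP.
by move=> z; case: ifP => _; [exact: measurable_norm_box|exact: measurable0].
Qed.

Lemma continuous_measurable_rV2 (g : rV2 R n -> R) :
  continuous g -> measurable_fun [set: rV2 R n] g.
Proof.
move=> /continuousP cg; apply: (measurability _ (RGenOpens.measurableE R)).
move=> _ [_ [a [b ->] <-]]; rewrite setTI; apply: open_measurable_rV2.
exact/cg/interval_open.
Qed.

Definition decay (N : nat) p : R := (1 + `|p|) ^- N.

Lemma decay_gt0 N p : 0 < decay N p.
Proof. by rewrite invr_gt0 exprn_gt0// ltr_pwDl. Qed.

Lemma continuous_inv_decay N : continuous (fun p : rV2 R n => (1 + `|p|) ^+ N).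
Proof.
move=> p; apply: (@continuous_comp _ _ _ (fun p : rV2 R n => 1 + `|p|) (fun t => t ^+ N)).
- by apply: cvgD; [exact: cvg_cst|exact: norm_continuous].
- exact: exprn_continuous.
Qed.

Lemma measurable_inv_decay N :
  measurable_fun [set: rV2 R n] (fun p => (1 + `|p|) ^+ N).
Proof. by apply: continuous_measurable_rV2; exact: continuous_inv_decay. Qed.

Lemma measurable_decay N : measurable_fun [set: rV2 R n] (decay N).
Proof.
apply: continuous_measurable_rV2 => p; apply: cvgV.
  by rewrite expf_neq0// gt_eqF// ltr_pwDl.
exact: continuous_inv_decay.
Qed.

(** Powers of the maximum norm, in which decay is measured, control the product
    weights, which are integrated by Fubini. *)
Lemma weight_le_norm p : \prod_i ((1 + (p.1 ord0 i) ^+ 2) * (1 + (p.2 ord0 i) ^+ 2))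
  <= (1 + `|p|) ^+ (4 * n).
Proof.
have sq (x : R) : `|x| <= `|p| -> 1 + x ^+ 2 <= (1 + `|p|) ^+ 2.
  move=> xp; rewrite -(real_normK (num_real x)).
  have : `|x| ^+ 2 <= `|p| ^+ 2 by rewrite ler_pXn2r ?nnegrE //.
  have := normr_ge0 p; nra.
have p0 (x : R) : 0 <= 1 + x ^+ 2 by rewrite addr_ge0 ?sqr_ge0.
have := @ler_prod _ _ (index_enum 'I_n) xpredT
  (fun i => (1 + (p.1 ord0 i) ^+ 2) * (1 + (p.2 ord0 i) ^+ 2))
  (fun i => (1 + `|p|) ^+ 4).
rewrite prodr_const card_ord -exprM; apply => i _; rewrite mulr_ge0//=.
rewrite (_ : 4 = 2 + 2)%N// exprD ler_pM// sq//.
- exact: norm_fst_coord.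
- exact: norm_snd_coord.
Qed.

Lemma integrable_decay :
  (@lebesgue2 R n).-integrable setT (fun p => (decay (4 * n) p)%:E).
Proof.
have [iv _] := @integrable_oneDsqrV R.
have := @integrable_prod R n _ (fun i => integrable_pairM iv iv).
apply: le_integrable => //; first by apply/measurable_EFinP; exact: measurable_decay.
move=> p _; rewrite /= lee_fin.
rewrite ger0_norm ?(ltW (decay_gt0 _ _))// (le_trans _ (ler_norm _))//.
under eq_bigr do rewrite -invfM; rewrite prodfV lef_pV2 ?posrE.
- exact: weight_le_norm.
- by rewrite exprn_gt0// ltr_pwDl.
- by apply: prodr_gt0 => i _; rewrite mulr_gt0// ltr_pwDl// sqr_ge0.
Qed.

End norm_coordinates.

(** * Schwartz functions and the decay of their transforms *)

Lemma substitution_scale (R : realType) n (a : R) (b : rV2 R n) : a != 0 ->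
  substitution (@lebesgue2 R n) (@lebesgue2 R n) (fun p => a *: p + b)
    (fun=> (`|a| * `|a|) ^+ n).
Proof.
move=> a0; have h (i : 'I_n) := substitution_affine2 (b.1 ord0 i) (b.2 ord0 i) a0 a0.
apply: eq_substitution (substitution_coord2 h) => p.
- by apply: coord2_inj => i; rewrite coord2_of /coord2 !mxE.
- by rewrite prodr_const card_ord.
Qed.

Section difference_quotients.
Context {R : realType}.

Lemma cvg_invS0 : (k.+1%:R^-1 : R) @[k --> \oo] --> 0^'.
Proof.
move=> A [e /= e0 eA]; have [N _ NP] := near_infty_natSinv_lt (PosNum e0).
exists N => // k /= Nk; apply: eA => /=.
- by rewrite sub0r normrN gtr0_norm ?invr_gt0 ?ltr0n//; exact: NP.
- by rewrite gt_eqF// invr_gt0 ltr0n.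
Qed.

Lemma cvg_invS : (k.+1%:R^-1 : R) @[k --> \oo] --> 0.
Proof. exact: cvg_trans cvg_invS0 (cvg_within _). Qed.

Lemma cvg_difference_quotient (V : normedModType R) (F : V -> R) x v :
  derivable F x v ->
  k.+1%:R * (F (x + k.+1%:R^-1 *: v) - F x) @[k --> \oo] --> 'D_v F x.
Proof.
move=> dF; have := cvg_comp _ _ cvg_invS0 dF.
apply: cvg_trans; apply: near_eq_cvg; apply: nearW => k /=.
by rewrite invrK [_ *: v + x]addrC.
Qed.

Lemma is_derive_line (V : normedModType R) (F : V -> R) x v (t : R) :
  derivable F (x + t *: v) v ->
  is_derive t 1 (fun t : R => F (x + t *: v)) ('D_v F (x + t *: v)).
Proof.
have E : (fun h : R => h^-1 *: (((fun t => F (x + t *: v)) \o shift t) (h *: 1) -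
      F (x + t *: v))) =
    (fun h => h^-1 *: ((F \o shift (x + t *: v)) (h *: v) - F (x + t *: v))).
  apply/funext => h /=; congr (_ *: (F _ - _)).
  by rewrite /shift /= -[h *: 1]/(h * 1) mulr1 scalerDl addrCA.
by move=> dF; split; rewrite /derivable /derive E.
Qed.

End difference_quotients.

Section schwartz_functions.
Context {R : realType} {n : nat}.
Local Notation V := (rV2 R n).
Local Notation mu := (@lebesgue2 R n).
Implicit Types (F : V -> R) (f : V -> R[i]).

Lemma schwartz_real_differentiable F : schwartz_real F -> forall x, differentiable F x.
Proof. by move=> [/(_ [::])]. Qed.

Lemma schwartz_real_derive F v : schwartz_real F -> schwartz_real (fun x => 'D_v F x).
Proof.
have E s : iter_derive s (fun x => 'D_v F x) = iter_derive (rcons s v) F.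
  by rewrite /iter_derive foldr_rcons.
by move=> [h1 h2]; split=> [s x|s k]; rewrite E.
Qed.

Lemma schwartz_real_decay F : schwartz_real F -> forall N,
  exists2 C, 0 <= C & forall p : V, `|F p| <= C * decay N p.
Proof.
move=> [_ /(_ [::])] h N; have [C hC] := h N; exists C.
  by apply: le_trans (hC 0); rewrite mulr_ge0// exprn_ge0// addr_ge0.
move=> p; rewrite /decay ler_pdivlMr ?exprn_gt0 ?ltr_pwDl// mulrC.
exact: hC.
Qed.

Lemma decay_translate N (p v : V) (c : R) : `|c| <= 1 ->
  decay N (p + c *: v) <= (1 + `|v|) ^+ N * decay N p.
Proof.
move=> c1; rewrite /decay -[leLHS]mul1r ler_pdivrMr ?exprn_gt0 ?ltr_pwDl//.
rewrite mulrAC ler_pdivlMr ?exprn_gt0 ?ltr_pwDl// mul1r -exprMn.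
apply: lerXn2r; rewrite ?nnegrE ?mulr_ge0 ?addr_ge0//.
have cv : `|c *: v| <= `|v| by rewrite normrZ ler_piMl.
have : `|p| <= `|p + c *: v| + `|v|.
  rewrite -{1}(addrK (c *: v) p); apply: le_trans (ler_normB _ _) _.
  by rewrite lerD2l.
have := normr_ge0 v; have := normr_ge0 (p + c *: v); nra.
Qed.

(** A bound on difference quotients that is uniform in the step, by the mean value
    theorem; it is what dominated convergence asks for in [fourier2_cderive]. *)
Lemma schwartz_real_increment F (v : V) : schwartz_real F -> forall N,
  exists2 C, 0 <= C & forall (p : V) (h : R), 0 < h -> h <= 1 ->
    `|F (p + h *: v) - F p| <= h * (C * decay N p).
Proof.
move=> sF N; have [C C0 hC] := schwartz_real_decay (schwartz_real_derive v sF) N.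
exists (C * (1 + `|v|) ^+ N); first by rewrite mulr_ge0// exprn_ge0// addr_ge0.
move=> p h h0 h1.
have dl (t : R) : is_derive t 1 (fun t : R => F (p + t *: v)) ('D_v F (p + t *: v)).
  by apply: is_derive_line; apply: diff_derivable; exact: schwartz_real_differentiable.
have [|c] := MVT h0 (fun t _ => dl t).
  apply: continuous_subspaceT => t.
  by have [/derivable1_diffP/differentiable_continuous] := dl t.
rewrite in_itv /= => /andP[c0 ch]; rewrite scale0r addr0 subr0 => ->.
rewrite normrM (gtr0_norm h0) mulrC ler_pM2l//.
apply: le_trans (hC _) _; rewrite -mulrA ler_wpM2l// decay_translate//.
by rewrite gtr0_norm// (le_trans (ltW ch)).
Qed.

Lemma continuous_differentiable F : (forall x, differentiable F x) -> continuous F.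
Proof. by move=> dF x; exact: differentiable_continuous. Qed.

Lemma schwartz_cmeasurable f : schwartz f -> cmeasurable f.
Proof.
move=> [/schwartz_real_differentiable f1 /schwartz_real_differentiable f2]; split.
- by apply: continuous_measurable_rV2; exact: continuous_differentiable.
- by apply: continuous_measurable_rV2; exact: continuous_differentiable.
Qed.

Lemma schwartz_decay f : schwartz f -> forall N,
  exists2 C, 0 <= C & forall p : V, norm1 (f p) <= C * decay N p.
Proof.
move=> [s1 s2] N; have [C1 C10 h1] := schwartz_real_decay s1 N.
have [C2 C20 h2] := schwartz_real_decay s2 N.
exists (C1 + C2); first by rewrite addr_ge0.
by move=> p; rewrite mulrDl lerD.
Qed.

Lemma cintegrable_decay f C : cmeasurable f ->
  (forall p : V, norm1 (f p) <= C * decay (4 * n) p) -> cintegrable mu f.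
Proof.
move=> mf; apply: cintegrable_le => //.
exact/integrableZl_EFin/integrable_decay.
Qed.

Lemma schwartz_cintegrable f : schwartz f -> cintegrable mu f.
Proof.
move=> sf; have [C _ hC] := schwartz_decay sf (4 * n).
exact: cintegrable_decay (schwartz_cmeasurable sf) hC.
Qed.

Definition cderive (v : V) f : V -> R[i] := fun p =>
  'D_v (fun x => complex.Re (f x)) p +i* 'D_v (fun x => complex.Im (f x)) p.

Lemma schwartz_cderive v f : schwartz f -> schwartz (cderive v f).
Proof. by move=> [f1 f2]; split; exact: schwartz_real_derive. Qed.

Lemma measurable_dot2r (xi : V) : measurable_fun [set: V] (fun p => dot2 p xi).
Proof.
apply: (measurableT_comp (@measurable_dot2 R n) (g := fun p : V => (p, xi))).
exact: measurable_pair2.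
Qed.

Lemma measurable_dot2l (xi : V) : measurable_fun [set: V] (fun p => dot2 xi p).
Proof.
apply: (measurableT_comp (@measurable_dot2 R n) (g := fun p : V => (xi, p))).
exact: measurable_pair1.
Qed.

Lemma cmeasurable_phase (a : R) (xi : V) : cmeasurable (fun p => cis (a * dot2 p xi)).
Proof.
apply: cmeasurable_cis; apply: (measurableT_comp (mulrl_measurable _)).
exact: measurable_dot2r.
Qed.

Lemma cintegrable_phase (h : V -> R) f : measurable_fun [set: V] h ->
  cintegrable mu f -> cintegrable mu (fun p => cis (h p) * f p).
Proof.
move=> mh jf; apply: (cintegrable_le (B := fun p => 2 * norm1 (f p))).
- by apply: cmeasurableM; [exact: cmeasurable_cis|exact: cintegrable_cmeasurable jf].
- exact/integrableZl_EFin/cintegrable_norm1.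
- move=> p; apply: le_trans (norm1M _ _) _.
  by rewrite ler_wpM2r ?norm1_ge0// norm1_cis.
Qed.

Lemma dotC m (x y : 'rV[R]_m) : dot x y = dot y x.
Proof. by apply: eq_bigr => i _; rewrite mulrC. Qed.

Lemma dot2C (p q : V) : dot2 p q = dot2 q p.
Proof. by rewrite /dot2 dotC [X in _ + X]dotC. Qed.

Lemma dotDl m (x y z : 'rV[R]_m) : dot (x + y) z = dot x z + dot y z.
Proof. by rewrite -big_split; apply: eq_bigr => i _ /=; rewrite mxE mulrDl. Qed.

Lemma dotZl m (a : R) (x y : 'rV[R]_m) : dot (a *: x) y = a * dot x y.
Proof. by rewrite mulr_sumr; apply: eq_bigr => i _; rewrite mxE mulrA. Qed.

Lemma dot2Dl (p q r : V) : dot2 (p + q) r = dot2 p r + dot2 q r.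
Proof. by rewrite /dot2 /= !dotDl addrACA. Qed.

Lemma dot2Zl (a : R) (p q : V) : dot2 (a *: p) q = a * dot2 p q.
Proof. by rewrite /dot2 /= !dotZl mulrDr. Qed.

Lemma dot2Bl (p q r : V) : dot2 (p - q) r = dot2 p r - dot2 q r.
Proof. by rewrite dot2Dl -scaleN1r dot2Zl mulN1r. Qed.

Let iR (a : R) : R[i] := 0 +i* a.

Let norm1_iR a z : norm1 (iR a * z) = `|a| * norm1 z.
Proof.
rewrite /norm1 complexReM complexImM /= !mul0r sub0r add0r normrN !normrM.
by rewrite addrC mulrDr.
Qed.

(** The phase turns translations of f into multiplications; passing to the limit
    in the difference quotients gives the transform of a derivative without
    integration by parts. *)
Lemma fourier2_cderive f v xi : schwartz f ->
  fourier2 (cderive v f) xi = iR (2 * pi * dot2 v xi) * fourier2 f xi.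
Proof.
move=> sf; have [s1 s2] := sf; have mf := schwartz_cmeasurable sf.
have jf := schwartz_cintegrable sf.
pose e (p : V) : R[i] := cis (- (2 * pi * dot2 p xi)).
have me : cmeasurable e.
  rewrite /e; under eq_fun do rewrite -mulNr; exact: cmeasurable_phase.
pose h (k : nat) : R := k.+1%:R^-1.
have h0 k : 0 < h k by rewrite invr_gt0 ltr0n.
have h1 k : h k <= 1 by rewrite invf_le1 ?ltr0n// ler1n.
pose dq k (p : V) : R[i] := (k.+1%:R)%:C * (f (p + h k *: v) - f p).
have mft k : cmeasurable (fun p : V => f (p + h k *: v)).
  have [mT _ _ _] := substitution_scale (h k *: v) (oner_neq0 R).
  by have := cmeasurable_comp mf mT; under eq_fun do rewrite scale1r.
have mdq k : cmeasurable (dq k).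
  apply: cmeasurableM; first exact: cmeasurable_cst.
  by case: mf (mft k) => [a1 a2] [b1 b2]; split; rewrite /=;
    [under eq_fun do rewrite raddfB|under eq_fun do rewrite raddfB]; exact: measurable_funB.
have [C1 C10 hC1] := schwartz_real_increment v s1 (4 * n).
have [C2 C20 hC2] := schwartz_real_increment v s2 (4 * n).
have hdq k p : norm1 (dq k p) <= (C1 + C2) * decay (4 * n) p.
  rewrite /dq norm1RM ger0_norm// mulrC -ler_pdivlMr ?ltr0n// mulrC mulrDl mulrDr.
  by rewrite /norm1 !raddfB lerD//; [exact: hC1|exact: hC2].
have lim1 : ccvg (fun k => cintegral mu (fun p : V => e p * dq k p))
    (fourier2 (cderive v f) xi).
  apply: (@cdominated_convergence _ _ _ _ _ _
    (fun p : V => 2 * ((C1 + C2) * decay (4 * n) p))).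
  - by move=> k; exact: cmeasurableM.
  - by apply: cmeasurableM => //; exact/schwartz_cmeasurable/schwartz_cderive.
  - move=> p; apply: ccvgM; first exact: ccvg_cst.
    split; rewrite /dq.
    + under eq_fun do rewrite complexReM /= mul0r subr0 raddfB.
      apply: cvg_difference_quotient; apply: diff_derivable.
      exact: schwartz_real_differentiable.
    + under eq_fun do rewrite complexImM /= mul0r addr0 raddfB.
      apply: cvg_difference_quotient; apply: diff_derivable.
      exact: schwartz_real_differentiable.
  - exact/integrableZl_EFin/integrableZl_EFin/integrable_decay.
  - move=> k p; apply: le_trans (norm1M _ _) _.
    by rewrite ler_pM ?norm1_ge0 ?norm1_cis.
have E k : cintegral mu (fun p : V => e p * dq k p) =
    (k.+1%:R)%:C * (cis (h k * (2 * pi * dot2 v xi)) - 1) * fourier2 f xi.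
  set a := 2 * pi * dot2 v xi.
  have jft : cintegrable mu (fun p : V => f (p + h k *: v)).
    have := substitution_cintegrable (substitution_scale (h k *: v) (oner_neq0 R)) mf.
    move=> [_ /(_ jf)].
    by under eq_fun do rewrite scale1r normr1 mulr1 expr1n mul1r.
  have mh : measurable_fun [set: V] (fun p : V => - (2 * pi * dot2 p xi)).
    by under eq_fun do rewrite -mulNr; apply: (measurableT_comp (mulrl_measurable _));
      exact: measurable_dot2r.
  have je := cintegrable_phase mh jf; have jet := cintegrable_phase mh jft.
  have E1 : cintegral mu (fun p : V => e p * f (p + h k *: v)) = cis (h k * a) * fourier2 f xi.
    rewrite -cintegralZ//.
    have mphi : cmeasurable (fun p : V => cis (h k * a) * (e p * f p)).
      by apply: cmeasurableM; [exact: cmeasurable_cst|exact: cmeasurableM].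
    rewrite -(substitution_cintegral (substitution_scale (h k *: v) (oner_neq0 R)) mphi).
    apply: eq_cintegral => p; rewrite scale1r normr1 mulr1 expr1n mul1r mulrA -cisD.
    congr (cis _ * _); rewrite dot2Dl dot2Zl /a; ring.
  transitivity ((k.+1%:R)%:C * (cintegral mu (fun p : V => e p * f (p + h k *: v)) +
      (-1) * cintegral mu (fun p : V => e p * f p))).
    rewrite -cintegralZ// -cintegralD//; last exact: cintegrableZ.
    rewrite -cintegralZ//; last first.
      have [x1 x2] := jet; have [y1 y2] := cintegrableZ (-1) je.
      split.
      - by under eq_fun do rewrite complexReD EFinD; exact: integrableD.
      - by under eq_fun do rewrite complexImD EFinD; exact: integrableD.
    apply: eq_cintegral => p; rewrite /dq; ring.
  rewrite E1 (_ : cintegral mu (fun p : V => e p * f p) = fourier2 f xi)//; ring.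
apply: ccvg_unique lim1 _; rewrite (funext E); apply: ccvgM; last exact: ccvg_cst.
set a := 2 * pi * dot2 v xi.
have lim (g : R -> R) (d : R) : is_derive (0 : R) 1 g d ->
    k.+1%:R * (g (h k) - g 0) @[k --> \oo] --> d.
  move=> [dg <-]; have := cvg_difference_quotient dg.
  by under eq_fun do rewrite add0r -[_ *: 1]/(_ * 1) mulr1.
have dc : is_derive (0 : R) 1 (fun t : R => cos (t * a)) 0.
  apply: is_derive_eq; rewrite mul0r sin0 oppr0 /GRing.scale /=; ring.
have ds : is_derive (0 : R) 1 (fun t : R => sin (t * a)) a.
  apply: is_derive_eq; rewrite mul0r cos0 /GRing.scale /=; ring.
split.
- under eq_fun do rewrite complexReM /= mul0r subr0.
  by have := lim _ _ dc; rewrite mul0r cos0.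
- under eq_fun do rewrite complexImM /= mul0r addr0 subr0.
  by have := lim _ _ ds; rewrite mul0r sin0; under eq_fun do rewrite subr0.
Qed.

Lemma fourier2_bounded f : cintegrable mu f ->
  exists C, forall xi : V, norm1 (fourier2 f xi) <= C.
Proof.
move=> jf; have i1 := cintegrable_norm1 jf.
exists (\int[mu]_p (2 * norm1 (f p))) => xi.
have mh : measurable_fun [set: V] (fun p => - (2 * pi * dot2 p xi)).
  by under eq_fun do rewrite -mulNr; apply: (measurableT_comp (mulrl_measurable _));
    exact: measurable_dot2r.
have je := cintegrable_phase mh jf.
have i2 := integrableZl_EFin 2 i1.
rewrite -lee_fin /Rintegral fineK; last exact: integrable_fin_num.
apply: le_trans (norm1_cintegral je) _; apply: le_integral => //.
- exact: cintegrable_norm1.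
- move=> p _; rewrite lee_fin; apply: le_trans (norm1M _ _) _.
  by rewrite ler_wpM2r ?norm1_ge0// norm1_cis.
Qed.

Lemma fourier2_dot_decay f v : schwartz f -> forall k,
  exists2 C, 0 <= C & forall xi : V, `|dot2 v xi| ^+ k * norm1 (fourier2 f xi) <= C.
Proof.
move=> sf k; elim: k f sf => [|k ih] f sf.
  have [C hC] := fourier2_bounded (schwartz_cintegrable sf); exists C.
    by apply: le_trans (hC 0); exact: norm1_ge0.
  by move=> xi; rewrite mul1r.
have [C C0 hC] := ih _ (schwartz_cderive v sf); exists C => // xi.
apply: le_trans (hC xi); rewrite fourier2_cderive// norm1_iR exprSr -mulrA.
rewrite ler_wpM2l ?exprn_ge0// ler_wpM2r ?norm1_ge0// normrM ler_peMl//.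
by have pi2 := @pi_ge2 R; rewrite ger0_norm; lra.
Qed.

(** Differentiating along the basis vectors bounds the powers of each coordinate,
    hence those of the maximum norm, which is attained at a coordinate. *)
Lemma fourier2_decay f : schwartz f -> forall k,
  exists2 C, 0 <= C & forall xi : V, norm1 (fourier2 f xi) <= C * decay k xi.
Proof.
move=> sf k.
pose u (b : bool) (i : 'I_n) : V := if b then (delta_mx ord0 i, 0) else (0, delta_mx ord0 i).
have dotd m (i : 'I_m) (x : 'rV[R]_m) : dot (delta_mx ord0 i) x = x ord0 i.
  rewrite /dot (bigD1 i)//= mxE !eqxx mul1r big1 ?addr0// => j ji.
  by rewrite mxE eqxx (negbTE ji) mul0r.
have dot0 m (x : 'rV[R]_m) : dot 0 x = 0.
  by rewrite /dot big1// => j _; rewrite mxE mul0r.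
have dotu b i xi : dot2 (u b i) xi = if b then xi.1 ord0 i else xi.2 ord0 i.
  by case: b; rewrite /dot2 /= dotd dot0 ?addr0 ?add0r.
have /choice[C hC] : forall bi : bool * 'I_n, exists C, 0 <= C /\
    forall xi, `|dot2 (u bi.1 bi.2) xi| ^+ k * norm1 (fourier2 f xi) <= C.
  by move=> [b i]; have [C C0 h] := fourier2_dot_decay (u b i) sf k; exists C.
have [C0 hC0] := fourier2_bounded (schwartz_cintegrable sf).
have C00 : 0 <= C0 by apply: le_trans (hC0 0); exact: norm1_ge0.
pose S := C0 + \sum_bi C bi.
have S0 : 0 <= \sum_bi C bi by apply: sumr_ge0 => bi _; case: (hC bi).
have CS bi : C bi <= \sum_bi C bi.
  by rewrite (bigD1 bi)//= lerDl; apply: sumr_ge0 => j _; case: (hC j).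
have hS xi : `|xi| ^+ k * norm1 (fourier2 f xi) <= S.
  have [xi0|xi0] := eqVneq `|xi| 0.
    rewrite xi0 expr0n; case: (k == 0%N); last by rewrite mul0r addr_ge0.
    by rewrite mul1r (le_trans (hC0 xi))// lerDl.
  have [i [->|->]] := norm_rV2_attained xi0.
  - have [_ /(_ xi)] := hC (true, i); rewrite dotu => h.
    by apply: le_trans h _; apply: le_trans (CS _) _; rewrite lerDr.
  - have [_ /(_ xi)] := hC (false, i); rewrite dotu => h.
    by apply: le_trans h _; apply: le_trans (CS _) _; rewrite lerDr.
exists (2 ^+ k * (C0 + S)); first by rewrite mulr_ge0 ?exprn_ge0// !addr_ge0.
move=> xi; rewrite /decay ler_pdivlMr ?exprn_gt0 ?ltr_pwDl//.
apply: (@le_trans _ _ (2 ^+ k * ((1 + `|xi| ^+ k) * norm1 (fourier2 f xi)))); last first.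
  by rewrite ler_wpM2l ?exprn_ge0// mulrDl mul1r lerD.
rewrite mulrC mulrA ler_wpM2r ?norm1_ge0//.
have [x1|x1] := leP `|xi| 1.
  apply: (@le_trans _ _ (2 ^+ k)); first by apply: lerXn2r; rewrite ?nnegrE ?addr_ge0//; lra.
  by rewrite ler_peMr ?exprn_ge0// lerDl exprn_ge0.
apply: (@le_trans _ _ (2 ^+ k * `|xi| ^+ k)).
  by rewrite -exprMn; apply: lerXn2r; rewrite ?nnegrE ?addr_ge0 ?mulr_ge0//; lra.
by rewrite ler_wpM2l ?exprn_ge0// lerDr.
Qed.

End schwartz_functions.

(** * Fourier inversion by Abel summation *)

Section Fourier_inversion.
Context {R : realType} {n : nat}.
Local Notation V := (rV2 R n).
Local Notation mu := (@lebesgue2 R n).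
Local Notation plane := (measurableTypeR R * measurableTypeR R)%type.

Definition sum_norm (xi : V) : R := \sum_i (`|xi.1 ord0 i| + `|xi.2 ord0 i|).

(** The Abel summation weight, and its Fourier transform, the Poisson kernel. *)
Definition abel (xi : V) : R := expR (- sum_norm xi).

Definition poisson1 (s : R) : R := 2 / (1 + (2 * pi * s) ^+ 2).

Definition poisson (w : V) : R :=
  \prod_i (poisson1 (w.1 ord0 i) * poisson1 (w.2 ord0 i)).

Let abelE xi : abel xi =
  \prod_i (expR (- `|(coord2 xi i).1 : R|) * expR (- `|(coord2 xi i).2 : R|)).
Proof.
rewrite /abel /sum_norm -sumrN expR_sum; apply: eq_bigr => i _.
by rewrite opprD expRD.
Qed.

Lemma sum_norm_ge0 xi : 0 <= sum_norm xi.
Proof. by apply: sumr_ge0 => i _; rewrite addr_ge0. Qed.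

Lemma sum_normZ (a : R) xi : sum_norm (a *: xi) = `|a| * sum_norm xi.
Proof.
by rewrite mulr_sumr; apply: eq_bigr => i _; rewrite !mxE !normrM mulrDr.
Qed.

Lemma abel_le1 xi : abel xi <= 1.
Proof. by rewrite -expR0 ler_expR oppr_le0 sum_norm_ge0. Qed.

Lemma integrable_abel : mu.-integrable setT (fun xi => (abel xi)%:E).
Proof.
under eq_fun do rewrite abelE.
exact: (integrable_prod (fun i => integrable_pairM (@integrable_expN R) (@integrable_expN R))).
Qed.

Lemma measurable_abel : measurable_fun [set: V] abel.
Proof. by have /measurable_int/measurable_EFinP := integrable_abel. Qed.

Lemma fourier_abel (w : V) :
  cintegral mu (fun xi => cis (2 * pi * dot2 w xi) * (abel xi)%:C) = (poisson w)%:C.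
Proof.
pose phi (i : 'I_n) (z : plane) : R[i] :=
  (cis (2 * pi * w.1 ord0 i * z.1) * (expR (- `|z.1 : R|))%:C) *
  (cis (2 * pi * w.2 ord0 i * z.2) * (expR (- `|z.2 : R|))%:C).
have iphi i : cintegrable (leb2 R) (phi i).
  have [j1 _] := cintegral_cis_expN (2 * pi * w.1 ord0 i).
  have [j2 _] := cintegral_cis_expN (2 * pi * w.2 ord0 i).
  exact: (cintegrable_pairM j1 j2).
have [_] := cintegral_prod iphi.
rewrite (_ : \prod_i _ = (poisson w)%:C); last first.
  rewrite /poisson rmorph_prod; apply: eq_bigr => i _.
  have [i1 e1] := cintegral_cis_expN (2 * pi * w.1 ord0 i).
  have [i2 e2] := cintegral_cis_expN (2 * pi * w.2 ord0 i).
  by rewrite (cintegral_pairM i1 i2) e1 e2 [RHS]rmorphM.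
move=> <-; apply: eq_cintegral => xi; rewrite abelE.
rewrite (_ : 2 * pi * dot2 w xi = \sum_i (2 * pi * w.1 ord0 i * xi.1 ord0 i +
  2 * pi * w.2 ord0 i * xi.2 ord0 i)); last first.
  rewrite /dot2 /dot -big_split mulr_sumr; apply: eq_bigr => i _ /=; ring.
rewrite cis_sum rmorph_prod -big_split; apply: eq_bigr => i _ /=.
by rewrite /phi /= cisD rmorphM mulrACA.
Qed.

Let integral_poisson1 : (leb R).-integrable setT (fun s => (poisson1 s)%:E) /\
  \int[leb R]_s poisson1 s = 1.
Proof.
have [iv ev] := @integrable_oneDsqrV R.
have pi0 := @pi_gt0 R.
have a0 : 2 * pi != 0 :> R by rewrite gt_eqF// mulr_gt0.
have hs := substitution_affine 0 a0.
have mv : measurable_fun [set: measurableTypeR R] (fun t : R => (1 + t ^+ 2)^-1).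
  by have /measurable_int/measurable_EFinP := iv.
have mc := cmeasurableR mv.
have E (s : R) : poisson1 s = pi^-1 * (`|2 * pi| * (1 + (2 * pi * s + 0) ^+ 2)^-1).
  rewrite /poisson1 addr0 gtr0_norm ?mulr_gt0//.
  by rewrite mulrA [pi^-1 * _]mulrCA mulVf ?mulr1// gt_eqF.
have i1 : (leb R).-integrable setT
    (fun s : R => (`|2 * pi| * (1 + (2 * pi * s + 0) ^+ 2)^-1)%:E).
  have [_ /(_ (cintegrableR iv))[+ _]] := substitution_cintegrable hs mc.
  by apply: eq_integrable => // s _; rewrite complexReM /= mul0r subr0.
split.
  by under eq_fun do rewrite E; exact: integrableZl_EFin.
under eq_Rintegral do rewrite E.
rewrite RintegralZl// (substitution_Rintegral hs mv) ev.
by rewrite mulVf// gt_eqF.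
Qed.

Lemma integrable_poisson : mu.-integrable setT (fun w => (poisson w)%:E).
Proof.
have [ip _] := integral_poisson1.
exact: (integrable_prod (fun i => integrable_pairM ip ip)).
Qed.

Lemma cintegral_poisson : cintegral mu (fun w => (poisson w)%:C) = 1.
Proof.
have [ip ep] := integral_poisson1.
have jp := cintegrableR ip.
have Ep : cintegral (leb R) (fun s : R => (poisson1 s)%:C) = 1.
  by apply: complex_eq; rewrite //= Rintegral_cst// mul0r.
have := cintegral_prod (fun i : 'I_n => cintegrable_pairM jp jp).
rewrite (cintegral_pairM jp jp) Ep mulr1 big1// => -[_ <-].
apply: eq_cintegral => w; rewrite rmorph_prod; apply: eq_bigr => i _.
by rewrite rmorphM.
Qed.

(** Abel summation: inserting the weight [abel (e xi)] in the inversion integral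
    turns it into the average of [F (p - e w)] against the Poisson kernel. *)
Lemma abel_summation (F : V -> R[i]) (e : R) p : 0 < e -> cintegrable mu F ->
  cintegral mu (fun xi => cis (2 * pi * dot2 p xi) * fourier2 F xi * (abel (e *: xi))%:C) =
  cintegral mu (fun w => F (p - e *: w) * (poisson w)%:C).
Proof.
move=> e0 jF; have e0' : e != 0 by rewrite gt_eqF.
have mF := cintegrable_cmeasurable jF.
have RM (a b : R) : (a * b)%:C = a%:C * b%:C by exact: rmorphM.
have nz : (`|e| * `|e|) ^+ n != 0 by rewrite expf_neq0// mulf_neq0// normr_eq0.
pose A (xi : V) := (abel (e *: xi))%:C.
have se := substitution_scale (0 : V) e0'.
have mA : cmeasurable A.
  have [mT _ _ _] := se; have := cmeasurable_comp (cmeasurableR measurable_abel) mT.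
  by under eq_fun do rewrite addr0.
have jA : cintegrable mu A.
  have := substitution_cintegrable se (cmeasurableR measurable_abel).
  move=> [_ /(_ (cintegrableR integrable_abel))].
  move=> /(cintegrableZ (((`|e| * `|e|) ^+ n)^-1)%:C).
  by under eq_fun do rewrite addr0 mulrA -RM mulVf// mul1r.
have mdot : measurable_fun [set: V * V] (fun z => 2 * pi * dot2 (p - z.1) z.2).
  have -> : (fun z : V * V => 2 * pi * dot2 (p - z.1) z.2) =
      (fun z => 2 * pi * (dot2 p z.2 - dot2 z.1 z.2)).
    by apply/funext => z; rewrite dot2Bl.
  apply: measurable_funM; first exact: measurable_cst.
  apply: measurable_funB; last exact: measurable_dot2.
  exact: (measurableT_comp (measurable_dot2l p) measurable_snd).
pose Phi (z : V * V) := cis (2 * pi * dot2 (p - z.1) z.2) * (F z.1 * A z.2).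
have jPhi : cintegrable (mu \x mu)%E Phi.
  apply: (cintegrable_le (B := fun z => 2 * norm1 (F z.1 * A z.2))).
  - apply: cmeasurableM; first exact: cmeasurable_cis.
    exact: (cmeasurable_pairM mF mA).
  - exact: (integrableZl_EFin 2 (cintegrable_norm1 (cintegrable_pairM jF jA))).
  - move=> z; apply: le_trans (norm1M _ _) _.
    by rewrite ler_wpM2r ?norm1_ge0// norm1_cis.
have [_ E1] := cfubini1 jPhi; have [_ E2] := cfubini2 jPhi.
transitivity (cintegral (mu \x mu)%E Phi).
  rewrite E2; apply: eq_cintegral => xi; rewrite /Phi /=.
  have jc := @cintegrable_phase R n (fun q => - (2 * pi * dot2 q xi)) F.
  rewrite mulrAC -[RHS]/(cintegral _ _) /fourier2 /fourier -cintegralZ//; last first.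
    apply: jc => //; under eq_fun do rewrite -mulNr.
    exact: (measurableT_comp (mulrl_measurable _) (measurable_dot2r xi)).
  apply: eq_cintegral => q; rewrite dot2Bl mulrBr cisD.
  rewrite /A; ring.
rewrite E1.
have -> : (fun q => cintegral mu (fun xi => Phi (q, xi))) =
    (fun q => F q * ((((`|e| * `|e|) ^+ n)^-1) * poisson (e^-1 *: (p - q)))%:C).
  apply/funext => q; rewrite /Phi /=.
  have jc : cintegrable mu (fun xi => cis (2 * pi * dot2 (p - q) xi) * A xi).
    apply: cintegrable_phase => //.
    exact: (measurableT_comp (mulrl_measurable _) (measurable_dot2l _)).
  under eq_cintegral do rewrite mulrCA.
  rewrite cintegralZ//; congr (_ * _).
  have mPsi : cmeasurable (fun xi => cis (2 * pi * dot2 (e^-1 *: (p - q)) xi) * (abel xi)%:C).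
    apply: cmeasurableM; last by apply: cmeasurableR; exact: measurable_abel.
    apply: cmeasurable_cis.
    exact: (measurableT_comp (mulrl_measurable _) (measurable_dot2l _)).
  rewrite RM -fourier_abel -(substitution_cintegral se mPsi) -cintegralZ; last first.
    apply/(substitution_cintegrable se mPsi); apply: cintegrable_phase.
      exact: (measurableT_comp (mulrl_measurable _) (measurable_dot2l _)).
    by apply: cintegrableR; exact: integrable_abel.
  apply: eq_cintegral => xi; rewrite addr0 mulrA -RM mulVf//.
  rewrite mul1r; congr (cis (_ * _) * _).
  by rewrite dot2Zl [X in _ = _ * X]dot2C dot2Zl mulKf// dot2C.
have Ne0 : - e != 0 by rewrite oppr_eq0.
have sN := substitution_scale p Ne0.
have mPsi : cmeasurable
    (fun q => F q * ((((`|e| * `|e|) ^+ n)^-1) * poisson (e^-1 *: (p - q)))%:C).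
  apply: cmeasurableM => //; apply: cmeasurableR; apply: measurable_funM => //.
  have mp : measurable_fun [set: V] poisson.
    by have /measurable_int/measurable_EFinP := integrable_poisson.
  have eN : - e^-1 != 0 by rewrite oppr_eq0 invr_neq0.
  have [mT _ _ _] := substitution_scale (e^-1 *: p) eN.
  have := measurableT_comp mp mT; congr (measurable_fun _ _); apply/funext => q /=.
  by congr poisson; rewrite scalerBr scaleNr addrC.
rewrite -(substitution_cintegral sN mPsi); apply: eq_cintegral => w.
rewrite (_ : - e *: w + p = p - e *: w); last by rewrite scaleNr addrC.
rewrite (_ : p - (p - e *: w) = e *: w); last by rewrite opprB addrCA subrr addr0.
by rewrite scalerA mulVf// scale1r normrN mulrCA -RM mulrA mulfV// mul1r.
Qed.

(** The weight tends to 1 on one side of [abel_summation] and F (p - e w) tends to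
    F p on the other, the Poisson kernel having integral 1. *)
Lemma fourier2_inversion (F : V -> R[i]) (M : R) : cintegrable mu F ->
  (forall p, norm1 (F p) <= M) ->
  continuous (fun p => complex.Re (F p)) -> continuous (fun p => complex.Im (F p)) ->
  cintegrable mu (fourier2 F) ->
  fourier2_inv (fourier2 F) = F.
Proof.
move=> jF FM c1 c2 jFh; apply/funext => p.
have mF := cintegrable_cmeasurable jF.
pose h (k : nat) : R := k.+1%:R^-1.
have h0 k : 0 < h k by rewrite invr_gt0 ltr0n.
have mph : measurable_fun [set: V] (fun xi : V => 2 * pi * dot2 p xi).
  exact: (measurableT_comp (mulrl_measurable _) (measurable_dot2l _)).
have jpF := cintegrable_phase mph jFh.
have mab k : measurable_fun [set: V] (fun xi : V => abel (h k *: xi)).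
  have [mT _ _ _] := substitution_scale (0 : V) (lt0r_neq0 (h0 k)).
  by have := measurableT_comp measurable_abel mT; under eq_fun do rewrite /= addr0.
have mFT k : cmeasurable (fun w : V => F (p - h k *: w)).
  have Nk : - h k != 0 by rewrite oppr_eq0 (lt0r_neq0 (h0 k)).
  have [mT _ _ _] := substitution_scale p Nk.
  by have := cmeasurable_comp mF mT; under eq_fun do rewrite scaleNr addrC.
have mpo : measurable_fun [set: V] poisson.
  by have /measurable_int/measurable_EFinP := integrable_poisson.
have po0 w : 0 <= poisson w.
  apply: prodr_ge0 => i _; rewrite mulr_ge0// /poisson1 divr_ge0// addr_ge0// sqr_ge0//.
have lim1 : ccvg (fun k => cintegral mu (fun xi : V =>
      cis (2 * pi * dot2 p xi) * fourier2 F xi * (abel (h k *: xi))%:C))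
    (fourier2_inv (fourier2 F) p).
  apply: (@cdominated_convergence _ _ _ _ _ _ (fun xi : V =>
    norm1 (cis (2 * pi * dot2 p xi) * fourier2 F xi))).
  - move=> k; apply: cmeasurableM; first exact: cintegrable_cmeasurable jpF.
    by apply: cmeasurableR; exact: mab.
  - exact: cintegrable_cmeasurable jpF.
  - move=> xi; rewrite -[X in ccvg _ X]mulr1; apply: ccvgM; first exact: ccvg_cst.
    apply: (@ccvgR R _ 1); rewrite /abel; under eq_fun do rewrite sum_normZ gtr0_norm//.
    suff : expR (- (h k * sum_norm xi)) @[k --> \oo] --> expR (- (0 * sum_norm xi)).
      by rewrite mul0r oppr0 expR0.
    apply: continuous_cvg; first exact: continuous_expR.
    by apply: cvgN; apply: cvgM; [exact: cvg_invS|exact: cvg_cst].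
  - exact: cintegrable_norm1.
  - move=> k xi; rewrite mulrC norm1RM ler_piMl ?norm1_ge0// ger0_norm ?abel_le1//.
    exact: expR_ge0.
have lim2 : ccvg (fun k => cintegral mu (fun w : V => F (p - h k *: w) * (poisson w)%:C))
    (cintegral mu (fun w : V => F p * (poisson w)%:C)).
  apply: (@cdominated_convergence _ _ _ _ _ _ (fun w : V => M * poisson w)).
  - by move=> k; apply: cmeasurableM => //; exact: cmeasurableR.
  - by apply: cmeasurableM; [exact: cmeasurable_cst|exact: cmeasurableR].
  - move=> w; apply: ccvgM; last exact: ccvg_cst.
    have cw : p - h k *: w @[k --> \oo] --> p.
      suff : p - h k *: w @[k --> \oo] --> p - 0 *: w by rewrite scale0r subr0.
      apply: cvgB; first exact: cvg_cst.
      by apply: cvgZr_tmp; exact: cvg_invS.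
    split.
    + exact: (continuous_cvg _ (c1 p) cw).
    + exact: (continuous_cvg _ (c2 p) cw).
  - exact/integrableZl_EFin/integrable_poisson.
  - by move=> k w; rewrite mulrC norm1RM ger0_norm// mulrC ler_wpM2r.
rewrite (_ : (fun k => _) = (fun k => cintegral mu (fun xi : V =>
    cis (2 * pi * dot2 p xi) * fourier2 F xi * (abel (h k *: xi))%:C))) in lim2; last first.
  by apply/funext => k; rewrite abel_summation.
rewrite (ccvg_unique lim1 lim2) cintegralZ ?cintegral_poisson ?mulr1//.
by apply: cintegrableR; exact: integrable_poisson.
Qed.

End Fourier_inversion.

(** * Integrable functions are determined by orthants *)

Section density.
Local Open Scope ereal_scope.
Context d (T : measurableType d) (R : realType) (mu : {measure set T -> \bar R}).

Section density_measure.
Variables (f : T -> \bar R) (mf : measurable_fun [set: T] f) (f0 : forall x, 0 <= f x).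

Definition density (_ : measurable_fun [set: T] f) (_ : forall x, 0 <= f x) (A : set T) :=
  \int[mu]_(x in A) f x.

Let density0 : density mf f0 set0 = 0.
Proof. exact: integral_set0. Qed.

Let density_ge0 A : 0 <= density mf f0 A.
Proof. exact: integral_ge0. Qed.

Let density_sigma_additive : semi_sigma_additive (density mf f0).
Proof. exact: semi_sigma_additive_nng_induced. Qed.

HB.instance Definition _ := isMeasure.Build _ _ _ (density mf f0)
  density0 density_ge0 density_sigma_additive.

End density_measure.

(** The positive and negative parts of [w] are densities of finite measures that
    agree on a generating pi-system, hence everywhere. *)
Lemma integrable_ae_eq0 (G : set (set T)) (g : nat -> set T) (w : T -> \bar R) :
  measurable = <<s G >> -> setI_closed G -> (forall i, G (g i)) ->
  \bigcup_i g i = [set: T] -> mu.-integrable [set: T] w ->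
  (forall A, G A -> \int[mu]_(x in A) w x = 0) ->
  ae_eq mu [set: T] w (cst 0).
Proof.
move=> GE GI Gg gT iw w0.
have mG A : G A -> measurable A by move=> GA; rewrite GE; exact: sub_sigma_algebra.
have mw := measurable_int _ iw.
have mp : measurable_fun setT w^\+ by exact: measurable_funepos.
have mn : measurable_fun setT w^\- by exact: measurable_funeneg.
have ip := integrable_funepos measurableT iw.
have i_n := integrable_funeneg measurableT iw.
have fin (v : T -> \bar R) A : mu.-integrable setT v -> measurable A ->
    \int[mu]_(x in A) v x \is a fin_num.
  by move=> iv mA; apply: integrable_fin_num => //; exact: integrableS iv.
have E A : measurable A -> \int[mu]_(x in A) w^\+ x = \int[mu]_(x in A) w^\- x.
  move=> mA; suff : density mp (funepos_ge0 w) A = density mn (funeneg_ge0 w) A by [].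
  apply: (measure_unique G g GE GI Gg gT) => //.
  - move=> B GB; have mB := mG _ GB; rewrite /= /density.
    have := w0 B GB; rewrite integralE => /(congr1 (fun x => x + \int[mu]_(x in B) w^\- x)).
    by rewrite subeK ?fin// add0e.
  - by move=> k; rewrite /= /density ltey_eq fin//; exact: mG.
apply: integral_ae_eq => // A _ mA.
by rewrite integral0 integralE E// subee// fin.
Qed.

End density.

Section orthants.
Context {R : realType} {n : nat}.
Local Notation V := (rV2 R n).

Definition orthant (b : V) : set V :=
  [set p : V | forall i, p.1 ord0 i < b.1 ord0 i /\ p.2 ord0 i < b.2 ord0 i].

Let ltr_measurable (g : V -> R) c : measurable_fun setT g -> measurable [set p | g p < c].
Proof.
move=> mg; rewrite (_ : [set _ | _] = g @^-1` `]-oo, c[); last first.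
  by apply/seteqP; split => p /=; rewrite in_itv.
by rewrite -[X in measurable X]setTI; apply: mg => //; exact: measurable_itv.
Qed.

Lemma measurable_orthant b : measurable (orthant b).
Proof.
rewrite (_ : orthant b = \bigcap_(i in [set: 'I_n])
    ([set p : V | p.1 ord0 i < b.1 ord0 i] `&` [set p : V | p.2 ord0 i < b.2 ord0 i]));
  last by apply/seteqP; split => p /= h i; [move=> _; exact: h|exact: (h i I)].
apply: fin_bigcap_measurable; first exact: finite_finset.
move=> i _; apply: measurableI; apply: ltr_measurable.
- exact: measurable_coord2_fst.
- exact: measurable_coord2_snd.
Qed.

Lemma setI_closed_orthant : setI_closed (range orthant).
Proof.
move=> _ _ [b _ <-] [c _ <-].
exists (\row_i Num.min (b.1 ord0 i) (c.1 ord0 i), \row_i Num.min (b.2 ord0 i) (c.2 ord0 i)) => //.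
apply/seteqP; split => p /=.
  by move=> h; split => i; have := h i; rewrite !mxE !lt_min => -[/andP[? ?] /andP[? ?]].
by move=> [h1 h2] i; have [? ?] := h1 i; have [? ?] := h2 i; rewrite !mxE !lt_min;
  split; apply/andP.
Qed.

Lemma bigcup_orthant : \bigcup_k orthant (const_mx k%:R, const_mx k%:R) = [set: V].
Proof.
apply/seteqP; split => // p _; exists (Num.bound `|p|) => // i.
have h := archi_boundP (normr_ge0 p); rewrite !mxE; split.
- by apply: le_lt_trans h; exact: le_trans (ler_norm _) (norm_fst_coord p i).
- by apply: le_lt_trans h; exact: le_trans (ler_norm _) (norm_snd_coord p i).
Qed.

Lemma measurable_orthantE : @measurable _ V = <<s range orthant >>.
Proof.
apply/seteqP; split; last first.
  apply: smallest_sub; first exact: sigma_algebra_measurable.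
  by move=> _ [b _ <-]; exact: measurable_orthant.
pose T' := g_sigma_algebraType (range orthant).
have half (g : V -> R) (B : R -> R -> V) :
    (forall c, [set p | g p < c] = \bigcup_k orthant (B c k%:R)) ->
    measurable_fun [set: T'] (g : T' -> R).
  move=> gB; apply: (measurability _ (RGenInftyO.measurableE R)).
  move=> _ [_ [c ->] <-]; rewrite setTI.
  have -> : g @^-1` `]-oo, c[ = [set p | g p < c].
    by apply/seteqP; split => p /=; rewrite in_itv.
  rewrite gB; apply: (@bigcupT_measurable _ T') => k; apply: sub_sigma_algebra.
  by exists (B c k%:R).
have lt_bound (p : V) i (k := Num.bound `|p|) : p.1 ord0 i < k%:R /\ p.2 ord0 i < k%:R.
  have h := archi_boundP (normr_ge0 p); split.
  - by apply: le_lt_trans h; exact: le_trans (ler_norm _) (norm_fst_coord p i).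
  - by apply: le_lt_trans h; exact: le_trans (ler_norm _) (norm_snd_coord p i).
(* it is enough that the coordinates are measurable for the generated structure *)
have mid : measurable_fun [set: T'] (fun p : T' => p : V).
  apply/measurable_fun_pairP; split => /=; apply: measurable_fun_rV => i.
  - apply: (half (fun p => p.1 ord0 i)
      (fun c k => (\row_j if j == i then c else k, const_mx k))) => c.
    apply/seteqP; split => p /=.
      move=> pc; exists (Num.bound `|p|) => // j; rewrite !mxE.
      by have [h1 h2] := lt_bound p j; split => //; case: eqP => // ->.
    by move=> [k _ /(_ i)]; rewrite !mxE eqxx => -[].
  - apply: (half (fun p => p.2 ord0 i)
      (fun c k => (const_mx k, \row_j if j == i then c else k))) => c.
    apply/seteqP; split => p /=.
      move=> pc; exists (Num.bound `|p|) => // j; rewrite !mxE.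
      by have [h1 h2] := lt_bound p j; split => //; case: eqP => // ->.
    by move=> [k _ /(_ i)]; rewrite !mxE eqxx => -[].
by move=> A mA; have := mid measurableT A mA; rewrite setTI.
Qed.

End orthants.

(** * Schwartz test functions *)

Section sigmoid.
Context {R : realType}.

Definition sigmoid (t : R) : R := (1 + expR (- t))^-1.

Let den_gt0 t : 0 < 1 + expR (- t) :> R.
Proof. by rewrite addr_gt0// expR_gt0. Qed.

Lemma sigmoid_ge0 t : 0 <= sigmoid t.
Proof. by rewrite invr_ge0 ltW. Qed.

Lemma sigmoid_le1 t : sigmoid t <= 1.
Proof. by rewrite invf_le1// lerDl expR_ge0. Qed.

Lemma is_derive_sigmoid (t : R) :
  is_derive t 1 sigmoid (sigmoid t * (1 - sigmoid t)).
Proof.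
have d1 : is_derive t 1 (fun t : R => 1 + expR (- t)) (- expR (- t)).
  by apply: is_derive_eq; ring.
have d2 := @is_deriveV R (fun t : R => 1 + expR (- t)) t _ 1 (lt0r_neq0 (den_gt0 t)) d1.
apply: (is_derive_eq d2); rewrite /sigmoid /GRing.scale /=.
have := lt0r_neq0 (den_gt0 t); move: (expR (- t)) => x x0.
by field.
Qed.

(** Sharp sigmoids shifted so as to converge everywhere, 0 included, to the
    indicator of the positive half-line. *)
Lemma cvg_sigmoid (a : R) :
  sigmoid (k%:R * (k%:R * a - 1)) @[k --> \oo] --> ((0 < a)%R%:R : R).
Proof.
have e0 : expR (- k%:R) @[k --> \oo] --> (0 : R) by exact: cvgn_expR.
have up u : sigmoid u <= expR u.
  by rewrite -[leRHS]invrK -expRN lef_pV2 ?posrE ?expR_gt0// lerDr.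
have low u : 1 - sigmoid u <= expR (- u).
  have h : sigmoid u * (1 + expR (- u)) = 1 by rewrite mulVf// lt0r_neq0.
  by have := sigmoid_le1 u; have := expR_ge0 (- u); nra.
apply/subr_cvg0; apply/norm_cvg0P; apply: (squeeze_cvgr _ (cvg_cst _) e0).
have [a0|a0] := ltP 0 a.
  have [K _ KP] : \forall k \near \oo, (2 / a <= k%:R :> R)%R.
    by exists (Num.bound (2 / a)) => // k /= h; apply: ltW;
      rewrite (lt_le_trans (archi_boundP _))// ?divr_ge0 ?(ltW a0)// ler_nat.
  exists K => // k /= Kk; rewrite normr_ge0 /= distrC ger0_norm ?subr_ge0 ?sigmoid_le1//.
  apply: le_trans (low _) _; rewrite ler_expR lerN2 ler_peMr//.
  by have := KP k Kk; rewrite ler_pdivrMr//; lra.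
apply: nearW => k; rewrite normr_ge0 /= subr0 ger0_norm ?sigmoid_ge0//.
apply: le_trans (up _) _; rewrite ler_expR -[leRHS]mulrN1 ler_wpM2l//.
have h : k%:R * a <= 0 by rewrite mulr_ge0_le0.
by lra.
Qed.

End sigmoid.

Section test_functions.
Context {R : realType} {n : nat}.
Local Notation V := (rV2 R n).
Local Notation mu := (@lebesgue2 R n).
Implicit Types f g : V -> R.

(** A class of functions of polynomial growth that is stable under
    differentiation. *)
Inductive moderate : (V -> R) -> Prop :=
| moderate_cst c : moderate (fun=> c)
| moderate_fst i : moderate (fun p => p.1 ord0 i)
| moderate_snd i : moderate (fun p => p.2 ord0 i)
| moderate_add f g : moderate f -> moderate g -> moderate (fun p => f p + g p)
| moderate_mul f g : moderate f -> moderate g -> moderate (fun p => f p * g p)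
| moderate_sigmoid f : moderate f -> moderate (fun p => sigmoid (f p)).

Lemma moderate_sum m (F : 'I_m -> V -> R) :
  (forall i, moderate (F i)) -> moderate (fun p => \sum_i F i p).
Proof.
elim: m F => [F _|m ih F mF].
  by under eq_fun do rewrite big_ord0; exact: moderate_cst.
by under eq_fun do rewrite big_ord_recl; apply: moderate_add => //; exact: ih.
Qed.

Lemma moderate_prod m (F : 'I_m -> V -> R) :
  (forall i, moderate (F i)) -> moderate (fun p => \prod_i F i p).
Proof.
elim: m F => [F _|m ih F mF].
  by under eq_fun do rewrite big_ord0; exact: moderate_cst.
by under eq_fun do rewrite big_ord_recl; apply: moderate_mul => //; exact: ih.
Qed.

Lemma differentiable_chain (h : R -> R) f p d v : differentiable f p ->
  is_derive (f p) 1 h d ->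
  differentiable (fun q => h (f q)) p /\ 'D_v (fun q => h (f q)) p = d * 'D_v f p.
Proof.
move=> df [dh hd]; have dh' : differentiable h (f p) by apply/derivable1_diffP.
have dc : differentiable (h \o f) p by exact: differentiable_comp.
split => //; rewrite -[LHS]/('D_v (h \o f) p) deriveE// diff_comp//= diff1E//.
by rewrite derive1E hd deriveE// /GRing.scale /= mulrC.
Qed.

Lemma moderate_differentiable f : moderate f -> forall p, differentiable f p.
Proof.
move=> mf p; elim: mf => [c|i|i|g h _ dg _ dh|g h _ dg _ dh|g _ dg].
- exact: differentiable_cst.
- apply: (@differentiable_comp _ _ _ _ fst (fun x : 'rV[R]_n => x ord0 i)).
    by apply: linear_differentiable => x; exact: cvg_fst.
  exact: differentiable_coord.
- apply: (@differentiable_comp _ _ _ _ snd (fun x : 'rV[R]_n => x ord0 i)).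
    by apply: linear_differentiable => x; exact: cvg_snd.
  exact: differentiable_coord.
- exact: differentiableD.
- exact: differentiableM.
- by have [] := differentiable_chain 0 dg (is_derive_sigmoid (g p)).
Qed.

Lemma moderate_derive f v : moderate f -> moderate (fun p => 'D_v f p).
Proof.
move=> mf; elim: mf => [c|i|i|g h mg dg mh dh|g h mg dg mh dh|g mg dg].
- by under eq_fun do rewrite derive_cst; exact: moderate_cst.
- rewrite (_ : (fun p => _) = fun=> v.1 ord0 i); first exact: moderate_cst.
  apply/funext => p; rewrite /derive.
  apply: cvg_lim => //; apply: cvg_near_cst; near=> h.
  have h0 : h != 0 by near: h; exact: nbhs_dnbhs_neq.
  by rewrite /= /shift /= !mxE addrK /GRing.scale /= mulKf.
- rewrite (_ : (fun p => _) = fun=> v.2 ord0 i); first exact: moderate_cst.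
  apply/funext => p; rewrite /derive.
  apply: cvg_lim => //; apply: cvg_near_cst; near=> h.
  have h0 : h != 0 by near: h; exact: nbhs_dnbhs_neq.
  by rewrite /= /shift /= !mxE addrK /GRing.scale /= mulKf.
- rewrite (_ : (fun p => _) = fun p => 'D_v g p + 'D_v h p); first exact: moderate_add.
  apply/funext => p; rewrite -[LHS]/('D_v (g + h) p).
  by rewrite deriveD//; apply: diff_derivable; exact: moderate_differentiable.
- rewrite (_ : (fun p => _) = fun p => g p * 'D_v h p + h p * 'D_v g p).
    by apply: moderate_add; exact: moderate_mul.
  apply/funext => p; rewrite -[LHS]/('D_v (g * h) p).
  by rewrite deriveM//; apply: diff_derivable; exact: moderate_differentiable.
- rewrite (_ : (fun p => _) = fun p =>
      sigmoid (g p) * (1 + (-1) * sigmoid (g p)) * 'D_v g p).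
    apply: moderate_mul => //; apply: moderate_mul; first exact: moderate_sigmoid.
    apply: moderate_add; first exact: moderate_cst.
    by apply: moderate_mul; [exact: moderate_cst|exact: moderate_sigmoid].
  apply/funext => p; rewrite mulN1r.
  by have [_] := differentiable_chain v (moderate_differentiable mg p)
    (is_derive_sigmoid (g p)).
Unshelve. all: by end_near. Qed.

Lemma moderate_growth f : moderate f ->
  exists C N, 0 <= C /\ forall p, `|f p| <= C * (1 + `|p|) ^+ N.
Proof.
have p1 (p : V) : 1 <= 1 + `|p| by rewrite lerDl.
move=> mf; elim: mf => [c|i|i|g h _ [C [N [C0 hC]]] _ [D [M [D0 hD]]]
    |g h _ [C [N [C0 hC]]] _ [D [M [D0 hD]]]|g _ _].
- by exists `|c|, 0%N; split => // p; rewrite mulr1.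
- exists 1, 1%N; split => // p; rewrite mul1r; apply: le_trans (norm_fst_coord p i) _.
  by rewrite lerDr.
- exists 1, 1%N; split => // p; rewrite mul1r; apply: le_trans (norm_snd_coord p i) _.
  by rewrite lerDr.
- exists (C + D), (N + M)%N; split; first exact: addr_ge0.
  move=> p; apply: le_trans (ler_normD _ _) _; rewrite mulrDl; apply: lerD.
  + apply: le_trans (hC p) _; rewrite ler_wpM2l// ler_weXn2l//; exact: leq_addr.
  + apply: le_trans (hD p) _; rewrite ler_wpM2l// ler_weXn2l//; exact: leq_addl.
- exists (C * D), (N + M)%N; split; first exact: mulr_ge0.
  by move=> p; rewrite normrM exprD mulrACA ler_pM.
- exists 1, 0%N; split => // p; rewrite mul1r ger0_norm ?sigmoid_ge0//.
  exact: sigmoid_le1.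
Qed.

Definition sqnorm (p : V) : R :=
  \sum_i (p.1 ord0 i * p.1 ord0 i + p.2 ord0 i * p.2 ord0 i).

Definition gaussian (p : V) : R := expR (- sqnorm p).

Lemma moderate_sqnorm : moderate sqnorm.
Proof.
apply: moderate_sum => i; apply: moderate_add; apply: moderate_mul;
  (exact: moderate_fst || exact: moderate_snd).
Qed.

Lemma sqr_norm_le_sqnorm (p : V) : `|p| ^+ 2 <= sqnorm p.
Proof.
have s0 : 0 <= sqnorm p by apply: sumr_ge0 => i _; rewrite -!expr2 addr_ge0 ?sqr_ge0.
have [->|p0] := eqVneq `|p| 0; first by rewrite expr0n.
have le i : (p.1 ord0 i) ^+ 2 + (p.2 ord0 i) ^+ 2 <= sqnorm p.
  rewrite /sqnorm (bigD1 i)//= -!expr2 lerDl; apply: sumr_ge0 => j _.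
  by rewrite -!expr2 addr_ge0 ?sqr_ge0.
have [i [->|->]] := norm_rV2_attained p0; rewrite real_normK ?num_real//;
  apply: le_trans (le i).
- by rewrite lerDl sqr_ge0.
- by rewrite lerDr sqr_ge0.
Qed.

(** From 1 + t <= e^t and N t <= t^2 + N^2. *)
Lemma gaussian_decay (N : nat) : exists2 C, 0 <= C &
  forall p, (1 + `|p|) ^+ N * gaussian p <= C.
Proof.
exists (expR (N%:R ^+ 2)); first exact: expR_ge0.
move=> p; rewrite /gaussian expRN ler_pdivrMr ?expR_gt0// -expRD.
apply: (@le_trans _ _ (expR (N%:R * `|p|))).
  rewrite expRM_natl; apply: lerXn2r; rewrite ?nnegrE ?addr_ge0 ?expR_ge0//.
  exact: expR_ge1Dx.
rewrite ler_expR; have := sqr_norm_le_sqnorm p.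
have := sqr_ge0 (`|p| - N%:R); have := sqr_ge0 `|p|; have := sqr_ge0 (N%:R : R).
nra.
Qed.

Lemma moderate_gaussian_schwartz f : moderate f ->
  schwartz_real (fun p => f p * gaussian p).
Proof.
have dg p v : differentiable gaussian p /\ 'D_v gaussian p = - 'D_v sqnorm p * gaussian p.
  have dq := moderate_differentiable moderate_sqnorm p.
  have hd : is_derive (sqnorm p) 1 (fun t : R => expR (- t)) (- gaussian p).
    by apply: is_derive_eq; rewrite mulrN1.
  by have [? ->] := differentiable_chain v dq hd; split => //; rewrite mulNr mulNr mulrC.
have dfg g p : moderate g -> differentiable (fun p => g p * gaussian p) p.
  move=> mg; have [dgp _] := dg p 0.
  by apply: differentiableM => //; exact: moderate_differentiable.
move=> mf.
have it s : exists2 g, moderate g &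
    iter_derive s (fun p => f p * gaussian p) = fun p => g p * gaussian p.
  elim: s => [|v s [g mg E]]; first by exists f.
  exists (fun p => 'D_v g p + (-1) * (g p * 'D_v sqnorm p)).
    apply: moderate_add; first exact: moderate_derive.
    apply: moderate_mul; first exact: moderate_cst.
    by apply: moderate_mul => //; apply: moderate_derive; exact: moderate_sqnorm.
  rewrite /= E; apply/funext => p; rewrite -[LHS]/('D_v (g * gaussian) p).
  have [dgp Dgp] := dg p v; rewrite deriveM//; last 2 first.
  - by apply: diff_derivable; exact: moderate_differentiable.
  - exact: diff_derivable.
  by rewrite Dgp /GRing.scale /=; ring.
split=> [s p|s k]; have [g mg ->] := it s; first exact: dfg.
have [C [N [C0 hC]]] := moderate_growth mg.
have [D D0 hD] := gaussian_decay (k + N).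
exists (C * D) => p; rewrite normrM [`|gaussian p|]ger0_norm ?expR_ge0//.
apply: le_trans (_ : _ <= C * ((1 + `|p|) ^+ (k + N) * gaussian p)) _; last first.
  exact: ler_wpM2l.
have -> : C * ((1 + `|p|) ^+ (k + N) * gaussian p) =
    (1 + `|p|) ^+ k * (C * (1 + `|p|) ^+ N * gaussian p) by rewrite exprD; ring.
by rewrite ler_wpM2l ?exprn_ge0 ?addr_ge0// ler_wpM2r ?expR_ge0.
Qed.

Let test (b : V) (k : nat) (p : V) : R :=
  \prod_i (sigmoid (k%:R * (k%:R * (b.1 ord0 i - p.1 ord0 i) - 1)) *
           sigmoid (k%:R * (k%:R * (b.2 ord0 i - p.2 ord0 i) - 1))).

Let moderate_test b k : moderate (test b k).
Proof.
have key g c : moderate g -> moderate (fun p => sigmoid (k%:R * (k%:R * (c - g p) - 1))).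
  move=> mg; apply: moderate_sigmoid.
  rewrite (_ : (fun p => _) =
    fun p => k%:R * (k%:R * (c + (-1) * g p) + (-1))); last first.
    by apply/funext => p; rewrite mulN1r.
  apply: moderate_mul; first exact: moderate_cst.
  apply: moderate_add; last exact: moderate_cst.
  apply: moderate_mul; first exact: moderate_cst.
  apply: moderate_add; first exact: moderate_cst.
  by apply: moderate_mul => //; exact: moderate_cst.
apply: moderate_prod => i; apply: moderate_mul; apply: key.
- exact: moderate_fst.
- exact: moderate_snd.
Qed.

Let test_ge0 b k p : 0 <= test b k p.
Proof. by apply: prodr_ge0 => i _; rewrite mulr_ge0// sigmoid_ge0. Qed.

Let test_le1 b k p : test b k p <= 1.
Proof.
apply: prodr_ile1 => i _; rewrite mulr_ge0 ?sigmoid_ge0//=.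
by rewrite -[leRHS]mulr1 ler_pM ?sigmoid_ge0 ?sigmoid_le1.
Qed.

Let cvg_ord_prod m (u : 'I_m -> nat -> R) (l : 'I_m -> R) :
  (forall i, u i k @[k --> \oo] --> l i) -> \prod_i u i k @[k --> \oo] --> \prod_i l i.
Proof.
elim: m u l => [u l _|m ih u l ul].
  by under eq_fun do rewrite big_ord0; rewrite big_ord0; exact: cvg_cst.
under eq_fun do rewrite big_ord_recl; rewrite big_ord_recl.
by apply: cvgM => //; apply: ih.
Qed.

Let cvg_test b p : test b k p @[k --> \oo] --> (\1_(orthant b) p : R).
Proof.
rewrite (_ : \1_(orthant b) p = \prod_i
    ((0 < b.1 ord0 i - p.1 ord0 i)%R%:R * (0 < b.2 ord0 i - p.2 ord0 i)%R%:R)).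
  by apply: cvg_ord_prod => i; apply: cvgM; exact: cvg_sigmoid.
rewrite indicE; have [bp|bp] := boolP (p \in orthant b).
  rewrite big1// => i _; have [h1 h2] := set_mem bp i.
  by rewrite !subr_gt0 h1 h2 mulr1.
have [i nb] : exists i, ~ (p.1 ord0 i < b.1 ord0 i /\ p.2 ord0 i < b.2 ord0 i).
  by apply/existsNP => h; move/negP: bp; apply; rewrite inE.
rewrite (bigD1 i)//= !subr_gt0.
have [h1|h1] := ltP (p.1 ord0 i) (b.1 ord0 i); last by rewrite !mul0r.
have [h2|h2] := ltP (p.2 ord0 i) (b.2 ord0 i); last by rewrite mulr0 mul0r.
by case: nb.
Qed.

(** Gaussians multiplied by sharper and sharper sigmoids tend to Gaussians
    restricted to orthants, on which integrals determine a function. *)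
Lemma schwartz_separates (h : V -> R) (N : nat) :
  mu.-integrable [set: V] (fun p => (decay N p * h p)%:E) ->
  (forall phi, schwartz_real phi -> \int[mu]_p (h p * phi p) = 0) ->
  {ae mu, forall p, h p = 0}.
Proof.
move=> ih h0; pose w p := h p * gaussian p.
have gE p : w p = ((1 + `|p|) ^+ N * gaussian p) * (decay N p * h p).
  have : (1 + `|p|) ^+ N != 0 by rewrite expf_neq0// gt_eqF// ltr_pwDl.
  by rewrite /w /decay; move: ((1 + `|p|) ^+ N) => X X0; field.
have [C C0 hC] := gaussian_decay N.
have mg f : moderate f -> measurable_fun [set: V] f.
  by move=> mf; apply: continuous_measurable_rV2; apply: continuous_differentiable;
    exact: moderate_differentiable.
have mgauss : measurable_fun [set: V] gaussian.
  apply: (measurableT_comp (@measurable_expR R)); apply: measurable_funN.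
  by apply: mg; exact: moderate_sqnorm.
have mdh : measurable_fun [set: V] (fun p => decay N p * h p).
  by have /measurable_int/measurable_EFinP := ih.
have cX := @continuous_inv_decay R n N.
have mw : measurable_fun [set: V] w.
  rewrite (funext gE); apply: measurable_funM => //; apply: measurable_funM => //.
  exact: continuous_measurable_rV2.
have iw : mu.-integrable [set: V] (fun p => (w p)%:E).
  have := integrableZl_EFin C ih; apply: le_integrable => //; first exact/measurable_EFinP.
  move=> p _; rewrite /= lee_fin gE normrM [leRHS]normrM ler_wpM2r//.
  rewrite (ger0_norm C0) ger0_norm//.
  by rewrite mulr_ge0 ?expR_ge0// exprn_ge0// addr_ge0.
have mo b : measurable_fun [set: V] (fun p => \1_(orthant b) p : R).
  by apply: measurable_indic; exact: measurable_orthant.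
have o1 b (p : V) : `|\1_(orthant b) p : R| <= 1.
  by rewrite indicE; case: (_ \in _); rewrite ?normr1 ?normr0.
have E b : \int[mu]_p (w p * \1_(orthant b) p) = 0.
  have lim : ccvg (fun k => cintegral mu (fun p => (w p * test b k p)%:C))
      (cintegral mu (fun p => (w p * \1_(orthant b) p)%:C)).
    apply: (@cdominated_convergence _ _ _ _ _ _ (fun p => `|w p|)).
    - move=> k; apply: cmeasurableR; apply: measurable_funM => //.
      by apply: mg; exact: moderate_test.
    - by apply: cmeasurableR; exact: measurable_funM.
    - by move=> p; apply: ccvgR; apply: cvgM; [exact: cvg_cst|exact: cvg_test].
    - exact: (integrable_abse iw).
    - by move=> k p; rewrite norm1R normrM ler_piMr// ger0_norm.
  have zero k : cintegral mu (fun p => (w p * test b k p)%:C) = 0.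
    apply: complex_eq; rewrite /= ?Rintegral_cst ?mul0r//.
    rewrite -[RHS](h0 _ (moderate_gaussian_schwartz (moderate_test b k))).
    by apply: eq_Rintegral => p _; rewrite /w -mulrA [gaussian p * _]mulrC.
  rewrite (funext zero) in lim.
  by have /(congr1 (@complex.Re R)) := ccvg_unique lim (ccvg_cst 0).
have w0 A : range orthant A -> (\int[mu]_(p in A) (w p)%:E = 0)%E.
  move=> [b _ <-]; rewrite integral_mkcond.
  have iwb : mu.-integrable [set: V] (fun p => (w p * \1_(orthant b) p)%:E).
    apply: le_integrable iw => //; first by apply/measurable_EFinP; exact: measurable_funM.
    by move=> p _; rewrite /= lee_fin normrM ler_piMr.
  rewrite (eq_integral (fun p => (w p * \1_(orthant b) p)%:E)); last first.
    by move=> p _; rewrite patchE indicE; case: (_ \in _); rewrite ?mulr1 ?mulr0.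
  by rewrite -[LHS]fineK ?integrable_fin_num// -/(Rintegral _ _ _) E.
have := integrable_ae_eq0 measurable_orthantE setI_closed_orthant
  (fun k => ex_intro2 _ _ _ I erefl) bigcup_orthant iw w0.
apply: filterS => p /(_ I) [] /eqP; rewrite /w mulf_eq0 => /orP[/eqP//|].
by rewrite gt_eqF// expR_gt0.
Qed.

End test_functions.

(** * Fourier transforms of integrable functions and of tempered functions *)

Section scalars_and_null_sets.
Context d (T : measurableType d) (R : realType) (mu : {measure set T -> \bar R}).

(** Unlike [cintegralZ], this also holds when the integral diverges, as it may on
    a null set of slices. *)
Lemma cintegralRZ (r : R) (F : T -> R[i]) : 0 < r -> cmeasurable F ->
  cintegral mu (fun x => r%:C * F x) = r%:C * cintegral mu F.
Proof.
move=> r0 [F1 F2].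
have key (h : T -> R) : measurable_fun setT h ->
    \int[mu]_x (r * h x) = r * \int[mu]_x h x.
  move=> mh; rewrite /Rintegral integralE [in RHS]integralE.
  have mEh : measurable_fun [set: T] (EFin \o h) by exact/measurable_EFinP.
  have -> : (\int[mu]_x (fun x => (r * h x)%:E)^\+ x =
      r%:E * \int[mu]_x (fun x => (h x)%:E)^\+ x)%E.
    rewrite -ge0_integralZl//; last 2 first.
    - exact: measurable_funepos.
    - by rewrite lee_fin ltW.
    by apply: eq_integral => x _; rewrite !funeposE maxe_pMr ?lee_fin ?ltW// mule0.
  have -> : (\int[mu]_x (fun x => (r * h x)%:E)^\- x =
      r%:E * \int[mu]_x (fun x => (h x)%:E)^\- x)%E.
    rewrite -ge0_integralZl//; last 2 first.
    - exact: measurable_funeneg.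
    - by rewrite lee_fin ltW.
    apply: eq_integral => x _.
    by rewrite !funenegE maxe_pMr ?lee_fin ?ltW// mule0 muleN -EFinM.
  have a0 : (0 <= \int[mu]_x (fun x => (h x)%:E)^\+ x)%E by exact: integral_ge0.
  have b0 : (0 <= \int[mu]_x (fun x => (h x)%:E)^\- x)%E by exact: integral_ge0.
  case: (\int[mu]_x _)%E a0 => [a| |]// _; case: (\int[mu]_x _)%E b0 => [b| |]// _.
  - by rewrite -!EFinM -!EFinB /= mulrBr.
  - by rewrite gt0_muley ?lte_fin//= mulr0.
  - by rewrite gt0_muley ?lte_fin//= mulr0.
  - by rewrite !gt0_muley ?lte_fin//= mulr0.
apply: complex_eq; rewrite ?complexReM ?complexImM /= ?mul0r ?subr0 ?addr0 -key//.
- by apply: eq_Rintegral => x _; rewrite complexReM /= mul0r subr0.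
- by apply: eq_Rintegral => x _; rewrite complexImM /= mul0r addr0.
Qed.

Lemma ae_cintegrable (F G : T -> R[i]) : cmeasurable F -> cintegrable mu G ->
  {ae mu, forall x, F x = G x} -> cintegrable mu F.
Proof.
move=> mF iG FG; have mG := cintegrable_cmeasurable iG.
apply: cintegrable_ltyP => //.
rewrite (_ : \int[mu]_x _ = \int[mu]_x (norm1 (G x))%:E)%E; first exact: cintegrable_lty.
apply: ge0_ae_eq_integral => //.
- exact/measurable_EFinP/measurable_norm1.
- exact/measurable_EFinP/measurable_norm1.
- by move=> x _; rewrite lee_fin norm1_ge0.
- by move=> x _; rewrite lee_fin norm1_ge0.
- by apply: filterS FG => x -> .
Qed.

End scalars_and_null_sets.

Lemma ae_cintegrable_slice d1 d2 (T1 : measurableType d1) (T2 : measurableType d2)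
    (R : realType) (m1 : {sigma_finite_measure set T1 -> \bar R})
    (m2 : {sigma_finite_measure set T2 -> \bar R}) (F : T1 * T2 -> R[i]) :
  cintegrable (m1 \x m2)%E F ->
  {ae m1, forall x, cintegrable m2 (fun y => F (x, y))}.
Proof.
by move=> [/ae_integrable1 F1 /ae_integrable1 F2]; apply: filterS2 F1 F2.
Qed.

Section phase_integrals.
Context {R : realType} {n : nat}.
Local Notation V := (rV2 R n).
Local Notation mu := (@lebesgue2 R n).
Implicit Types f : V -> R[i].

Let mphase (s : R) : measurable_fun [set: V * V] (fun z => s * dot2 z.1 z.2).
Proof. exact: (measurableT_comp (mulrl_measurable _) (@measurable_dot2 R n)). Qed.

Lemma cintegrable_phase2 (s : R) f f' : cintegrable mu f -> cintegrable mu f' ->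
  cintegrable (mu \x mu)%E (fun z => cis (s * dot2 z.1 z.2) * (f z.1 * f' z.2)).
Proof.
move=> jf jf'; have jp := cintegrable_pairM jf jf'.
apply: (cintegrable_le (B := fun z => 2 * norm1 (f z.1 * f' z.2))).
- apply: cmeasurableM; first by apply: cmeasurable_cis; exact: mphase.
  exact: (cintegrable_cmeasurable jp).
- exact: (integrableZl_EFin 2 (cintegrable_norm1 jp)).
- move=> z; apply: le_trans (norm1M _ _) _.
  by rewrite ler_wpM2r ?norm1_ge0// norm1_cis.
Qed.

(** An integrable factor f' makes the double integral converge; with a decaying
    f' this gives both measurability and temperedness of Fourier integrals. *)
Lemma cintegrable_phase_integral (s : R) f f' : cintegrable mu f -> cintegrable mu f' ->
  cintegrable mu (fun xi => f' xi * cintegral mu (fun p => cis (s * dot2 p xi) * f p)).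
Proof.
move=> jf jf'; have [+ _] := cfubini2 (cintegrable_phase2 s jf jf').
congr cintegrable; apply/funext => xi /=.
rewrite -cintegralZ; last first.
  apply: cintegrable_phase => //.
  exact: (measurableT_comp (mulrl_measurable _) (measurable_dot2r xi)).
by apply: eq_cintegral => p; rewrite mulrA mulrC.
Qed.

Lemma cmeasurable_phase_integral (s : R) f : cintegrable mu f ->
  cmeasurable (fun xi => cintegral mu (fun p => cis (s * dot2 p xi) * f p)).
Proof.
move=> jf; have jd := cintegrableR (@integrable_decay R n).
have mj := cintegrable_cmeasurable (cintegrable_phase_integral s jf jd).
have mV : cmeasurable (fun xi : V => ((decay (4 * n) xi)^-1)%:C).
  apply: cmeasurableR.
  rewrite (_ : (fun _ => _) = fun p : V => (1 + `|p|) ^+ (4 * n)).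
    exact: measurable_inv_decay.
  by apply/funext => p; rewrite /decay invrK.
have := cmeasurableM mV mj; congr cmeasurable; apply/funext => xi.
have h : (decay (4 * n) xi)^-1 * decay (4 * n) xi = 1.
  by rewrite mulVf// gt_eqF// decay_gt0.
by rewrite mulrA -(rmorphM (@real_complex R)) h mul1r.
Qed.

Lemma fourier2E f xi :
  fourier2 f xi = cintegral mu (fun p => cis (- (2 * pi) * dot2 p xi) * f p).
Proof. by apply: eq_cintegral => p; rewrite mulNr. Qed.

Lemma fourier2_invE f p :
  fourier2_inv f p = cintegral mu (fun xi => cis (2 * pi * dot2 xi p) * f xi).
Proof. by apply: eq_cintegral => xi; rewrite dot2C. Qed.

Lemma cmeasurable_fourier2 f : cintegrable mu f -> cmeasurable (fourier2 f).
Proof. by rewrite (funext (fourier2E f)); exact: cmeasurable_phase_integral. Qed.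

Lemma schwartz_cintegrable_fourier2 f : schwartz f -> cintegrable mu (fourier2 f).
Proof.
move=> sf; have [C _ hC] := fourier2_decay sf (4 * n).
apply: cintegrable_decay hC; exact/cmeasurable_fourier2/schwartz_cintegrable.
Qed.

Lemma schwartz_inversion f : schwartz f -> fourier2_inv (fourier2 f) = f.
Proof.
move=> sf; have [s1 s2] := sf; have [M _ hM] := schwartz_decay sf 0.
apply: (@fourier2_inversion _ _ _ M).
- exact: schwartz_cintegrable.
- by move=> p; have := hM p; rewrite /decay expr0 invr1 mulr1.
- by apply: continuous_differentiable; exact: schwartz_real_differentiable.
- by apply: continuous_differentiable; exact: schwartz_real_differentiable.
- exact: schwartz_cintegrable_fourier2.
Qed.

(** The tempered Fourier transform of the inverse transform of an integrable
    function is that function. *)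
Lemma is_fourier_transform_inv (G : V -> R[i]) : cintegrable mu G ->
  is_fourier_transform (fourier2_inv G) G.
Proof.
move=> jG; split.
- exists (4 * n)%N; rewrite (funext (fourier2_invE G)).
  exact: (cintegrable_phase_integral (2 * pi) jG (cintegrableR (@integrable_decay R n))).
- by exists 0%N; under eq_fun do rewrite expr0 invr1 mul1r.
move=> phi sphi; have jphi := schwartz_cintegrable_fourier2 sphi.
have jj := cintegrable_phase2 (2 * pi) jphi jG.
have [_ E1] := cfubini1 jj; have [_ E2] := cfubini2 jj.
have mph (p : V) : measurable_fun [set: V] (fun xi => 2 * pi * dot2 p xi).
  exact: (measurableT_comp (mulrl_measurable _) (measurable_dot2l p)).
have mph' (p : V) : measurable_fun [set: V] (fun xi => 2 * pi * dot2 xi p).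
  exact: (measurableT_comp (mulrl_measurable _) (measurable_dot2r p)).
transitivity (cintegral (mu \x mu)%E
    (fun z => cis (2 * pi * dot2 z.1 z.2) * (fourier2 phi z.1 * G z.2))).
  rewrite E1; apply: eq_cintegral => p /=; rewrite mulrC -cintegralZ.
    by apply: eq_cintegral => xi; rewrite mulrCA.
  exact: cintegrable_phase.
rewrite E2; apply: eq_cintegral => xi /=.
rewrite -[in RHS](schwartz_inversion sphi) fourier2_invE -cintegralZ.
  by apply: eq_cintegral => p; rewrite mulrA mulrC.
exact: cintegrable_phase.
Qed.

(** [schwartz_separates] applies to the difference of the real parts and to that
    of the imaginary parts, since real test functions are allowed. *)
Lemma is_fourier_transform_ae (h G H : V -> R[i]) :
  is_fourier_transform h G -> is_fourier_transform h H ->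
  {ae mu, forall p, H p = G p}.
Proof.
move=> [_ [N1 jG] hG] [_ [N2 jH] hH]; pose N := (N1 + N2)%N.
have dec (K : V -> R[i]) (M : nat) : (M <= N)%N ->
    cintegrable mu (fun p => ((1 + `|p|) ^- M)%:C * K p) ->
    cintegrable mu (fun p => (decay N p)%:C * K p).
  move=> MN jK; have mK := cintegrable_cmeasurable jK.
  have E p : (decay N p)%:C * K p = (decay (N - M) p)%:C * (((1 + `|p|) ^- M)%:C * K p).
    rewrite mulrA -(rmorphM (@real_complex R)) /= /decay -invfM -exprD.
    by rewrite subnK.
  rewrite (funext E).
  apply: (cintegrable_le (B := fun p : V => norm1 (((1 + `|p|) ^- M)%:C * K p))).
  - by apply: cmeasurableM => //; apply: cmeasurableR; exact: measurable_decay.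
  - exact: cintegrable_norm1.
  - move=> p; rewrite norm1RM ler_piMl ?norm1_ge0// ger0_norm ?(ltW (decay_gt0 _ _))//.
    by rewrite invf_le1 ?exprn_gt0 ?ltr_pwDl// exprn_ege1// lerDl.
have [jG1 jG2] := dec G N1 (leq_addr _ _) jG.
have [jH1 jH2] := dec H N2 (leq_addl _ _) jH.
have real_int (K : V -> R) (phi : V -> R) :
    mu.-integrable setT (fun p => (decay N p * K p)%:E) -> schwartz_real phi ->
    mu.-integrable setT (fun p => (K p * phi p)%:E).
  move=> iK sphi; have [C C0 hC] := schwartz_real_decay sphi N.
  have E p : K p * phi p = ((1 + `|p|) ^+ N * phi p) * (decay N p * K p).
    have : (1 + `|p|) ^+ N != 0 by rewrite expf_neq0// gt_eqF// ltr_pwDl.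
    by rewrite /decay; move: ((1 + `|p|) ^+ N) => X X0; field.
  have cphi : continuous phi.
    by apply: continuous_differentiable; exact: schwartz_real_differentiable.
  have mK : measurable_fun setT (fun p => decay N p * K p).
    by have /measurable_int/measurable_EFinP := iK.
  have cX : continuous (fun p : V => (1 + `|p|) ^+ N * phi p).
    by move=> p; apply: cvgM; [exact: continuous_inv_decay|exact: cphi].
  have := integrableZl_EFin C iK; apply: le_integrable => //.
    apply/measurable_EFinP; rewrite (funext E); apply: measurable_funM => //.
    exact: continuous_measurable_rV2.
  move=> p _; rewrite /= lee_fin E normrM [leRHS]normrM ler_wpM2r//.
  rewrite normrM (ger0_norm C0) ger0_norm ?exprn_ge0 ?addr_ge0// mulrC.
  by rewrite -ler_pdivlMr ?exprn_gt0 ?ltr_pwDl//; exact: hC.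
have key (P : R[i] -> R) : (forall z (r : R), P (z * r%:C) = P z * r) ->
    (forall F, P (cintegral mu F) = \int[mu]_p P (F p)) ->
    mu.-integrable setT (fun p => (decay N p * P (G p))%:E) ->
    mu.-integrable setT (fun p => (decay N p * P (H p))%:E) ->
    {ae mu, forall p, P (H p) = P (G p)}.
  move=> PM PI iG iH.
  have : {ae mu, forall p, P (H p) - P (G p) = 0}.
    apply: (@schwartz_separates _ _ _ N).
      under eq_fun do rewrite mulrBr EFinB; exact: integrableB.
    move=> phi sphi; under eq_Rintegral do rewrite mulrBl.
    rewrite RintegralB//; [|exact: real_int|exact: real_int].
    have sc : schwartz (fun p => (phi p)%:C : R[i]).
      split => //=; have := moderate_gaussian_schwartz (@moderate_cst R n 0).
      by under eq_fun do rewrite mul0r.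
    have := congr1 P (etrans (esym (hH _ sc)) (hG _ sc)).
    rewrite !PI; under eq_Rintegral do rewrite PM.
    by under [X in _ = X]eq_Rintegral do rewrite PM; move=> ->; rewrite subrr.
  by apply: filterS => p /eqP; rewrite subr_eq0 => /eqP.
have ReE (K : V -> R[i]) : (fun p => (complex.Re ((decay N p)%:C * K p))%:E) =
    (fun p => (decay N p * complex.Re (K p))%:E).
  by apply/funext => p; rewrite complexReM /= mul0r subr0.
have ImE (K : V -> R[i]) : (fun p => (complex.Im ((decay N p)%:C * K p))%:E) =
    (fun p => (decay N p * complex.Im (K p))%:E).
  by apply/funext => p; rewrite complexImM /= mul0r addr0.
have kRe : {ae mu, forall p, complex.Re (H p) = complex.Re (G p)}.
  apply: key; rewrite -?ReE// => z r; by rewrite complexReM /= mulr0 subr0.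
have kIm : {ae mu, forall p, complex.Im (H p) = complex.Im (G p)}.
  apply: key; rewrite -?ImE// => z r; by rewrite complexImM /= mulr0 add0r.
by apply: filterS2 kRe kIm => p; exact: complex_eq.
Qed.

End phase_integrals.

(** * The inversion formula *)

Section radial_weight.
Context {R : realType}.

(** By the inequality s^2 + t^2 >= |s| |t|, the singularity of order beta < 2 at
    the origin of the plane splits into two singularities of order beta / 2 < 1
    on the line, which are integrable. *)
Lemma radial_weight_le (beta : R) : beta < 2 ->
  exists g m, [/\ 0 <= g, g < 1 & forall s t : R, s != 0 -> t != 0 ->
    Num.sqrt (s ^+ 2 + t ^+ 2) `^ (- beta) <=
    (`|s| `^ (- g) * (1 + s ^+ 2) ^+ m) * (`|t| `^ (- g) * (1 + t ^+ 2) ^+ m)].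
Proof.
move=> beta2; have [b0|b0] := leP beta 0.
  (* no singularity: the norm is at most P >= 1, and the exponent at most m *)
  exists 0, (Num.bound (- beta)); split => // s t s0 t0.
  rewrite oppr0 !powRr0 !mul1r -exprMn; set P := (1 + s ^+ 2) * (1 + t ^+ 2).
  have s2 := sqr_ge0 s; have t2 := sqr_ge0 t.
  have P1 : 1 <= P by rewrite /P; nra.
  have rP : Num.sqrt (s ^+ 2 + t ^+ 2) <= P.
    rewrite -[leRHS](ger0_norm (le_trans ler01 P1)) -sqrtr_sqr; apply: ler_wsqrtr.
    have : s ^+ 2 + t ^+ 2 <= P by rewrite /P; nra.
    by nra.
  rewrite -[leRHS]powR_mulrn ?(le_trans ler01 P1)//.
  apply: (@le_trans _ _ (P `^ (- beta))).
    by apply: ge0_ler_powR; rewrite ?nnegrE ?sqrtr_ge0 ?oppr_ge0 ?(le_trans ler01 P1)//.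
  by rewrite ler_powR// ltW// archi_boundP// oppr_ge0.
exists (beta / 2), 0%N; split; [by rewrite divr_ge0// ltW|by rewrite ltr_pdivrMr// mul1r|].
move=> s t s0 t0; rewrite !expr0 !mulr1.
have s1 : 0 < `|s| by rewrite normr_gt0.
have t1 : 0 < `|t| by rewrite normr_gt0.
have st : 0 <= s ^+ 2 + t ^+ 2 by rewrite addr_ge0 ?sqr_ge0.
set c := beta / 2; have bE : beta = 2%:R * c by rewrite /c mulrC divfK.
rewrite -powRM// !powRN bE powRrM powR_mulrn ?sqrtr_ge0// sqr_sqrtr//.
rewrite lef_pV2 ?posrE ?powR_gt0 ?mulr_gt0//; last first.
  by rewrite ltr_pwDl// ?sqr_ge0// exprn_even_gt0.
apply: ge0_ler_powR; rewrite ?nnegrE ?mulr_ge0 ?divr_ge0// ?ltW//.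
rewrite -(real_normK (num_real s)) -(real_normK (num_real t)).
have := sqr_ge0 (`|s| - `|t|); nra.
Qed.

End radial_weight.

Section inversion_formula.
Context {R : realType} {n : nat}.
Local Notation Rn := 'rV[R]_n.
Local Notation V := (rV2 R n).
Local Notation mu := (@lebesgue2 R n).
Implicit Types (f : V -> R[i]) (alpha xi : Rn).

Definition radial (b : R) (eta : V) : R :=
  \prod_i Num.sqrt ((eta.1 ord0 i) ^+ 2 + (eta.2 ord0 i) ^+ 2) `^ (- b).

Lemma radial_ge0 b eta : 0 <= radial b eta.
Proof. by apply: prodr_ge0 => i _; exact: powR_ge0. Qed.

Lemma measurable_radial b : measurable_fun [set: V] (radial b).
Proof.
apply: measurable_prod => i _.
apply: (measurableT_comp (measurable_powR (- b))).
apply: (measurableT_comp (continuous_measurable_fun (@sqrt_continuous R))).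
apply: measurable_funD; apply: measurable_funX.
- exact: measurable_coord2_fst.
- exact: measurable_coord2_snd.
Qed.

(** Off the coordinate hyperplanes the integrand is at most a product over the 2n
    coordinates of the weights of [integrable_singular_weight]. *)
Lemma cintegrable_radial_fourier2 f (b : R) : schwartz f -> b < 2 ->
  cintegrable mu (fun eta => (radial b eta)%:C * fourier2 f eta).
Proof.
move=> sf b2; have [g [m [g0 g1 hgm]]] := radial_weight_le b2.
(* one factor (1 + s^2)(1 + t^2) per plane is kept for integrability, the other m
   compensate the growth of the radial weight *)
have [C C0 hC] := fourier2_decay sf (4 * n * m.+1).
pose w (s : R) := `|s| `^ (- g) / (1 + s ^+ 2).
have iw : (leb R).-integrable setT (fun s => (w s)%:E) by exact: integrable_singular_weight.
have iB := integrableZl_EFin C (integrable_prod (fun i : 'I_n => integrable_pairM iw iw)).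
have mG : cmeasurable (fun eta => (radial b eta)%:C * fourier2 f eta).
  apply: cmeasurableM; first by apply: cmeasurableR; exact: measurable_radial.
  exact/cmeasurable_fourier2/schwartz_cintegrable.
apply: cintegrable_ltyP => //.
have w0 s : 0 <= w s by rewrite divr_ge0 ?powR_ge0// addr_ge0 ?sqr_ge0.
apply: (@le_lt_trans _ _ (\int[mu]_eta
    (C * \prod_i (w (coord2 eta i).1 * w (coord2 eta i).2))%:E)%E); last first.
  exact: integrable_lty iB.
apply: ae_ge0_le_integral => //.
- by move=> eta _; rewrite lee_fin norm1_ge0.
- exact/measurable_EFinP/measurable_norm1.
- by move=> eta _; rewrite lee_fin mulr_ge0// prodr_ge0// => i _; rewrite mulr_ge0.
- exact: measurable_int iB.
apply: filterS (ae_coord2_neq0 n) => eta eta0 _; rewrite lee_fin.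
rewrite norm1RM ger0_norm ?radial_ge0//.
have p0 (x : R) : 0 < 1 + x ^+ 2 by rewrite ltr_pwDl// sqr_ge0.
pose P := \prod_i ((1 + (eta.1 ord0 i) ^+ 2) * (1 + (eta.2 ord0 i) ^+ 2)).
have P0 : 0 < P by apply: prodr_gt0 => i _; rewrite mulr_gt0.
have hP : decay (4 * n * m.+1) eta <= P ^- m.+1.
  rewrite /decay exprM lef_pV2 ?posrE ?exprn_gt0 ?ltr_pwDl//.
  by apply: lerXn2r; rewrite ?nnegrE ?exprn_ge0 ?addr_ge0 ?(ltW P0)//; exact: weight_le_norm.
apply: (@le_trans _ _ (radial b eta * (C * P ^- m.+1))).
  rewrite ler_wpM2l ?radial_ge0//; apply: le_trans (hC eta) _.
  by rewrite ler_wpM2l.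
rewrite mulrCA ler_wpM2l// /P -prodrXl -prodfV -big_split /=.
have q0 (i : 'I_n) :
    0 <= (((1 + (eta.1 ord0 i) ^+ 2) * (1 + (eta.2 ord0 i) ^+ 2)) ^+ m.+1)^-1.
  by rewrite invr_ge0 exprn_ge0// mulr_ge0 ?ltW.
apply: ler_prod => i _; rewrite mulr_ge0 ?powR_ge0//=.
have [e1 e2] := eta0 i.
apply: le_trans (ler_wpM2r (q0 i) (hgm _ _ e1 e2)) _.
rewrite le_eqVlt; apply/orP; left; apply/eqP; rewrite /w /coord2 /=.
move: (`|_| `^ _) (`|_| `^ _) => A B.
move: (p0 (eta.1 ord0 i)) (p0 (eta.2 ord0 i)).
move: (1 + (eta.1 ord0 i) ^+ 2) (1 + (eta.2 ord0 i) ^+ 2) => X Y X0 Y0.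
rewrite exprMn !exprS; field.
by rewrite !expf_neq0 !gt_eqF.
Qed.

Definition slice alpha xi : V :=
  (\row_i (alpha ord0 i * xi ord0 i), \row_i ((1 - alpha ord0 i) * xi ord0 i)).

(** The Fourier slice theorem: the phase is constant along the lines on which f is
    integrated, so it can be moved inside the line integrals. This is done for
    almost every line, namely where f is known to be integrable by Fubini. *)
Lemma fourier1_photo f alpha xi : schwartz f ->
  fourier1 (photo f alpha) xi = fourier2 f (slice alpha xi).
Proof.
move=> sf.
pose T (i : 'I_n) (z : measurableTypeR R * measurableTypeR R) :=
  (line_x (alpha ord0 i) z.1 z.2 : measurableTypeR R,
   line_u (alpha ord0 i) z.1 z.2 : measurableTypeR R).
have sT := substitution_coord2 (fun i => substitution_line (alpha ord0 i)).
pose rho : R := \prod_i line_weight (alpha ord0 i).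
have rho0 : 0 < rho.
  apply: prodr_gt0 => i _; rewrite /line_weight; case: eqVneq => // a0.
  by rewrite invr_gt0 normr_gt0.
have jf := schwartz_cintegrable sf; have mf := schwartz_cmeasurable sf.
pose L (y t : Rn) : V := (\row_i line_x (alpha ord0 i) (y ord0 i) (t ord0 i),
  \row_i line_u (alpha ord0 i) (y ord0 i) (t ord0 i)).
have jfT : cintegrable mu (fun z => rho%:C * f (L z.1 z.2)).
  exact/(substitution_cintegrable sT mf).
have dotL y t : dot2 (L y t) (slice alpha xi) = dot y xi.
  rewrite /dot2 /dot -big_split; apply: eq_bigr => i _; rewrite /= !mxE.
  rewrite /line_x /line_u; case: eqVneq => [->|a0]; first by ring.
  by field.
pose e (q : V) : R[i] := cis (- (2 * pi * dot2 q (slice alpha xi))).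
have me : cmeasurable e.
  rewrite /e; under eq_fun do rewrite -mulNr; exact: cmeasurable_phase.
have mPsi : cmeasurable (fun q => e q * f q) by exact: cmeasurableM.
have jPsi : cintegrable mu (fun q => e q * f q).
  apply: cintegrable_phase => //; under eq_fun do rewrite -mulNr.
  exact: (measurableT_comp (mulrl_measurable _) (measurable_dot2r _)).
have jPT := proj2 (substitution_cintegrable sT mPsi) jPsi.
rewrite /fourier2 /fourier -[RHS](substitution_cintegral sT mPsi).
have [_ ->] := cfubini1 (m1 := lebesgue_rV R n) (m2 := lebesgue_rV R n) jPT.
have [jP1 _] := cfubini1 (m1 := lebesgue_rV R n) (m2 := lebesgue_rV R n) jPT.
have [jf1 _] := cfubini1 (m1 := lebesgue_rV R n) (m2 := lebesgue_rV R n) jfT.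
have photoE' y : photo f alpha y =
    cintegral (lebesgue_rV R n) (fun t => rho%:C * f (L y t)).
  rewrite cintegralRZ//; have [mT _ _ _] := sT.
  have := cmeasurable_comp mf mT => mfT.
  exact: (cmeasurable_comp mfT (measurable_pair1 y)).
apply: ae_eq_cintegral; last first.
- apply: filterS (ae_cintegrable_slice (m1 := lebesgue_rV R n) (m2 := lebesgue_rV R n) jfT).
  move=> y jy; rewrite photoE' -cintegralZ//; apply: eq_cintegral => t.
  rewrite -[RHS]/(rho%:C * (e (L y t) * f (L y t))) mulrCA; congr (_ * _).
  by rewrite /e dotL.
- exact: cintegrable_cmeasurable jP1.
- apply: cmeasurableM; last first.
    by rewrite (funext photoE'); exact: cintegrable_cmeasurable jf1.
  under eq_fun do rewrite -mulNr.
  apply: cmeasurable_cis; apply: (measurableT_comp (mulrl_measurable _)).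
  apply: measurable_sum => i; apply: measurable_funM; last exact: measurable_cst.
  exact: measurable_coordinate.
Qed.

(** Unfolding the left-hand side gives an iterated integral in (alpha, xi), which
    [substitution_slices] turns into an integral over the Fourier space R^2n. *)
Lemma photo_dual_weighted_Ibar f (b : R) : schwartz f -> b < 2 ->
  photo_dual_weighted b (Ibar (b - 1) (photo f)) =
  fourier2_inv (fun eta => (radial b eta)%:C * fourier2 f eta).
Proof.
move=> sf b2; apply/funext => p.
set G := (fun eta => (radial b eta)%:C * fourier2 f eta).
have jG : cintegrable mu G by exact: cintegrable_radial_fourier2.
pose Phi eta := cis (2 * pi * dot2 p eta) * G eta.
have jPhi : cintegrable mu Phi.
  apply: cintegrable_phase => //.
  exact: (measurableT_comp (mulrl_measurable _) (measurable_dot2l _)).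
have mPhi := cintegrable_cmeasurable jPhi.
have sT := substitution_coord2 (fun i : 'I_n => @substitution_slices R).
have jPT := proj2 (substitution_cintegrable sT mPhi) jPhi.
have [mT _ _ _] := sT.
pose q (a : R) : R := a ^+ 2 + (1 - a) ^+ 2.
have q0 a : 0 < q a by rewrite /q; nra.
pose w alpha : R := \prod_i q (alpha ord0 i) `^ (- b / 2).
have w0 alpha : 0 < w alpha by apply: prodr_gt0 => i _; rewrite powR_gt0.
pose y alpha : Rn := \row_i (alpha ord0 i * p.1 ord0 i + (1 - alpha ord0 i) * p.2 ord0 i).
pose X (z : V) : R[i] := cis (2 * pi * dot (y z.1) z.2) *
  ((\prod_i `|z.2 ord0 i| `^ (- (b - 1)))%:C * fourier2 f (slice z.1 z.2)).
have dot_y alpha xi : dot (y alpha) xi = dot2 p (slice alpha xi).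
  rewrite /dot2 /dot -big_split; apply: eq_bigr => i _; rewrite /= !mxE; ring.
have mX : cmeasurable X.
  have mT' : measurable_fun [set: V] (fun z : V => slice z.1 z.2) by exact: mT.
  apply: cmeasurableM; last apply: cmeasurableM.
  - under eq_fun do rewrite dot_y.
    apply: cmeasurable_cis; apply: (measurableT_comp (mulrl_measurable _)).
    exact: (measurableT_comp (measurable_dot2l p) mT').
  - apply: cmeasurableR; apply: measurable_prod => i _.
    apply: (measurableT_comp (measurable_powR _)).
    apply: (measurableT_comp (@normr_measurable R setT)).
    exact: measurable_coord2_snd.
  - apply: (cmeasurable_comp (h := fun z : V => slice z.1 z.2) _ mT').
    exact/cmeasurable_fourier2/schwartz_cintegrable.
have mw : measurable_fun [set: V] (fun z : V => w z.1).
  apply: measurable_prod => i _; apply: (measurableT_comp (measurable_powR _)).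
  have mc := @measurable_coord2_fst R n i.
  apply: measurable_funD; apply: measurable_funX => //.
  by apply: measurable_funB => //; exact: measurable_cst.
have mJ : cmeasurable (fun z : V => (w z.1)%:C * X z).
  by apply: cmeasurableM => //; exact: cmeasurableR.
(* w(a) |x|^(1-b) = |x| norm(a x, (1-a) x)^(-b), for x != 0 in each plane *)
have JE : {ae mu, forall z : V, (w z.1)%:C * X z =
    (\prod_i `|(coord2 z i).2|)%:C * Phi (slice z.1 z.2)}.
  apply: filterS (ae_coord2_neq0 n) => z z0; rewrite /X /Phi dot_y /G.
  rewrite mulrCA [RHS]mulrCA; congr (_ * _); rewrite !mulrA; congr (_ * _).
  rewrite -!(rmorphM (@real_complex R)); congr (_ %:C).
  rewrite /w /radial -!big_split /=; apply: eq_bigr => i _; rewrite !mxE.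
  have [_ x0] := z0 i; set x := z.2 ord0 i in x0 *; set a := z.1 ord0 i.
  have nx : 0 < `|x| by rewrite normr_gt0.
  rewrite (_ : (a * x) ^+ 2 + ((1 - a) * x) ^+ 2 = q a * x ^+ 2); last by rewrite /q; ring.
  rewrite sqrtrM ?(ltW (q0 a))// sqrtr_sqr powRM ?sqrtr_ge0//.
  rewrite -powR12_sqrt ?(ltW (q0 a))// -powRrM.
  rewrite mulrCA -{2}(powRr1 (ltW nx)) -powRD ?(gt_eqF nx) ?implybT//.
  by congr (_ `^ _ * _ `^ _); [rewrite mulrC|ring].
have jJ := ae_cintegrable mJ jPT JE.
have [_ E] := cfubini1 (m1 := lebesgue_rV R n) (m2 := lebesgue_rV R n) jJ.
transitivity (cintegral mu (fun z : V => (w z.1)%:C * X z)); last first.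
  rewrite -[RHS](substitution_cintegral sT mPhi); apply: ae_eq_cintegral => //.
  exact: cintegrable_cmeasurable jPT.
rewrite [RHS]E; apply: eq_cintegral => alpha /=.
rewrite cintegralRZ//; last exact: (cmeasurable_comp mX (measurable_pair1 alpha)).
congr (_ * _); apply: eq_cintegral => xi; congr (_ * (_ * _)).
exact: fourier1_photo.
Qed.

End inversion_formula.

Theorem proposition5p4 (R : realType) (n : nat)
    (f : 'rV[R]_n * 'rV[R]_n -> R[i]) (beta : R) :
  schwartz f -> beta < 2 ->
  let g := photo f in
  f = Icbar (- beta) (photo_dual_weighted beta (Ibar (beta - 1) g)).
Proof.
move=> sf b2 /=; rewrite photo_dual_weighted_Ibar//.
set G := fun eta => (radial beta eta)%:C * fourier2 f eta.
have jG : cintegrable (@lebesgue2 R n) G by exact: cintegrable_radial_fourier2.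
have hG := is_fourier_transform_inv jG.
have hH : is_fourier_transform (fourier2_inv G) (tempered_fourier (fourier2_inv G)).
  exact: (xgetPex (fun=> 0) (ex_intro _ G hG)).
set H := tempered_fourier _ in hH *.
have [_ [N jH] _] := hH.
have mH : cmeasurable H.
  have := cmeasurableM (cmeasurableR (measurable_inv_decay N)) (cintegrable_cmeasurable jH).
  congr cmeasurable; apply/funext => p.
  have e : (1 + `|p|) ^+ N * (1 + `|p|) ^- N = 1 :> R.
    by rewrite mulfV// expf_neq0// gt_eqF// ltr_pwDl.
  by rewrite mulrA -(rmorphM (@real_complex R)) e mul1r.
rewrite -[LHS](schwartz_inversion sf); apply/funext => p.
have jF := schwartz_cintegrable_fourier2 sf.
have mphase : cmeasurable (fun xi : rV2 R n => cis (2 * pi * dot2 p xi)).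
  apply: cmeasurable_cis; apply: (measurableT_comp (mulrl_measurable _)).
  exact: measurable_dot2l.
apply: ae_eq_cintegral.
- by apply: cmeasurableM => //; exact: cintegrable_cmeasurable jF.
- apply: cmeasurableM => //; apply: cmeasurableM => //; apply: cmeasurableR.
  exact: (measurable_radial (- beta)).
apply: filterS2 (is_fourier_transform_ae hG hH) (ae_coord2_neq0 n) => xi HG xi0.
rewrite -[RHS]/(cis (2 * pi * dot2 p xi) * ((radial (- beta) xi)%:C * H xi)) HG /G.
rewrite [(radial (- beta) xi)%:C * _]mulrA -(rmorphM (@real_complex R)).
rewrite (_ : radial (- beta) xi * radial beta xi = 1) ?mul1r//.
rewrite /radial -big_split big1// => i _ /=; have [x0 _] := xi0 i.
rewrite opprK powRN mulfV// gt_eqF// powR_gt0// sqrtr_gt0 ltr_pwDl ?sqr_ge0//.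
by rewrite exprn_even_gt0.
Qed.
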